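(* Let $T>0$, $L>0$, $a\in C([0,T])$ and initial data $\rho_0^\pm$ be as in the context, and let $M\ge1$ be an integer. Let $(N_m)_{m\in\mathbb N}$ and $(N_{T,m})_{m\in\mathbb N}$ be sequences of positive integers, $\Delta x_m=1/N_m$, $\Delta t_m=T/N_{T,m}$, such that $M\le N_m$ for all $m$, $\varepsilon_m=\max(\Delta t_m,\Delta x_m)\to0$ as $m\to\infty$, and for all $m$ $$\frac{\Delta t_m}{\Delta x_m}<\min\left\{\frac{1}{4(4M^2L+\|a\|_{L^\infty(0,T)})},\ \frac{1}{18M^2L}\right\},\qquad \Delta t_m<\frac{1}{2L(4M^2L+\|a\|_{L^\infty(0,T)})}.$$ Let $\rho_M^{\pm,\mathrm{per},m}$ be the $Q^1$ reconstruction (R) of the solution of the scheme (S) (see context) with $N=N_m$, $N_T=N_{T,m}$. Then there exist functions $\rho_M^{\pm,\mathrm{per}}\in W^{1,\infty}((0,T)\times\mathbb T^2)$ such that, up to a subsequence, as $m\to\infty$, $$\rho_M^{\pm,\mathrm{per},m}\to\rho_M^{\pm,\mathrm{per}}\quad\text{strongly in }C([0,T]\times\mathbb T^2).$$ Moreover, $\rho_M^{\pm,\mathrm{per}}$ are solutions, in the distributional sense, of the regularized system $$\partial_t\rho_M^{\pm,\mathrm{per}}=\mp\left(\sigma_M^{\mathcal K}\ast(\rho_M^{+,\mathrm{per}}-\rho_M^{-,\mathrm{per}})+a(t)\right)\left(\partial_{x_1}\rho_M^{\pm,\mathrm{per}}+L\right)\quad\text{in }(0,T)\times\mathbb T^2,$$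 with initial data $\rho_M^{\pm,\mathrm{per}}(0,x)=\rho_{M,0}^{\pm,\mathrm{per}}(x)$ for all $x\in\mathbb T^2$.
   Context: Data. $\mathbb T^2=(\mathbb R/\mathbb Z)^2$; functions on $\mathbb T^2$ are identified with $\mathbb Z^2$-periodic functions on $\mathbb R^2$; $\ast$ is periodic convolution in the space variable $x=(x_1,x_2)$ on $\mathbb T^2$. The initial data are $\rho_0^{\pm}(x)=\rho_0^{\pm,\mathrm{per}}(x)+Lx_1$ with $\rho_0^{\pm,\mathrm{per}}\in L^2(\mathbb T^2)$ real-valued, $\partial_{x_1}\rho_0^{\pm}=\partial_{x_1}\rho_0^{\pm,\mathrm{per}}+L\ge 0$ a.e., and $\partial_{x_1}\rho_0^{\pm}\in L\log L(\mathbb T^2)$, i.e. $\int_{\mathbb T^2}|\partial_{x_1}\rho_0^\pm|\ln(e+|\partial_{x_1}\rho_0^\pm|)\,dx<\infty$. The function $a\in C([0,T])$ is real-valued. Kernels. For $M\ge1$ let $F_M(z)=\frac1M\sum_{\ell=0}^{M-1}\sum_{|j|\le\ell}e^{2i\pi jz}$ (Fejér kernel) and $F_M^2(x)=F_M(x_1)F_M(x_2)$. Put $c_{(0,0)}(\mathcal K)=0$, $c_m(\mathcal K)=\frac{m_1^2m_2^2}{|m|^4}$ for $m=(m_1,m_2)\in\mathbb Z^2\setminus\{0\}$, $|m|=\sqrt{m_1^2+m_2^2}$, and $$\sigma_M^{\mathcal K}(x)=\frac1{M^2}\sum_{n_1,n_2=0}^{M-1}\ \sum_{|m_1|\le n_1}\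 \sum_{|m_2|\le n_2}c_{(m_1,m_2)}(\mathcal K)\,e^{2i\pi(m_1x_1+m_2x_2)},\quad x\in\mathbb T^2.$$ The regularized initial data are $\rho_{M,0}^{\pm,\mathrm{per}}(x)=\int_{\mathbb T^2}F_M^2(x-y)\rho_0^{\pm,\mathrm{per}}(y)\,dy$. Grid. For positive integers $N,N_T$: $\Delta x=1/N$, $\Delta t=T/N_T$, $\mathcal I_N=\mathbb Z/N\mathbb Z$, $x_i=i\Delta x$, $t_n=n\Delta t$; vectors indexed by $\mathcal I_N^2$ are $N$-periodic in each index. $x_+=\frac{x+|x|}2$, $x_-=\frac{|x|-x}2$. Scheme (S). $\rho^{\pm,0,\mathrm{per}}_{M,i,j}=\rho_{M,0}^{\pm,\mathrm{per}}(x_i,x_j)$, and for $0\le n\le N_T-1$, given $\rho_M^{\pm,n,\mathrm{per}}$, the real vectors $\rho_M^{\pm,n+1,\mathrm{per}}$ solve, for all $(i,j)\in\mathcal I_N^2$, $$\frac{\rho^{\pm,n+1,\mathrm{per}}_{M,i,j}-\rho^{\pm,n,\mathrm{per}}_{M,i,j}}{\Delta t}=\lambda^\pm_{i,j}[\rho_M^{n+1,\mathrm{per}}]_+\left(\theta^{\pm,n,\mathrm{per}}_{M,i+1/2,j}+L\right)-\lambda^\pm_{i,j}[\rho_M^{n+1,\mathrm{per}}]_-\left(\theta^{\pm,n,\mathrm{per}}_{M,i-1/2,j}+L\right),$$ where $\rho_M^{n,\mathrm{per}}=\rho_M^{+,n,\mathrm{per}}-\rho_M^{-,n,\mathrm{per}}$,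 $\theta^{\pm,n,\mathrm{per}}_{M,i+1/2,j}=\frac{\rho^{\pm,n,\mathrm{per}}_{M,i+1,j}-\rho^{\pm,n,\mathrm{per}}_{M,i,j}}{\Delta x}$, and $$\lambda^\pm_{i,j}[\rho_M^{n+1,\mathrm{per}}]=\mp\left(a(t_{n+1})+\sum_{(\ell,r)\in\mathcal I_N^2}(\Delta x)^2\sigma^{\mathcal K}_{M,\ell,r}\,\rho^{n+1,\mathrm{per}}_{M,i-\ell,j-r}\right),\qquad \sigma^{\mathcal K}_{M,i,j}=\sigma_M^{\mathcal K}(x_i,x_j).$$ Under the stated conditions on $\Delta t,\Delta x$ and $M\le N$, this scheme has a unique solution. Reconstruction (R). For $(t,x_1,x_2)\in[t_n,t_{n+1}]\times[x_i,x_{i+1}]\times[x_j,x_{j+1}]$, with $\tau=\frac{t-t_n}{\Delta t}$, $\alpha=\frac{x_1-x_i}{\Delta x}$, $\beta=\frac{x_2-x_j}{\Delta x}$ and $Q^k=\alpha\beta\,\rho^{\pm,k,\mathrm{per}}_{M,i+1,j+1}+(1-\alpha)\beta\,\rho^{\pm,k,\mathrm{per}}_{M,i,j+1}+\alpha(1-\beta)\rho^{\pm,k,\mathrm{per}}_{M,i+1,j}+(1-\alpha)(1-\beta)\rho^{\pm,k,\mathrm{per}}_{M,i,j}$, the reconstruction takes the value $\tau Q^{n+1}+(1-\tau)Q^n$ at $(t,x_1,x_2)$. ''Solution in the distributional sense'' means the equations hold in $\mathcal D'((0,T)\times\mathbb T^2)$, together with the initial condition. *)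

(* Defs.v *)
(* MathComp-Analysis; R[i] comes from mathcomp-real-closed. *)
From HB Require Import structures.
From mathcomp Require Import all_boot all_order all_algebra.
From mathcomp Require Import all_classical all_reals all_analysis.
From mathcomp Require Import complex.
Set Implicit Arguments.
Unset Strict Implicit.
Unset Printing Implicit Defensive.
Import Order.TTheory GRing.Theory Num.Theory.
Import numFieldNormedType.Exports.
Local Open Scope classical_set_scope.
Local Open Scope ring_scope.

(* A function on the torus is a Z^2-periodic function R * R -> R, a function on
   (0,T) x T^2 a function R * (R * R) -> R of (t, (x1, x2)) that is periodic in
   x.  Integrals over T^2 are taken over the fundamental domain [0,1]^2. *)
Definition torus_periodic (R : realType) (f : R * R -> R) : Prop :=
  forall x, f (x.1 + 1, x.2) = f x /\ f (x.1, x.2 + 1) = f x.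

Definition unit_square (R : realType) : set (R * R) := `[0, 1] `*` `[0, 1].
Arguments unit_square R : clear implicits.

Definition slab (R : realType) (T : R) : set (R * (R * R)) :=
  `]0, T[ `*` unit_square R.

Lemma measurable_unit_square (R : realType) : measurable (unit_square R).
Proof. by apply: measurableX; exact: measurable_itv. Qed.
Arguments measurable_unit_square R : clear implicits.

Lemma measurable_slab (R : realType) (T : R) : measurable (slab T).
Proof.
by apply: measurableX; [exact: measurable_itv | exact: measurable_unit_square].
Qed.

Lemma sigma_finite_product (d1 d2 : measure_display) (T1 : measurableType d1)
    (T2 : measurableType d2) (R : realType)
    (m1 : {sigma_finite_measure set T1 -> \bar R})
    (m2 : {sigma_finite_measure set T2 -> \bar R}) :
  sigma_finite setT (m1 \x m2)%E.
Proof.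
have /sigma_finiteP[F [TF ndF Foo]] := sigma_finiteT m1.
have /sigma_finiteP[G [TG ndG Goo]] := sigma_finiteT m2.
exists (fun n => F n `*` G n).
  rewrite -setXTT TF TG predeqE => -[x y]; split.
    move=> [/= [n _ Fnx] [k _ Gky]]; exists (maxn n k) => //; split.
    - by move: x Fnx; exact/subsetPset/ndF/leq_maxl.
    - by move: y Gky; exact/subsetPset/ndG/leq_maxr.
  by move=> [n _ []/= ? ?]; split; exists n.
move=> k; have [? ?] := Foo k; have [? ?] := Goo k.
split; first exact: measurableX.
by rewrite product_measure1E// lte_mul_pinfty// ge0_fin_numE.
Qed.

(* These are named because no sigma-finite structure is inferred for a product
   of two sigma-finite measures. *)
Definition leb2 (R : realType) :
    set (measurableTypeR R * measurableTypeR R) -> \bar R :=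
  (@lebesgue_measure R \x @lebesgue_measure R)%E.
HB.instance Definition _ (R : realType) := Measure.on (@leb2 R).
HB.instance Definition _ (R : realType) :=
  @Measure_isSigmaFinite.Build _ _ _ (@leb2 R)
    (sigma_finite_product (@lebesgue_measure R) (@lebesgue_measure R)).
Arguments leb2 R : clear implicits.

Definition leb3 (R : realType) :
    set (measurableTypeR R * (measurableTypeR R * measurableTypeR R)) -> \bar R :=
  (@lebesgue_measure R \x leb2 R)%E.
HB.instance Definition _ (R : realType) := Measure.on (@leb3 R).
HB.instance Definition _ (R : realType) :=
  @Measure_isSigmaFinite.Build _ _ _ (@leb3 R)
    (sigma_finite_product (@lebesgue_measure R) (leb2 R)).
Arguments leb3 R : clear implicits.

(* The restricted measures give the spaces L^p(T^2), L^p((0,T) x T^2) and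
   L^p(0,T) as [Lfun] of the library. *)
Definition torus_measure (R : realType) :
    {measure set (measurableTypeR R * measurableTypeR R) -> \bar R} :=
  mrestr (leb2 R) (measurable_unit_square R).

Definition slab_measure (R : realType) (T : R) :
    {measure set (measurableTypeR R * (measurableTypeR R * measurableTypeR R)) ->
     \bar R} :=
  mrestr (leb3 R) (measurable_slab T).

Definition time_measure (R : realType) (T : R) : {measure set (measurableTypeR R) -> \bar R} :=
  mrestr (@lebesgue_measure R) (measurable_itv `]0, T[).

Definition Linfty_norm (R : realType) (T : R) (a : R -> R) : R :=
  fine (Lnorm (time_measure T) +oo%E (EFin \o a)).

Definition smooth (R : realType) (V : normedModType R) (phi : V -> R) : Prop :=
  forall (vs : seq V) (x : V),
    differentiable (foldr (fun v f => 'D_v f) phi vs) x.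

Definition torus_test (R : realType) (phi : R * R -> R) : Prop :=
  smooth phi /\ torus_periodic phi.

Definition slab_test (R : realType) (T : R) (phi : R * (R * R) -> R) : Prop :=
  [/\ smooth phi,
      forall t, torus_periodic (fun x => phi (t, x)) &
      exists t0 t1, [/\ 0 < t0, t1 < T &
        forall t x, phi (t, x) != 0 -> t0 <= t <= t1]].

(* g is the derivative of u in the direction v in the sense of distributions *)
Definition torus_weak_derivative (R : realType) (v : R * R) (u g : R * R -> R) :
    Prop :=
  [/\ (leb2 R).-integrable (unit_square R) (EFin \o u),
      (leb2 R).-integrable (unit_square R) (EFin \o g) &
      forall phi, torus_test phi ->
        \int[leb2 R]_(x in unit_square R) (u x * 'D_v phi x) =
        - \int[leb2 R]_(x in unit_square R) (g x * phi x)].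

Definition slab_weak_derivative (R : realType) (T : R) (v : R * (R * R))
    (u g : R * (R * R) -> R) : Prop :=
  [/\ (leb3 R).-integrable (slab T) (EFin \o u),
      (leb3 R).-integrable (slab T) (EFin \o g) &
      forall phi, slab_test T phi ->
        \int[leb3 R]_(z in slab T) (u z * 'D_v phi z) =
        - \int[leb3 R]_(z in slab T) (g z * phi z)].

Definition dir_t (R : realType) : R * (R * R) := (1, (0, 0)).
Definition dir_1 (R : realType) : R * (R * R) := (0, (1, 0)).
Definition dir_2 (R : realType) : R * (R * R) := (0, (0, 1)).

Definition W1infty (R : realType) (T : R) (u : R * (R * R) -> R) : Prop :=
  u \in Lfun (slab_measure T) +oo%E /\
  forall v, v \in [:: dir_t R; dir_1 R; dir_2 R] ->
    exists g, g \in Lfun (slab_measure T) +oo%E /\ slab_weak_derivative T v u g.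

Definition cylinder (R : realType) (T : R) : set (R * (R * R)) :=
  `[0, T] `*` setT.

Definition in_C (R : realType) (T : R) (u : R * (R * R) -> R) : Prop :=
  {within cylinder T, continuous u} /\
  forall t, 0 <= t <= T -> torus_periodic (fun x => u (t, x)).

Definition converges_in_C (R : realType) (T : R)
    (u : nat -> R * (R * R) -> R) (l : R * (R * R) -> R) : Prop :=
  [/\ forall m, in_C T (u m), in_C T l & {uniform cylinder T, u @ \oo --> l}].

Definition LlogL (R : realType) (g : R * R -> R) : Prop :=
  measurable_fun (unit_square R) g /\
  (\int[leb2 R]_(x in unit_square R)
     (`|g x| * ln (expR 1 + `|g x|))%:E < +oo)%E.

(* rho is the periodic part of the datum rho(x) + L x_1, and g is the
   x_1-derivative of that periodic part. *)
Definition admissible_datum (R : realType) (L : R) (rho : R * R -> R) : Prop :=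
  [/\ torus_periodic rho, rho \in Lfun (torus_measure R) 2%:E &
      exists g, [/\ torus_weak_derivative (1, 0) rho g,
        {ae leb2 R, forall x, unit_square R x -> 0 <= g x + L} &
        LlogL (fun x => g x + L)]].

(* e^{2 i pi s} *)
Definition cexp2pi (R : realType) (s : R) : R[i] :=
  Complex (cos (2 * pi * s)) (sin (2 * pi * s)).

(* [:: - l; ...; l] *)
Definition sym_range (l : nat) : seq int :=
  [seq k%:Z - l%:Z | k <- iota 0 (2 * l).+1].

(* The sums defining F_M and sigma_M^K are real, by the symmetry j <-> - j. *)
Definition fejer (R : realType) (M : nat) (z : R) : R :=
  complex.Re (M%:R^-1 *
    \sum_(0 <= l < M) \sum_(j <- sym_range l) cexp2pi (j%:~R * z)).

Definition fejer2 (R : realType) (M : nat) (x : R * R) : R :=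
  fejer M x.1 * fejer M x.2.

Definition kernel_coef (R : realType) (m : int * int) : R :=
  if m == (0, 0) then 0
  else m.1%:~R ^+ 2 * m.2%:~R ^+ 2 /
       Num.sqrt (m.1%:~R ^+ 2 + m.2%:~R ^+ 2) ^+ 4.

Definition sigmaK (R : realType) (M : nat) (x : R * R) : R :=
  complex.Re ((M%:R ^+ 2)^-1 *
    \sum_(0 <= n1 < M) \sum_(0 <= n2 < M)
      \sum_(m1 <- sym_range n1) \sum_(m2 <- sym_range n2)
        Complex (kernel_coef R (m1, m2)) 0 *
        cexp2pi (m1%:~R * x.1 + m2%:~R * x.2)).

Definition torus_conv (R : realType) (k f : R * R -> R) (x : R * R) : R :=
  \int[leb2 R]_(y in unit_square R) (k (x - y) * f y).

Definition regularized_datum (R : realType) (M : nat) (rho : R * R -> R) :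
    R * R -> R :=
  torus_conv (fejer2 M) rho.

Definition pos_part (R : realType) (x : R) : R := (x + `|x|) / 2.
Definition neg_part (R : realType) (x : R) : R := (`|x| - x) / 2.

(* The superscript +/- is a boolean, [true] standing for +. *)
Definition sgb (R : realType) (b : bool) : R := if b then 1 else -1.

Definition space_step (R : realType) (N : nat) : R := N%:R^-1.
Definition time_step (R : realType) (T : R) (NT : nat) : R := T / NT%:R.

(* A vector indexed by (Z/NZ)^2 is a function on Z^2 that is N-periodic in each
   index; a sum over (Z/NZ)^2 runs over the representatives 0, ..., N - 1. *)
Definition grid_periodic (R : realType) (N : nat) (w : int -> int -> R) : Prop :=
  forall i j, w (i + N%:Z) j = w i j /\ w i (j + N%:Z) = w i j.

(* theta_{i+1/2,j}; theta_{i-1/2,j} is [grid_slope N w (i - 1) j] *)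
Definition grid_slope (R : realType) (N : nat) (w : int -> int -> R)
    (i j : int) : R :=
  (w (i + 1) j - w i j) / space_step R N.

(* lambda^{+/-}_{i,j}[w], with an = a(t_{n+1}) *)
Definition speed (R : realType) (M N : nat) (b : bool) (an : R)
    (w : int -> int -> R) (i j : int) : R :=
  - sgb R b * (an + \sum_(0 <= l < N) \sum_(0 <= r < N)
    space_step R N ^+ 2 *
    sigmaK M (l%:R * space_step R N, r%:R * space_step R N) *
    w (i - l%:Z) (j - r%:Z)).

(* v b n i j is the value of rho^b at time t_n and grid point (x_i, x_j). *)
Definition scheme_solution (R : realType) (T L : R) (a : R -> R)
    (rho0 : bool -> R * R -> R) (M N NT : nat)
    (v : bool -> nat -> int -> int -> R) : Prop :=
  let dx := space_step R N in
  let dt := time_step T NT in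
  [/\ forall b n, (n <= NT)%N -> grid_periodic N (v b n),
      forall b (i j : int),
        v b 0%N i j = regularized_datum M (rho0 b) (i%:~R * dx, j%:~R * dx) &
      forall b n, (n < NT)%N -> forall i j : int,
        let lam := speed M N b (a (n.+1%:R * dt))
          (fun k l => v true n.+1 k l - v false n.+1 k l) i j in
        (v b n.+1 i j - v b n i j) / dt =
          pos_part lam * (grid_slope N (v b n) i j + L) -
          neg_part lam * (grid_slope N (v b n) (i - 1) j + L)].

Definition Q1_interpolation (R : realType) (w : int -> int -> R) (i j : int)
    (alpha beta : R) : R :=
  alpha * beta * w (i + 1) (j + 1) +
  (1 - alpha) * beta * w i (j + 1) +
  alpha * (1 - beta) * w (i + 1) j +
  (1 - alpha) * (1 - beta) * w i j.

(* The cells are closed; on their common faces the prescribed values agree. *)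
Definition Q1_reconstruction (R : realType) (T : R) (N NT : nat)
    (v : nat -> int -> int -> R) (u : R * (R * R) -> R) : Prop :=
  let dx := space_step R N in
  let dt := time_step T NT in
  forall n, (n < NT)%N -> forall (i j : int) (t x1 x2 : R),
    n%:R * dt <= t <= n.+1%:R * dt ->
    i%:~R * dx <= x1 <= (i + 1)%:~R * dx ->
    j%:~R * dx <= x2 <= (j + 1)%:~R * dx ->
    let tau := (t - n%:R * dt) / dt in
    let alpha := (x1 - i%:~R * dx) / dx in
    let beta := (x2 - j%:~R * dx) / dx in
    u (t, (x1, x2)) = tau * Q1_interpolation (v n.+1) i j alpha beta +
                      (1 - tau) * Q1_interpolation (v n) i j alpha beta.

(* The evolution equation for rho^b in D'((0,T) x T^2): the bounded function g is
   the distributional x_1-derivative of rho^b, so that the right-hand side is a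
   function, and it is the distributional t-derivative of rho^b. *)
Definition distributional_solution (R : realType) (T L : R) (a : R -> R)
    (M : nat) (rho : bool -> R * (R * R) -> R) (b : bool) : Prop :=
  exists g, [/\ g \in Lfun (slab_measure T) +oo%E,
    slab_weak_derivative T (dir_1 R) (rho b) g &
    slab_weak_derivative T (dir_t R) (rho b) (fun z =>
      - sgb R b *
      (torus_conv (sigmaK M)
         (fun y => rho true (z.1, y) - rho false (z.1, y)) z.2 + a z.1) *
      (g z + L))].

Definition CFL (R : realType) (T L : R) (a : R -> R) (M N NT : nat) : Prop :=
  let dx := space_step R N in
  let dt := time_step T NT in
  let A := 4 * M%:R ^+ 2 * L + Linfty_norm T a in
  dt / dx < Num.min (1 / (4 * A)) (1 / (18 * M%:R ^+ 2 * L)) /\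
  dt < 1 / (2 * L * A).

(* Main.v *)
Require Import Defs.
From HB Require Import structures.
From mathcomp Require Import all_boot all_order all_algebra.
From mathcomp Require Import all_classical all_reals all_analysis.
From mathcomp Require Import measurable_realfun ess_sup_inf complex zify ring lra.
Import Order.TTheory GRing.Theory Num.Theory.
Import numFieldNormedType.Exports.
Set Implicit Arguments.
Unset Strict Implicit.
Unset Printing Implicit Defensive.
Local Open Scope classical_set_scope.
Local Open Scope ring_scope.

(** The discrete solutions are Lipschitz with constants that do not depend on the
mesh.  This gives the compactness, and it gives a meaning to the product of the
velocity by the x_1-derivative in the limit.

_Discrete estimates._  The Fejer kernel is nonnegative, so that regularization
keeps [rho + L x_1] nondecreasing in x_1 ([regularized_datum_monotone]).  The
scheme is upwind: an x_1-increment at the new time is a combination of old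
increments, with nonnegative coefficients as soon as the velocity satisfies a
CFL condition ([jumpE], [jump_ge0]).  Monotonicity has two consequences.  The
increments of [v + L x_1] over a period add up to [L], hence the oscillation of
[v] along x_1 is at most [L] ([periodic1_osc]); and since the kernel has no mode
with m_1 = 0 ([sigmaK_row_zero]), its convolution with [v] only sees that
oscillation and is bounded independently of the size of [v].  The velocity is
taken at the new time, where monotonicity is not known yet; its bound is
obtained from itself, the excess being absorbed by the CFL condition
([speed_self_bound]).  The velocity is Lipschitz in space, since its differences
can be put on the kernel ([sigma_conv_lip1]).  Therefore the largest x_1-increment
grows by a factor [1 + C dt] at most in a step ([jump_growth]), and by a Gronwall
argument it stays of order [dx] on [0, T].  The increments in x_2 and in time
follow ([cross_growth], [time_growth]).

_Compactness._  The Q1 reconstruction has the Lipschitz constant of the nodal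
values ([reconstruction_lip3]).  Tychonoff's theorem gives a cluster point for
pointwise convergence, and the common Lipschitz constant makes the convergence
uniform along a subsequence ([uniform_subsequence]).

_Equation._  The piecewise constant function with the nodal values satisfies the
scheme as an identity between functions on the slab ([cell_scheme]).  Against a
test function, the time difference is moved to the test function
([time_by_parts]).  In the right-hand side the velocities converge, because the
discrete convolutions are Riemann sums ([grid_conv_error]), but the slopes are
only bounded.  After a shift of one cell the positive and negative parts of the
velocity recombine ([space_summation], [bracket_limit]); what remains is a slope
integrated against the product of the limit velocity by the test function, which
is Lipschitz in x_1, so that the difference can be moved to this product and only
the uniform convergence of the densities is used ([slope_limit]).  The
x_1-derivative of the limit is its pointwise derivative, which exists almost
everywhere because Lipschitz functions of one variable are differentiable almost
everywhere ([lip_derivable_ae], [pderiv_ae]). *)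

(** * Almost everywhere differentiability of Lipschitz functions *)

Section lip_ae.
Context (R : realType).
Let mu := @lebesgue_measure R.
Variables (f : R -> R) (K : R).
Hypothesis fK : forall x y, `|f x - f y| <= K * `|x - y|.

(** Adding [K x] makes [f] nondecreasing: [g] is the cumulative function of a measure. *)
Let g x := f x + K * x.

Let g_nd : {homo g : x y / x <= y}.
Proof.
move=> x y xy; rewrite /g.
have := fK x y; rewrite ler_norml [`|x - y|]distrC [`|y - x|]ger0_norm ?subr_ge0//.
by move=> /andP[_]; lra.
Qed.

Let K_ge0 : 0 <= K.
Proof. by have := fK 1 0; rewrite subr0 normr1 mulr1; apply: le_trans. Qed.

Lemma lipschitz_continuous : continuous f.
Proof.
move=> x; apply/cvgrPdist_le => e e0.
have K1 : 0 < K + 1 by rewrite ltr_wpDl.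
have eK : 0 < e / (K + 1) by exact: divr_gt0.
have := @nbhsx_ballx _ _ (x : R) _ eK; apply: filterS => y; rewrite -ball_normE /= => xy.
apply: (le_trans (fK x y)).
apply: (@le_trans _ _ ((K + 1) * `|x - y|)); first by rewrite ler_wpM2r// lerDl.
by rewrite mulrC -ler_pdivlMr// ltW.
Qed.

Let g_rc : right_continuous g.
Proof.
apply: right_continuousW => x; apply: cvgD; first exact: lipschitz_continuous.
by apply: cvgM; [exact: cvg_cst|exact: cvg_id].
Qed.

HB.instance Definition _ := isCumulative.Build R _ R g g_nd g_rc.
Let nu := lebesgue_stieltjes_measure g.

Let wlength_le X : ocitv X -> (wlength g X <= (2 * K)%:E * wlength idfun X)%E.
Proof.
move=> /ocitvP[->|[x x12 ->]]; first by rewrite !wlength0 mule0.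
rewrite !wlength_itv_bnd//= ?(ltW x12)//.
rewrite -EFinM lee_fin /g.
have := fK x.2 x.1; rewrite ler_norml [`|_ - _|]gtr0_norm ?subr_gt0// => /andP[_].
lra.
Qed.

Let derivable_slope (x : R) : derivable g x 1 -> derivable f x 1.
Proof.
move=> dg; have dK : derivable (fun y : R => K * y) x 1 by exact: ex_derive.
have -> : f = g - (fun y => K * y).
  by apply/funext => y; rewrite /g /= !fctE addrK.
exact: (derivableB dg dK).
Qed.

(** Intervals have [nu]-measure at most [2 K] times their length, hence so do
    the covers that define the outer measures. *)
Let nu_dom N : measurable N -> mu N = 0%E -> nu N = 0%E.
Proof.
move=> mN N0; apply/eqP; rewrite eq_le measure_ge0 andbT.
apply/lee_addgt0Pr => e e0; rewrite add0e.
have K1 : 0 < 2 * K + 1 by rewrite ltr_wpDl// mulr_ge0.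
have : (mu N < (e / (2 * K + 1))%:E)%E by rewrite N0 lte_fin divr_gt0.
move=> /ereal_inf_lt[_ [A [mA NA] <-]] hA.
apply: (@le_trans _ _ (\sum_(0 <= k <oo) wlength g (A k))%E).
  by apply: ereal_inf_lbound; exists A.
apply: (@le_trans _ _ (\sum_(0 <= k <oo) (2 * K + 1)%:E * wlength idfun (A k))%E).
  apply: lee_nneseries.
    by move=> n _ _; apply: wlength_ge0.
  move=> n _; apply: (le_trans (wlength_le (mA n))).
  apply: lee_wpmul2r; first exact: wlength_ge0.
  by rewrite lee_fin lerDl.
rewrite nneseriesZl//.
apply: (@le_trans _ _ ((2 * K + 1)%:E * (e / (2 * K + 1))%:E)%E).
  by apply: lee_wpmul2l; [rewrite lee_fin ltW|exact: ltW].
by rewrite -EFinM mulrCA mulfV ?mulr1 ?gt_eqF.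
Qed.

(** The Stieltjes measure of [f x + K x] is absolutely continuous, hence it is
    the integral of a density, and the integral of an integrable function is
    differentiable almost everywhere. *)
Lemma lip_derivable_ae (a b : R) :
  {ae mu, forall x, a < x < b -> derivable f x 1}.
Proof.
have [ab|ba] := ltP a b; last first.
  by apply: aeW => x /andP[ax xb]; have := lt_le_trans (lt_trans ax xb) ba; rewrite ltxx.
have mI : measurable (`]a, b]%classic : set (measurableTypeR R)) by exact: measurable_itv.
have nuI c : c <= b -> a <= c -> nu `]a, c]%classic = (g c - g a)%:E.
  move=> cb ac.
  transitivity (wlength g `]a, c]%classic).
    apply: measurable_mu_extE.
    exact: is_ocitv.
  by rewrite wlength_itv_bnd.
have Ioo : (nu `]a, b]%classic < +oo)%E by rewrite nuI ?ltry// ltW.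
pose nur := mfrestr mI Ioo.
have dom : nur `<< mu.
  apply/null_content_dominatesP => N mN N0; rewrite /nur /mfrestr /mrestr /=.
  apply: nu_dom; first exact: measurableI.
  by apply: (@subset_measure0 _ _ _ mu _ N) => //; exact: measurableI.
have [h [h0 hfin hint hE]] := radon_nikodym_sigma_finite dom.
pose hr := fine \o h.
have hrE : EFin \o hr = h by apply/funext => x /=; rewrite /hr /= fineK.
have hrint : mu.-integrable setT (EFin \o hr) by rewrite hrE.
have locf : locally_integrable setT hr.
  by apply: open_integrable_locally => //; exact: openT.
have := @FTC1 R hr (BRight a) _ locf.
case.
  by move=> y; apply: integrableS hrint.
move=> N [mN N0 hN]; exists N; split => // x /= nx; apply: hN => /= H; apply: nx.
move=> /andP[ax xb].
have [d _] := H ax.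
set F := (fun x => _) in d.
(* near [x], the function [g] is an integral of the density, up to a constant *)
have gE : {near x, (fun y => F y + g a) =1 g}.
  near=> y.
  have ya : a < y by near: y; exact: lt_nbhsr.
  have yb : y < b by near: y; exact: lt_nbhsl.
  rewrite /F /Rintegral.
  have -> : (\int[mu]_(t in `]a, y]) (hr t)%:E = nur `]a, y]%classic)%E.
    apply/esym; etransitivity; first by apply: hE; exact: measurable_itv.
    by apply: eq_integral => t _; rewrite -hrE.
  rewrite /nur /mfrestr /mrestr /= setIidl; last first.
    by move=> z /=; rewrite !in_itv/= => /andP[-> /le_trans->//]; exact: ltW.
  by rewrite nuI ?(ltW ya) ?(ltW yb)//= subrK.
have dg : derivable g x 1.
  apply: (near_eq_derivable gE).
  exact: (derivableD d (derivable_cst (g a) x 1)).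
exact: derivable_slope dg.
Unshelve. all: by end_near. Qed.

End lip_ae.

(** * Integrals of bounded functions and translations *)

Section bounded_integrals.
Context d (X : measurableType d) (R : realType).
Variables (mu : {measure set X -> \bar R}) (D : set X).
Hypotheses (mD : measurable D) (Doo : (mu D < +oo)%E).

Lemma bounded_integrable (f : X -> R) (B : R) :
  measurable_fun D f -> (forall x, D x -> `|f x| <= B) ->
  mu.-integrable D (EFin \o f).
Proof.
move=> mf fB; apply: measurable_bounded_integrable => //.
exists B; split; first exact: num_real.
by move=> C BC x Dx /=; apply: (le_trans (fB x Dx)); exact: ltW.
Qed.

Lemma Rintegral_le_bound (f : X -> R) (B : R) :
  measurable_fun D f -> (forall x, D x -> `|f x| <= B) ->
  `|\int[mu]_(x in D) f x| <= B * fine (mu D).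
Proof.
move=> mf fB; have intf := bounded_integrable mf fB.
apply: (le_trans (le_normr_Rintegral mD intf)).
rewrite -(Rintegral_cst mu mD); apply: le_Rintegral => //.
- apply: (@bounded_integrable _ B); first exact: measurableT_comp.
  by move=> x Dx; rewrite normr_id; exact: fB.
- by apply: (@bounded_integrable _ `|B|) => // x _.
Qed.

Lemma Rintegral_bounded_cvg (f_ : nat -> X -> R) (f : X -> R) (B : R) :
  (forall n, measurable_fun D (f_ n)) -> measurable_fun D f ->
  (forall n x, D x -> `|f_ n x| <= B) ->
  {ae mu, forall x, D x -> f_ ^~ x @ \oo --> f x} ->
  \int[mu]_(x in D) f_ n x @[n --> \oo] --> \int[mu]_(x in D) f x.
Proof.
move=> mf_ mf fB cf.
have [| | | | |if' _] := @dominated_convergence _ _ _ mu D mD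
  (fun n => EFin \o f_ n) (EFin \o f) (cst B%:E).
- by move=> n; exact/measurable_EFinP.
- exact/measurable_EFinP.
- case: cf => N [mN N0 sN]; exists N; split => // x /= nx; apply: sN => /= h; apply: nx.
  move=> Dx; apply/fine_cvgP; split; first exact: nearW.
  exact: h.
- apply: (@bounded_integrable (cst B) `|B|) => //.
- by apply: aeW => x n Dx /=; rewrite lee_fin; exact: fB.
- move=> h; rewrite /Rintegral; apply: fine_cvg; rewrite fineK //.
  exact: (@integrable_fin_num _ _ _ mu).
Qed.

End bounded_integrals.

Section measure_preserving.
Context d (X : measurableType d) (R : realType).
Variables (mu : {measure set X -> \bar R}).

Lemma Rintegral_measure_preserving (phi : X -> X) (D : set X) (f : X -> R) (B : R) :
  measurable_fun setT phi ->
  (forall A, measurable A -> mu (phi @^-1` A) = mu A) ->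
  measurable D -> (mu D < +oo)%E ->
  measurable_fun setT f -> (forall x, `|f x| <= B) ->
  \int[mu]_(x in phi @^-1` D) f (phi x) = \int[mu]_(x in D) f x.
Proof.
move=> mphi pmu mD Doo mf fB.
rewrite /Rintegral; congr fine.
have mpD : measurable (phi @^-1` D) by rewrite -[X in measurable X]setTI; exact: mphi.
rewrite -(@integral_pushforward _ _ _ _ _ _ mphi mu D (EFin \o f)) //.
- by apply: eq_measure_integral => A mA _; rewrite /pushforward; exact: pmu.
- exact/measurable_EFinP.
- apply: (@bounded_integrable _ _ _ mu _ _ _ (f \o phi) B) => //.
  + by rewrite pmu.
  + by apply/measurable_funTS; exact: measurableT_comp.
  + by move=> x _ /=.
Qed.

End measure_preserving.

(** A measure preserving flow [tau] moves the coordinate [q] at unit speed and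
    leaves the strip [S] invariant, so that [0 <= q <= 1] is a fundamental domain
    of [S] for the time-one map.  This form covers at once the line and the two
    space directions of the slab. *)
Section periodic_shift.
Context d (X : measurableType d) (R : realType).
Variables (mu : {measure set X -> \bar R}) (tau : R -> X -> X) (q : X -> R) (S : set X).
Hypotheses (mtau : forall s, measurable_fun setT (tau s))
  (ptau : forall s A, measurable A -> mu (tau s @^-1` A) = mu A)
  (tauD : forall s t x, tau s (tau t x) = tau (s + t) x)
  (mq : measurable_fun setT q) (qtau : forall s x, q (tau s x) = q x + s)
  (mS : measurable S) (Stau : forall s x, S (tau s x) <-> S x)
  (S0 : forall c, mu (S `&` q @^-1` [set c]) = 0%E)
  (S1 : (mu (S `&` q @^-1` `[0%R, 1%R]) < +oo)%E).

Let St (i : interval R) := S `&` q @^-1` [set` i].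

Let mSt i : measurable (St i).
Proof. by apply: measurableI => //; rewrite -[X in measurable X]setTI; exact: mq. Qed.

Lemma Rintegral_strip_shift (f : X -> R) (B : R) (h : R) (i j : interval R) :
  measurable_fun setT f -> (forall x, `|f x| <= B) -> (mu (St j) < +oo)%E ->
  (forall r, (r \in i) = (r + h \in j)) ->
  \int[mu]_(x in St i) f (tau h x) = \int[mu]_(x in St j) f x.
Proof.
move=> mf fB joo ij.
rewrite -(@Rintegral_measure_preserving _ _ _ mu (tau h) (St j) f B)//; last exact: ptau.
congr Rintegral; apply/seteqP; split => x [/= Sx qx]; split => //=.
- exact/Stau.
- by rewrite qtau -ij.
- by apply/(Stau h).
- by rewrite ij -qtau.
Qed.

(** The shift maps [0 <= q < 1 - h] and [1 - h <= q < 1] to [h <= q < 1] and, up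
    to a period, to [0 <= q < h]. *)
Lemma Rintegral_periodic_shift (f : X -> R) (B : R) (h : R) :
  0 <= h <= 1 -> measurable_fun setT f -> (forall x, `|f x| <= B) ->
  (forall x, f (tau 1 x) = f x) ->
  \int[mu]_(x in St `[0, 1]) f (tau h x) = \int[mu]_(x in St `[0, 1]) f x.
Proof.
move=> /andP[h0 h1] mf fB fp.
have Stoo (i : interval R) : ([set` i] `<=` `[0%R, 1%R])%classic -> (mu (St i) < +oo)%E.
  move=> i01; apply: le_lt_trans S1; apply: le_measure; rewrite ?inE//.
    exact: (mSt `[0, 1]).
  by move=> x [Sx qx]; split => //=; exact: i01.
have intb (i : interval R) (g : X -> R) : ([set` i] `<=` `[0%R, 1%R])%classic ->
    measurable_fun setT g -> (forall x, `|g x| <= B) -> mu.-integrable (St i) (EFin \o g).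
  move=> i01 mg gB; apply: (@bounded_integrable _ _ _ mu _ _ _ g B) => //.
    exact: Stoo.
  exact: measurable_funTS.
have split01 (c : R) (g : X -> R) : 0 <= c <= 1 ->
    measurable_fun setT g -> (forall x, `|g x| <= B) ->
    \int[mu]_(x in St `[0, 1]) g x =
    \int[mu]_(x in St `[0, c[) g x + \int[mu]_(x in St `[c, 1[) g x.
  move=> /andP[c0 c1] mg gB.
  have sub1 : (`[0%R, c[%classic `<=` `[0%R, 1%R])%classic.
    by move=> x; rewrite /= ?in_itv/= => /andP[-> /ltW /le_trans ->].
  have sub2 : (`[c, 1%R[%classic `<=` `[0%R, 1%R])%classic.
    by move=> x; rewrite /= ?in_itv/= => /andP[cx /ltW ->]; rewrite (le_trans c0).
  have sub3 : (`[0%R, (1 : R)[%classic `<=` `[0%R, (1 : R)])%classic.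
    by move=> x; rewrite /= ?in_itv/= => /andP[-> /ltW ->].
  have E : St `[0, 1[ = St `[0, c[ `|` St `[c, 1[.
    rewrite /St -setIUr -preimage_setU; congr (_ `&` _ @^-1` _).
    by rewrite -itv_bndbnd_setU// bnd_simp.
  rewrite -Rintegral_setU//; last 2 first.
  - by rewrite -E; exact: intb.
  - apply/disj_setPS => x [[_ /=]]; rewrite in_itv/= => /andP[_ xc] [_ /=].
    by rewrite in_itv/= leNgt xc.
  rewrite -E /Rintegral; congr fine.
  have mS1 : measurable (S `&` q @^-1` [set (1:R)]).
    by apply: measurableI => //; rewrite -[X in measurable X]setTI; exact: mq.
  rewrite (@negligible_integral _ _ _ mu (St `[0, 1]) (S `&` q @^-1` [set (1:R)]))//.
  - congr (integral _ _ _); apply/seteqP; split => x.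
      move=> [[Sx /=]]; rewrite in_itv/= => /andP[q0 q1] nq; split => //=.
      rewrite in_itv/= q0/= lt_neqAle q1 andbT.
      by apply/eqP => q1'; apply: nq.
    move=> [Sx /=]; rewrite in_itv/= => /andP[q0 q1]; split.
      by split => //=; rewrite in_itv/= q0 ltW.
    by move=> [_ /= q1']; move: q1; rewrite q1' ltxx.
  - exact: intb.
(* the piece on [1 - h, 1[ is moved by [h - 1] after a full period *)
rewrite (split01 (1 - h) (f \o tau h)); last 3 first.
- by rewrite subr_ge0 h1 lerBlDr lerDl.
- exact: measurableT_comp.
- by move=> x /=.
rewrite (split01 h)// ?h0// addrC; congr (_ + _).
- transitivity (\int[mu]_(x in St `[1 - h, 1[) f (tau (h - 1) x)).
    apply: eq_Rintegral => x _ /=.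
    by rewrite -[RHS]fp tauD addrC subrK.
  apply: (Rintegral_strip_shift mf fB).
    by apply: Stoo => x; rewrite /= ?in_itv/= => /andP[-> /ltW /le_trans ->].
  by move=> r; rewrite !in_itv/=; apply/idP/idP => /andP[? ?]; apply/andP; split; lra.
- apply: (Rintegral_strip_shift mf fB).
    by apply: Stoo => x; rewrite /= ?in_itv/= => /andP[hx /ltW ->]; rewrite (le_trans h0).
  by move=> r; rewrite !in_itv/=; apply/idP/idP => /andP[? ?]; apply/andP; split; lra.
Qed.

End periodic_shift.

(** * Measurability, translations and null sets *)

(** Piecewise constant functions are measurable as soon as their pieces are:
    [c] names the piece and [F] is arbitrary. *)
Lemma measurable_fun_countable d d' (X : measurableType d) (Y : measurableType d')
    (I : countType) (c : X -> I) (F : I -> Y) :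
  (forall i, measurable (c @^-1` [set i])) -> measurable_fun setT (F \o c).
Proof.
move=> mc _ A mA; rewrite setTI.
pose G k := if (unpickle k : option I) is Some i then
  (if F i \in A then c @^-1` [set i] else set0) else set0.
suff -> : (F \o c) @^-1` A = \bigcup_k G k.
  apply: bigcupT_measurable => k; rewrite /G.
  by case: (unpickle k : option I) => // i; case: ifP.
apply/seteqP; split => x /=.
  by move=> AFx; exists (pickle (c x)) => //; rewrite /G pickleK mem_set.
move=> [k _]; rewrite /G; case: (unpickle k : option I) => // i.
by case: ifPn => // /set_mem Fi /= ->.
Qed.

Lemma measurable_fun_countable2 d d' d'' (X1 : measurableType d) (X2 : measurableType d')
    (Y : measurableType d'') (I1 I2 : countType) (c1 : X1 -> I1) (c2 : X2 -> I2)
    (F : I1 * I2 -> Y) :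
  (forall i, measurable (c1 @^-1` [set i])) ->
  (forall i, measurable (c2 @^-1` [set i])) ->
  measurable_fun setT (fun z : X1 * X2 => F (c1 z.1, c2 z.2)).
Proof.
move=> m1 m2; apply: (@measurable_fun_countable _ _ _ _ (I1 * I2)%type
  (fun z : X1 * X2 => (c1 z.1, c2 z.2)) F) => -[i j].
rewrite (_ : _ @^-1` _ = (c1 @^-1` [set i]) `*` (c2 @^-1` [set j])).
  exact: measurableX.
by apply/seteqP; split => -[x y] /= [-> ->].
Qed.

Section floor_cells.
Context (R : realType).
Local Notation mR := (measurableTypeR R).

(** The index [i] of the cell [i k <= x < (i + 1) k]. *)
Definition cell_of (k x : R) : int := Num.floor (x / k).

Lemma measurable_cell_of (k : R) (n : int) : measurable ((cell_of k : mR -> int) @^-1` [set n]).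
Proof.
have -> : (cell_of k : mR -> int) @^-1` [set n] =
    (fun x : R => x / k) @^-1` `[n%:~R, (n + 1)%:~R[%classic.
  apply/seteqP; split => x /=; rewrite /cell_of in_itv /=.
    by move=> /eqP; rewrite floor_eq.
  by rewrite -floor_eq => /eqP.
rewrite -[X in measurable X]setTI.
by apply: (measurable_funM (@measurable_id _ _ _) (measurable_cst k^-1)) => //; exact: measurable_itv.
Qed.

Lemma measurable_cell_of2 (k1 k2 : R) (n : int * int) :
  measurable ((fun x : mR * mR => (cell_of k1 x.1, cell_of k2 x.2)) @^-1` [set n]).
Proof.
case: n => n1 n2.
rewrite (_ : _ @^-1` _ = ((cell_of k1 : mR -> int) @^-1` [set n1]) `*` ((cell_of k2 : mR -> int) @^-1` [set n2])).
  by apply: measurableX; exact: measurable_cell_of.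
by apply/seteqP; split => -[x y] /= [-> ->].
Qed.

Lemma measurable_cells3 (k0 k1 k2 : R) (F : int -> int -> int -> R) :
  measurable_fun setT (fun z : mR * (mR * mR) => F (cell_of k0 z.1) (cell_of k1 z.2.1) (cell_of k2 z.2.2)).
Proof.
apply: (@measurable_fun_countable2 _ _ _ _ _ _ _ _ (cell_of k0)
  (fun x : mR * mR => (cell_of k1 x.1, cell_of k2 x.2)) (fun p => F p.1 p.2.1 p.2.2)).
- exact: measurable_cell_of.
- exact: measurable_cell_of2.
Qed.

Lemma cell_of_cvg (x : R) : (cell_of n.+1%:R^-1 x)%:~R / n.+1%:R @[n --> \oo] --> x.
Proof.
apply: (@squeeze_cvgr _ _ _ _ (fun n => x - n.+1%:R^-1) (fun=> x)).
- apply: nearW => n; rewrite /cell_of invrK.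
  have n0 : (0 : R) < n.+1%:R by [].
  rewrite ler_pdivrMr// floor_le andbT lerBlDr -[X in _ + X]div1r -mulrDl ler_pdivlMr//.
  by have := floorD1_gt (x * n.+1%:R); rewrite intrD => /ltW.
- rewrite -[X in _ --> X]subr0; apply: cvgB; first exact: cvg_cst.
  exact: cvg_harmonic.
- exact: cvg_cst.
Qed.

Lemma cvg_triple (u1 u2 u3 : nat -> R) (a b c : R) :
  u1 n @[n --> \oo] --> a -> u2 n @[n --> \oo] --> b -> u3 n @[n --> \oo] --> c ->
  (u1 n, (u2 n, u3 n)) @[n --> \oo] --> ((a, (b, c)) : R * (R * R)).
Proof. by move=> ha hb hc; exact: (cvg_pair ha (cvg_pair hb hc)). Qed.

(** A continuous function is the limit of its values at the corners of the
    cells of finer and finer grids.  This gives measurability for the product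
    sigma-algebra. *)
Lemma continuous_measurable3 (f : R * (R * R) -> R) :
  continuous f -> measurable_fun setT (f : mR * (mR * mR) -> R).
Proof.
move=> cf.
apply: (@measurable_fun_cvg _ _ _ _ (fun n z => f ((cell_of n.+1%:R^-1 z.1)%:~R / n.+1%:R,
   ((cell_of n.+1%:R^-1 z.2.1)%:~R / n.+1%:R, (cell_of n.+1%:R^-1 z.2.2)%:~R / n.+1%:R)))).
  move=> n; exact: (@measurable_cells3 n.+1%:R^-1 n.+1%:R^-1 n.+1%:R^-1
   (fun a b c => f (a%:~R / n.+1%:R, (b%:~R / n.+1%:R, c%:~R / n.+1%:R)))).
move=> [t [x y]] _ /=.
exact: (cvg_comp _ _ (cvg_triple (@cell_of_cvg t) (@cell_of_cvg x) (@cell_of_cvg y)) (cf (t, (x, y)))).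
Qed.

Lemma continuous_measurable2 (f : R * R -> R) :
  continuous f -> measurable_fun setT (f : mR * mR -> R).
Proof.
move=> cf.
have cf3 : continuous (fun z : R * (R * R) => f z.2).
  by move=> z; apply: continuous_comp; [exact: cvg_snd|exact: cf].
have mp : measurable_fun setT (fun x : mR * mR => ((0 : mR), x)).
  by apply: measurable_fun_pair; [exact: measurable_cst|exact: measurable_id].
exact: (measurableT_comp (continuous_measurable3 cf3) mp).
Qed.

End floor_cells.

Section translations.
Context (R : realType).
Local Notation mR := (measurableTypeR R).
Local Notation leb := (@lebesgue_measure R).

Lemma measurable_addr (c : R) : measurable_fun setT (fun x : mR => (x + c : mR)).
Proof. exact: (measurable_funD (@measurable_id _ _ _) (measurable_cst c)). Qed.

Lemma lebesgue_translation (c : R) (A : set mR) : measurable A ->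
  leb ((fun x => x + c) @^-1` A) = leb A.
Proof.
move=> mA.
apply/esym; unshelve eapply (@lebesgue_measure_unique _ (pushforward leb (fun x : mR => x + c : mR))) => //.
exact: measurable_addr.
move=> X /ocitvP[->|[[a b] /= ab ->]]; rewrite /pushforward ?preimage_set0 ?measure0//.
rewrite (_ : _ @^-1` _ = `]a - c, b - c]%classic).
  rewrite !lebesgue_measure_itv /= !lte_fin ltrD2r ab -!EFinB; congr EFin.
  by rewrite opprB addrA subrK.
by apply/seteqP; split => x /=; rewrite !in_itv/= => /andP[? ?]; apply/andP; split; lra.
Qed.

(** Uniqueness of the product measure, applied to the image measure. *)
Lemma product_preserving d1 d2 (X1 : measurableType d1) (X2 : measurableType d2)
  (m1 : {sigma_finite_measure set X1 -> \bar R})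
  (m2 : {sigma_finite_measure set X2 -> \bar R})
  (f1 : X1 -> X1) (f2 : X2 -> X2) (A : set (X1 * X2)) :
  measurable_fun setT f1 -> measurable_fun setT f2 ->
  (forall A, measurable A -> m1 (f1 @^-1` A) = m1 A) ->
  (forall A, measurable A -> m2 (f2 @^-1` A) = m2 A) ->
  measurable A ->
  (m1 \x m2)%E ((fun z => (f1 z.1, f2 z.2)) @^-1` A) = (m1 \x m2)%E A.
Proof.
move=> mf1 mf2 p1 p2 mA.
have mf : measurable_fun setT (fun z : X1 * X2 => (f1 z.1, f2 z.2)).
  by apply: measurable_fun_pair; exact: measurableT_comp.
rewrite [RHS](@product_measure_unique _ _ _ _ _ m1 m2 (pushforward (m1 \x m2)%E
  (fun z : X1 * X2 => (f1 z.1, f2 z.2))))//.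
move=> B C mB mC; rewrite /pushforward.
change ((m1 \x m2)%E ((f1 @^-1` B) `*` (f2 @^-1` C)) = (m1 B * m2 C)%E).
rewrite product_measure1E; [by congr (_ * _)%E; [exact: p1|exact: p2]| |].
by rewrite -[X in measurable X]setTI; exact: mf1.
by rewrite -[X in measurable X]setTI; exact: mf2.
Qed.

Definition translate (w z : R * (R * R)) : R * (R * R) :=
  (z.1 + w.1, (z.2.1 + w.2.1, z.2.2 + w.2.2)).

Lemma measurable_translate w :
  measurable_fun setT (translate w : mR * (mR * mR) -> mR * (mR * mR)).
Proof.
apply: measurable_fun_pair.
  exact: (measurableT_comp (measurable_addr w.1)).
apply: measurable_fun_pair.
  apply: (measurableT_comp (measurable_addr w.2.1)).
  exact: (measurableT_comp (@measurable_fst _ _ _ _) (@measurable_snd _ _ _ _)).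
apply: (measurableT_comp (measurable_addr w.2.2)).
exact: (measurableT_comp (@measurable_snd _ _ _ _) (@measurable_snd _ _ _ _)).
Qed.

Lemma leb3_translate w A : measurable A -> leb3 R (translate w @^-1` A) = leb3 R A.
Proof.
move=> mA.
apply: (@product_preserving _ _ _ _ leb (leb2 R) (fun x => x + w.1)
  (fun y : mR * mR => (y.1 + w.2.1, y.2 + w.2.2))) => //.
- exact: measurable_addr.
- apply: measurable_fun_pair.
    exact: (measurableT_comp (measurable_addr w.2.1)).
  exact: (measurableT_comp (measurable_addr w.2.2)).
- exact: lebesgue_translation.
- move=> B mB.
  apply: (@product_preserving _ _ _ _ leb leb (fun x => x + w.2.1) (fun x => x + w.2.2)) => //;
  by [exact: measurable_addr|exact: lebesgue_translation].
Qed.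

End translations.

Section null_sections.
Context (R : realType).
Local Notation mR := (measurableTypeR R).
Local Notation leb := (@lebesgue_measure R).

Lemma leb2_null_xsection (A : set (mR * mR)) : measurable A ->
  (forall x, leb (xsection A x) = 0%E) -> leb2 R A = 0%E.
Proof.
move=> mA h; rewrite /leb2 /product_measure1.
by apply: integral0_eq => x _ /=; exact: h.
Qed.

Lemma leb2_null_ysection (A : set (mR * mR)) : measurable A ->
  (forall y, leb (ysection A y) = 0%E) -> leb2 R A = 0%E.
Proof.
move=> mA h.
rewrite /leb2 (@product_measure_unique _ _ _ _ _ leb leb (leb \x^ leb)%E)//.
  rewrite /product_measure2.
  by apply: integral0_eq => x _ /=; exact: h.
by move=> B C mB mC /=; rewrite product_measure2E.
Qed.

Lemma leb3_null_x1 (A : set (mR * (mR * mR))) : measurable A ->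
  (forall t y, leb.-negligible [set s | A (t, (s, y))]) -> leb3 R A = 0%E.
Proof.
move=> mA h; rewrite /leb3 /product_measure1.
apply: integral0_eq => t _ /=; apply: leb2_null_ysection; first exact: measurable_xsection.
move=> y; apply/negligibleP.
  by apply: measurable_ysection; exact: measurable_xsection.
apply: negligibleS (h t y).
by move=> s /= /set_mem/set_mem.
Qed.

Lemma leb3_null_x2 (A : set (mR * (mR * mR))) : measurable A ->
  (forall t x, leb.-negligible [set s | A (t, (x, s))]) -> leb3 R A = 0%E.
Proof.
move=> mA h; rewrite /leb3 /product_measure1.
apply: integral0_eq => t _ /=; apply: leb2_null_xsection; first exact: measurable_xsection.
move=> x; apply/negligibleP.
  by apply: measurable_xsection; exact: measurable_xsection.
apply: negligibleS (h t x).
by move=> s /= /set_mem/set_mem.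
Qed.

End null_sections.

(** * Test functions *)

Section test_functions.
Context (R : realType).
Implicit Types (f : R * R -> R) (phi u : R * (R * R) -> R).

Lemma addr3E (t a b t' a' b' : R) :
  ((t, (a, b)) : R * (R * R)) + (t', (a', b')) = (t + t', (a + a', b + b')).
Proof. by []. Qed.

Lemma torus_periodic_int f (m n : int) (x : R * R) :
  torus_periodic f -> f (x.1 + m%:~R, x.2 + n%:~R) = f x.
Proof.
move=> fp.
have p1 (k : nat) a b : f (a + k%:R, b) = f (a, b).
  elim: k => [|k IH]; first by rewrite addr0.
  by rewrite -natr1 addrA -[RHS]IH; exact: (fp (a + k%:R, b)).1.
have p2 (k : nat) a b : f (a, b + k%:R) = f (a, b).
  elim: k => [|k IH]; first by rewrite addr0.
  by rewrite -natr1 addrA -[RHS]IH; exact: (fp (a, b + k%:R)).2.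
have q1 (k : int) a b : f (a + k%:~R, b) = f (a, b).
  case: k => k; first exact: p1.
  by rewrite NegzE mulrNz -[LHS](p1 k.+1) subrK.
have q2 (k : int) a b : f (a, b + k%:~R) = f (a, b).
  case: k => k; first exact: p2.
  by rewrite NegzE mulrNz -[LHS](p2 k.+1) subrK.
by rewrite q1 q2; case: x.
Qed.

(** Periodicity reduces the supremum to the compact set [0, T] * [0, 1]^2. *)
Lemma x_periodic_bounded T u : continuous u ->
  (forall t, torus_periodic (fun x => u (t, x))) ->
  (forall t x, u (t, x) != 0 -> 0 <= t <= T) ->
  exists B : R, forall z, `|u z| <= B.
Proof.
move=> cu up u0.
have [T0|T0] := ltP T 0.
  exists 0 => -[t x]; case: (eqVneq (u (t, x)) 0) => [->|/u0]; first by rewrite normr0.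
  by move=> /andP[/le_trans/[apply]]; rewrite leNgt T0.
have cK : compact (`[0, T] `*` unit_square R).
  apply: compact_setX; first exact: segment_compact.
  by apply: compact_setX; exact: segment_compact.
have K0 : (`[0, T] `*` unit_square R) !=set0.
  by exists (0, (0, 0)); split; [|split]; rewrite /= in_itv/= lexx//= ler01.
have cn : {within `[0, T] `*` unit_square R, continuous (fun z => `|u z|)}.
  apply: continuous_subspaceT => z.
  by apply: continuous_comp; [exact: cu|exact: norm_continuous].
have [c _ cmax] := compact_EVT_max K0 cK cn.
exists `|u c| => -[t x].
have [->|tT] := eqVneq (u (t, x)) 0; first by rewrite normr0.
have {}tT := u0 _ _ tT.
rewrite -(torus_periodic_int (- Num.floor x.1) (- Num.floor x.2) x (up t)) /=.
apply: cmax; rewrite inE; split => /=; first by rewrite in_itv.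
split; rewrite /= in_itv/= !mulrNz subr_ge0 floor_le/= lerBlDl.
  by have := floorD1_gt x.1; rewrite intrD => /ltW.
by have := floorD1_gt x.2; rewrite intrD => /ltW.
Qed.

Lemma smooth_continuous (V : normedModType R) (phi : V -> R) :
  smooth phi -> continuous phi.
Proof. by move=> sphi x; apply: differentiable_continuous; exact: (sphi [::] x). Qed.

Lemma smooth_derivable (V : normedModType R) (phi : V -> R) x v :
  smooth phi -> derivable phi x v.
Proof. by move=> sphi; apply: diff_derivable; exact: (sphi [::] x). Qed.

Lemma smooth_derive (V : normedModType R) (phi : V -> R) v :
  smooth phi -> smooth ('D_v phi).
Proof.
move=> sphi vs x; have := sphi (rcons vs v) x.
by rewrite foldr_rcons.
Qed.

Lemma derive_eq_translate (V : normedModType R) (phi : V -> R) (c v x : V) :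
  (forall y, phi (y + c) = phi y) -> 'D_v phi (x + c) = 'D_v phi x.
Proof.
move=> pc; rewrite /derive.
suff -> : (fun h : R => h^-1 *: ((phi \o shift (x + c)) (h *: v) - phi (x + c))) =
          (fun h : R => h^-1 *: ((phi \o shift x) (h *: v) - phi x)) by [].
by apply/funext => h /=; rewrite pc addrA pc.
Qed.

(** The support condition survives because a test function vanishes in a
    neighbourhood of every point outside of its time interval. *)
Lemma slab_test_derive T phi v : slab_test T phi -> slab_test T ('D_v phi).
Proof.
move=> [sphi pphi [t0 [t1 [t00 t1T supp]]]]; split; first exact: smooth_derive.
- move=> t [x y]; split => /=.
    have <- : ((t, (x, y)) : R * (R * R)) + (0, (1, 0)) = (t, (x + 1, y)).
      by rewrite addr3E !addr0.
    apply: derive_eq_translate => -[s [c d]]; rewrite addr3E !addr0.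
    exact: (pphi s (c, d)).1.
  have <- : ((t, (x, y)) : R * (R * R)) + (0, (0, 1)) = (t, (x, y + 1)).
    by rewrite addr3E !addr0.
  apply: derive_eq_translate => -[s [c d]]; rewrite addr3E !addr0.
  exact: (pphi s (c, d)).2.
- exists t0, t1; split => // t x; apply: contra_neqT => tout.
  have phi0 : forall s y, ~~ (t0 <= s <= t1) -> phi (s, y) = 0.
    by move=> s y; apply: contraNeq => /supp.
  suff : {near (t, x), phi =1 cst 0}.
    by move=> /near_eq_derive ->; rewrite derive_cst.
  have : \forall s \near t, ~~ (t0 <= s <= t1).
    move: tout; rewrite negb_and -!ltNge => /orP[tt|tt].
      near=> s; rewrite negb_and -!ltNge; apply/orP; left.
      by near: s; exact: lt_nbhsl.
    near=> s; rewrite negb_and -!ltNge; apply/orP; right.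
    by near: s; exact: lt_nbhsr.
  move=> h.
  have : \forall z \near (t, x), ~~ (t0 <= z.1 <= t1).
    have hc : (fun z : R * (R * R) => z.1) @ (t, x) --> t by exact: cvg_fst.
    exact: (hc _ h).
  by apply: filterS => -[s y] /=; exact: phi0.
Unshelve. all: by end_near. Qed.

Lemma slab_test_bounded T phi : slab_test T phi -> exists B : R, forall z, `|phi z| <= B.
Proof.
move=> [sphi pphi [t0 [t1 [t00 t1T supp]]]].
apply: (x_periodic_bounded (T := T)); [exact: smooth_continuous|exact: pphi|].
move=> t x /supp /andP[t0t tt1]; apply/andP; split.
  by apply: le_trans t0t; exact: ltW.
by apply: (le_trans tt1); exact: ltW.
Qed.

Lemma smooth_line_lipschitz (V : normedModType R) (phi : V -> R) v B :
  smooth phi -> (forall z, `|'D_v phi z| <= B) ->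
  forall z h, `|phi (z + h *: v) - phi z| <= B * `|h|.
Proof.
move=> sphi dB z.
pose f s := phi (z + s *: v).
have df (s : R) : is_derive s (1 : R) f ('D_v phi (z + s *: v)).
  have dv := @smooth_derivable _ phi (z + s *: v) v sphi.
  have E : (fun h : R => h^-1 *: ((phi \o shift (z + s *: v)) (h *: v) - phi (z + s *: v))) =
           (fun h : R => h^-1 *: ((f \o shift s) (h *: (1 : R)) - f s)).
    apply/funext => h /=.
    by rewrite /f /= scalerDl [h *: 1]mulr1 addrA [h *: v + z]addrC -addrA [h *: v + _]addrC.
  by apply: DeriveDef; [move: dv; rewrite /derivable /= E|rewrite /derive E].
have cf : continuous f.
  by move=> s; apply: differentiable_continuous; apply/derivable1_diffP; case: (df s).
have main (s h : R) : s < h -> `|f h - f s| <= B * `|h - s|.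
  move=> sh.
  have [c _ ->] := MVT sh (fun x _ => df x) (continuous_subspaceT cf).
  by rewrite normrM ler_wpM2r.
move=> h; rewrite (_ : phi z = f 0); last by rewrite /f scale0r addr0.
rewrite -[phi _]/(f h).
have [h0|h0|->] := ltgtP h 0; last by rewrite subrr !normr0 mulr0.
  by rewrite distrC; have := main _ _ h0; rewrite sub0r normrN.
by have := main _ _ h0; rewrite subr0.
Qed.

Lemma smooth_quotient_cvg (V : normedModType R) (phi : V -> R) v z (h : nat -> R) :
  smooth phi -> (forall m, h m != 0) -> h @ \oo --> 0 ->
  (h m)^-1 * (phi (z + h m *: v) - phi z) @[m --> \oo] --> 'D_v phi z.
Proof.
move=> sphi h0 hc.
have dv := @smooth_derivable _ phi z v sphi.
have /cvgr_dnbhsP/(_ h) := dv.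
have : (forall n, h n != 0) /\ h n @[n --> \oo] --> 0 by [].
move=> /[swap]/[apply].
under eq_fun do rewrite /= [_ *: v + z]addrC.
exact.
Qed.
End test_functions.

(** * Difference quotients on the slab *)

Section slab_integrals.
Context (R : realType) (T : R).
Local Notation mR := (measurableTypeR R).
Local Notation R3 := (mR * (mR * mR))%type.
Local Notation leb := (@lebesgue_measure R).
Implicit Types (f g : R * (R * R) -> R).

Lemma measurable_x1 : measurable_fun setT (fun z : R3 => z.2.1).
Proof. exact: (measurableT_comp (@measurable_fst _ _ _ _) (@measurable_snd _ _ _ _)). Qed.

Lemma measurable_x2 : measurable_fun setT (fun z : R3 => z.2.2).
Proof. exact: (measurableT_comp (@measurable_snd _ _ _ _) (@measurable_snd _ _ _ _)). Qed.

Lemma leb2_unit_square : leb2 R (unit_square R) = 1%E.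
Proof.
transitivity (leb `[0%R, 1%R]%classic * leb `[0%R, 1%R]%classic)%E.
  by apply: product_measure1E; exact: measurable_itv.
by rewrite lebesgue_measure_itv /= lte01 -EFinB subr0 mule1.
Qed.

Lemma leb3_box (A : set mR) : measurable A -> leb3 R (A `*` unit_square R) = leb A.
Proof.
move=> mA; transitivity (leb A * leb2 R (unit_square R))%E; last by rewrite leb2_unit_square mule1.
by apply: product_measure1E => //; exact: measurable_unit_square.
Qed.

Lemma lebesgue_oo_lty (a b : R) : (leb `]a, b[%classic < +oo)%E.
Proof. by rewrite lebesgue_measure_itv /=; case: ifPn => _; rewrite -?EFinB ?ltry. Qed.

Lemma leb3_slab_lty : (leb3 R (slab T) < +oo)%E.
Proof. by rewrite leb3_box; [exact: lebesgue_oo_lty|exact: measurable_itv]. Qed.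

Lemma translate3 (z w : R * (R * R)) : translate w z = z + w.
Proof. by case: z w => [t [x y]] [t' [x' y']]. Qed.

Lemma scale_dir_1 h : h *: dir_1 R = (0, (h, 0)).
Proof. by rewrite -[LHS]/(h * 0, (h * 1, h * 0)) !mulr0 mulr1. Qed.

Lemma scale_dir_2 h : h *: dir_2 R = (0, (0, h)).
Proof. by rewrite -[LHS]/(h * 0, (h * 0, h * 1)) !mulr0 mulr1. Qed.

Lemma scale_dir_t h : h *: dir_t R = (h, (0, 0)).
Proof. by rewrite -[LHS]/(h * 1, (h * 0, h * 0)) !mulr0 mulr1. Qed.

(** Each space direction is an instance of [Rintegral_periodic_shift]. *)
Lemma slab_shift_x f (B h : R) (v : R * (R * R)) : v \in [:: dir_1 R; dir_2 R] ->
  0 <= h <= 1 -> measurable_fun setT (f : R3 -> R) -> (forall z, `|f z| <= B) ->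
  (forall t, torus_periodic (fun x => f (t, x))) ->
  \int[leb3 R]_(z in slab T) f (z + h *: v) = \int[leb3 R]_(z in slab T) f z.
Proof.
move=> vdir h01 mf fB fp.
have mtau (w : R -> R * (R * R)) s : measurable_fun setT (translate (w s) : R3 -> R3).
  exact: measurable_translate.
have mm (i : interval R) : measurable ([set` i] : set mR) by exact: measurable_itv.
rewrite !inE in vdir; case/orP : vdir => /eqP ->.
- have E : slab T = (`]0, T[ `*` (setT `*` `[0, 1])) `&`
      (fun z : R3 => z.2.1) @^-1` `[0, 1]%classic.
    by apply/seteqP; split => -[t [x y]] /=; rewrite /slab /unit_square /=; tauto.
  have := @Rintegral_periodic_shift _ _ R (leb3 R) (fun s => translate (0, (s, 0)))
    (fun z => z.2.1) (`]0, T[ `*` (setT `*` `[0, 1])) _ _ _ _ _ _ _ _ _ f B h h01 mf fB.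
  rewrite -E => <-.
  + by apply: eq_Rintegral => z _; rewrite translate3 scale_dir_1.
  + by move=> s; exact: (mtau (fun s => (0, (s, 0)))).
  + by move=> s A; exact: leb3_translate.
  + by move=> s s' [t [x y]]; rewrite /translate /= !addr0 addrAC -addrA.
  + exact: measurable_x1.
  + by move=> s [t [x y]].
  + by do 2 (apply: measurableX => //).
  + by move=> s [t [x y]] /=; rewrite !addr0.
  + move=> c; apply: leb3_null_x1.
      apply: measurableI; first by do 2 (apply: measurableX => //).
      by rewrite -[X in measurable X]setTI; exact: measurable_x1.
    by move=> t y; exists [set c]; split => //; [exact: lebesgue_measure_set1|move=> x /= []].
  + exact: leb3_slab_lty.
  + by move=> [t [x y]]; rewrite /translate /= !addr0; exact: (fp t (x, y)).1.
- have E : slab T = (`]0, T[ `*` (`[0, 1] `*` setT)) `&`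
      (fun z : R3 => z.2.2) @^-1` `[0, 1]%classic.
    by apply/seteqP; split => -[t [x y]] /=; rewrite /slab /unit_square /=; tauto.
  have := @Rintegral_periodic_shift _ _ R (leb3 R) (fun s => translate (0, (0, s)))
    (fun z => z.2.2) (`]0, T[ `*` (`[0, 1] `*` setT)) _ _ _ _ _ _ _ _ _ f B h h01 mf fB.
  rewrite -E => <-.
  + by apply: eq_Rintegral => z _; rewrite translate3 scale_dir_2.
  + by move=> s; exact: (mtau (fun s => (0, (0, s)))).
  + by move=> s A; exact: leb3_translate.
  + by move=> s s' [t [x y]]; rewrite /translate /= !addr0 addrAC -addrA.
  + exact: measurable_x2.
  + by move=> s [t [x y]].
  + by do 2 (apply: measurableX => //).
  + by move=> s [t [x y]] /=; rewrite !addr0.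
  + move=> c; apply: leb3_null_x2.
      apply: measurableI; first by do 2 (apply: measurableX => //).
      by rewrite -[X in measurable X]setTI; exact: measurable_x2.
    by move=> t y; exists [set c]; split => //; [exact: lebesgue_measure_set1|move=> x /= []].
  + exact: leb3_slab_lty.
  + by move=> [t [x y]]; rewrite /translate /= !addr0; exact: (fp t (x, y)).2.
Qed.

(** Lipschitz for the l^1 norm of the three coordinates. *)
Definition lip3 (K : R) (rho : R * (R * R) -> R) := forall z w,
  `|rho z - rho w| <= K * (`|z.1 - w.1| + `|z.2.1 - w.2.1| + `|z.2.2 - w.2.2|).

Lemma lip3_ge0 K rho : lip3 K rho -> 0 <= K.
Proof.
move=> lip; have := lip (1, (0, 0)) (0, (0, 0)).
by rewrite /= !subr0 !normr0 normr1 !addr0 mulr1; apply: le_trans.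
Qed.

Lemma lip3_continuous K rho : lip3 K rho -> continuous rho.
Proof.
move=> lip z; apply/cvgrPdist_le => e e0.
have K0 := lip3_ge0 lip.
have K1 : 0 < 3 * K + 1 by rewrite ltr_wpDl// mulr_ge0.
have d0 : 0 < e / (3 * K + 1) by rewrite divr_gt0.
have := @nbhsx_ballx _ _ (z : R * (R * R)) _ d0; apply: filterS => w [w1 [w2 w3]].
apply: (le_trans (lip z w)).
move: w1 w2 w3; rewrite -!ball_normE /= => w1 w2 w3.
apply: (@le_trans _ _ (K * (3 * (e / (3 * K + 1))))).
  by apply: ler_wpM2l => //; set d := e / _ in w1 w2 w3 *; lra.
rewrite (_ : K * _ = (3 * K) * e / (3 * K + 1)); last by ring.
by rewrite ler_pdivrMr// mulrC ler_wpM2l ?(ltW e0)// lerDl.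
Qed.

Lemma integrable_slab f B : measurable_fun setT (f : R3 -> R) -> (forall z, `|f z| <= B) ->
  (leb3 R).-integrable (slab T) (EFin \o f).
Proof.
move=> mf fB; apply: (@bounded_integrable _ _ _ (leb3 R) (slab T) _ _ f B) => //.
- exact: measurable_slab.
- exact: leb3_slab_lty.
- exact: measurable_funTS.
Qed.

(** Fubini: a measurable set is null if its sections by lines along x_1 are null. *)
Lemma ae_line1 (P : R3 -> Prop) : measurable [set z | ~ P z] ->
  (forall t y, {ae leb, forall s, 0 <= s <= 1 -> P (t, (s, y))}) ->
  {ae leb3 R, forall z, slab T z -> P z}.
Proof.
move=> mP h; exists (slab T `&` [set z | ~ P z]); split.
- by apply: measurableI => //; exact: measurable_slab.
- apply: leb3_null_x1; first by apply: measurableI => //; exact: measurable_slab.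
  move=> t y; have [N [mN N0 sN]] := h t y; exists N; split => // s /= [[_ [/= s01 _]] nP].
  by apply: sN => /= H; apply: nP; apply: H; move: s01; rewrite in_itv.
- by move=> z /= nP; split; [|move=> Pz]; apply: contrapT => H; apply: nP => // ?; contradiction.
Qed.

Lemma ae_line2 (P : R3 -> Prop) : measurable [set z | ~ P z] ->
  (forall t x, {ae leb, forall s, 0 <= s <= 1 -> P (t, (x, s))}) ->
  {ae leb3 R, forall z, slab T z -> P z}.
Proof.
move=> mP h; exists (slab T `&` [set z | ~ P z]); split.
- by apply: measurableI => //; exact: measurable_slab.
- apply: leb3_null_x2; first by apply: measurableI => //; exact: measurable_slab.
  move=> t y; have [N [mN N0 sN]] := h t y; exists N; split => // s /= [[_ [/= _ s01]] nP].
  by apply: sN => /= H; apply: nP; apply: H; move: s01; rewrite in_itv.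
- by move=> z /= nP; split; [|move=> Pz]; apply: contrapT => H; apply: nP => // ?; contradiction.
Qed.

Lemma derivable_quotient_cvg (f : R -> R) x (h : nat -> R) : derivable f x 1 ->
  (forall m, h m != 0) -> h @ \oo --> 0 ->
  (h m)^-1 * (f (x + h m) - f x) @[m --> \oo] --> 'D_1 f x.
Proof.
move=> df h0 hc; have /cvgr_dnbhsP/(_ h) := df.
have : (forall n, h n != 0) /\ h n @[n --> \oo] --> 0 by [].
move=> /[swap]/[apply].
under eq_fun do rewrite /= [_ *: 1]mulr1 [h _ + x]addrC.
exact.
Qed.

Definition quotient (rho : R * (R * R) -> R) (v : R * (R * R)) (h : R) (z : R * (R * R)) :=
  h^-1 * (rho (z + h *: v) - rho z).

Lemma quotient_bounded K rho v h : lip3 K rho -> v \in [:: dir_1 R; dir_2 R] ->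
  h != 0 -> forall z, `|quotient rho v h z| <= K.
Proof.
move=> lip vdir h0 z; rewrite /quotient normrM normfV mulrC ler_pdivrMr ?normr_gt0//.
apply: (le_trans (lip _ _)); rewrite !inE in vdir; move: z => [t [x y]].
by case/orP : vdir => /eqP ->; rewrite ?scale_dir_1 ?scale_dir_2 addr3E /=
  !addr0 !subrr normr0 ?addr0 ?add0r addrAC subrr add0r.
Qed.

Lemma measurable_comp_translate (f : R * (R * R) -> R) w :
  measurable_fun setT (f : R3 -> R) -> measurable_fun setT ((fun z => f (z + w)) : R3 -> R).
Proof.
move=> mf; have := measurableT_comp mf (@measurable_translate R w).
by apply: eq_measurable_fun => z _; rewrite /= translate3.
Qed.

Lemma measurable_quotient rho v h : measurable_fun setT (rho : R3 -> R) ->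
  measurable_fun setT (quotient rho v h : R3 -> R).
Proof.
move=> mr; apply: measurable_funM => //.
by apply: measurable_funB => //; exact: measurable_comp_translate.
Qed.

(** With the exceptional set measurable, Fubini's theorem passes from almost every
    point of every line to almost every point. *)
Lemma measurable_not_cvg (f_ : nat -> R3 -> R) (g : R3 -> R) :
  (forall n, measurable_fun setT (f_ n)) -> measurable_fun setT g ->
  measurable [set z | ~ (f_ n z @[n --> \oo] --> g z)].
Proof.
move=> mf mg.
pose r z := limn_esup (fun n => (`|f_ n z - g z|)%:E).
have mr : measurable_fun setT r.
  apply: measurable_fun_limn_esup => n; apply/measurable_EFinP.
  by apply: measurableT_comp => //; exact: measurable_funB.
rewrite (_ : [set _ | _] = ~` (r @^-1` [set 0%E])).
  by apply: measurableC; rewrite -[X in measurable X]setTI; apply: mr => //; exact: emeasurable_set1.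
have iff z : r z = 0%E <-> (f_ n z @[n --> \oo] --> g z).
  split => [r0|c].
    have : (fun n => (`|f_ n z - g z|)%:E) @ \oo --> 0%:E.
      apply: limn_esup_le_cvg; first by rewrite -/(r z) r0.
      by move=> n; rewrite lee_fin.
    move=> /fine_cvgP[_ /= c0].
    by apply/subr_cvg0; apply/norm_cvg0P.
  have : (fun n => (`|f_ n z - g z|)%:E) @ \oo --> 0%:E.
    by apply/fine_cvgP; split; [exact: nearW|apply/norm_cvg0P/subr_cvg0].
  move=> c0; rewrite /r is_cvg_limn_esupE; last by apply/cvg_ex; exists 0%:E.
  exact/cvg_lim.
by apply/seteqP; split => z /= h => [/iff|/iff].
Qed.

Lemma lip3_line K rho v z : lip3 K rho -> v \in [:: dir_1 R; dir_2 R] ->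
  forall s s', `|rho (z + s *: v) - rho (z + s' *: v)| <= K * `|s - s'|.
Proof.
move=> lip vdir s s'; apply: (le_trans (lip _ _)); rewrite !inE in vdir.
move: z => [t [x y]].
by case/orP : vdir => /eqP ->; rewrite ?scale_dir_1 ?scale_dir_2 !addr3E /=
  !addr0 !subrr normr0 ?addr0 ?add0r opprD addrACA subrr add0r.
Qed.

(** A jointly measurable choice of the partial derivative: the upper limit of
    the difference quotients, truncated at the Lipschitz constant so that it is
    bounded also at the exceptional points. *)
Definition pderiv (K : R) (rho : R * (R * R) -> R) (v z : R * (R * R)) : R :=
  Num.max (- K) (Num.min K (limn_sup (fun n => quotient rho v n.+1%:R^-1 z))).

Lemma pderiv_bounded K rho v : 0 <= K -> forall z, `|pderiv K rho v z| <= K.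
Proof.
move=> K0 z; rewrite ler_norml /pderiv le_max lexx/= ge_max ge_min lexx /= andbT.
by rewrite lerNl (le_trans _ K0)// oppr_le0.
Qed.

Lemma pderiv_cvg K rho v z (l : R) : lip3 K rho -> v \in [:: dir_1 R; dir_2 R] ->
  quotient rho v n.+1%:R^-1 z @[n --> \oo] --> l -> pderiv K rho v z = l.
Proof.
move=> lip vdir c; rewrite /pderiv.
rewrite cvg_limn_supE; last by apply/cvg_ex; exists l.
rewrite (cvg_lim _ c)//.
have qK n : - K <= quotient rho v n.+1%:R^-1 z <= K.
  by rewrite -ler_norml; apply: quotient_bounded => //; rewrite invr_eq0.
have lK : l <= K by apply: (cvgr_to_le c); apply: nearW => n; have /andP[] := qK n.
have Kl : - K <= l by apply: (cvgr_to_ge c); apply: nearW => n; have /andP[] := qK n.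
by rewrite (min_idPr lK) (max_idPr Kl).
Qed.

Lemma measurable_pderiv K rho v : lip3 K rho -> v \in [:: dir_1 R; dir_2 R] ->
  measurable_fun setT (pderiv K rho v : R3 -> R).
Proof.
move=> lip vdir.
have mr := continuous_measurable3 (lip3_continuous lip).
apply: measurable_maxr => //; apply: measurable_minr => //.
have qK z n : - K <= quotient rho v n.+1%:R^-1 z <= K.
  by rewrite -ler_norml; apply: quotient_bounded => //; rewrite invr_eq0.
apply: measurable_fun_limn_sup.
- by move=> z _; exists K => _ [n _ <-]; have /andP[] := qK z n.
- by move=> z _; exists (- K) => _ [n _ <-]; have /andP[] := qK z n.
- by move=> n; exact: measurable_quotient.
Qed.

(** On each line the function is Lipschitz, hence differentiable at almost
    every point, and there the quotients with steps [h m] and with steps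
    [1 / (n + 1)] have the same limit.  Then [ae_line1] or [ae_line2] applies. *)
Lemma pderiv_ae K rho v (h : nat -> R) : lip3 K rho -> v \in [:: dir_1 R; dir_2 R] ->
  (forall m, h m != 0) -> h @ \oo --> 0 ->
  {ae leb3 R, forall z, slab T z -> quotient rho v (h m) z @[m --> \oo] --> pderiv K rho v z}.
Proof.
move=> lip vdir h0 hc.
have mr := continuous_measurable3 (lip3_continuous lip).
have mN : measurable [set z | ~ (quotient rho v (h m) z @[m --> \oo] --> pderiv K rho v z)].
  apply: measurable_not_cvg; last exact: measurable_pderiv.
  by move=> n; exact: measurable_quotient.
have line z : {ae leb, forall s, 0 <= s <= 1 ->
    quotient rho v (h m) (z + s *: v) @[m --> \oo] --> pderiv K rho v (z + s *: v)}.
  have := lip_derivable_ae (lip3_line z lip vdir) (-1) 2.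
  apply: filterS; first exact: (ae_filter_ringOfSetsType leb).
  move=> s der /andP[s0 s1].
  have ds : derivable (fun s : R => rho (z + s *: v)) s 1 by apply: der; apply/andP; split; lra.
  have E k : (fun m : nat => (k m)^-1 * (rho (z + (s + k m) *: v) - rho (z + s *: v))) =
             (fun m => quotient rho v (k m) (z + s *: v)).
    by apply/funext => m; rewrite /quotient scalerDl addrA.
  have c1 := derivable_quotient_cvg ds h0 hc.
  rewrite E in c1.
  have c2 := derivable_quotient_cvg ds (h := fun n => n.+1%:R^-1) _ (@cvg_harmonic R).
  rewrite E in c2.
  by rewrite (pderiv_cvg lip vdir (c2 _))// => n; rewrite invr_eq0.
move: mN line; rewrite !inE in vdir; case/orP : vdir => /eqP -> mN line.
- apply: (ae_line1 mN) => t y; have := line (t, (0, y)).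
  apply: filterS; first exact: (ae_filter_ringOfSetsType leb).
  by move=> s; rewrite scale_dir_1 addr3E !addr0 add0r.
- apply: (ae_line2 mN) => t y; have := line (t, (y, 0)).
  apply: filterS; first exact: (ae_filter_ringOfSetsType leb).
  by move=> s; rewrite scale_dir_2 addr3E !addr0 add0r.
Qed.

End slab_integrals.

(** * Integration by parts on the slab *)

Section weak_derivatives.
Context (R : realType) (T : R).
Local Notation mR := (measurableTypeR R).
Local Notation R3 := (mR * (mR * mR))%type.
Local Notation leb := (@lebesgue_measure R).
Implicit Types (f g psi rho : R * (R * R) -> R) (v : R * (R * R)).
Local Notation I f := (\int[leb3 R]_(z in slab T) f z).

Definition x_periodic f := forall t, torus_periodic (fun x => f (t, x)).

Lemma x_periodic_translate f w : x_periodic f -> x_periodic (fun z => f (z + w)).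
Proof.
case: w => [t' [x' y']] fp t [x y]; rewrite !addr3E /=; split.
  by rewrite addrAC; exact: (fp (t + t') (x + x', y + y')).1.
by rewrite addrAC; exact: (fp (t + t') (x + x', y + y')).2.
Qed.

Lemma x_periodicM f g : x_periodic f -> x_periodic g -> x_periodic (fun z => f z * g z).
Proof. by move=> fp gp t x; rewrite !(fp t x).1 !(fp t x).2 !(gp t x).1 !(gp t x).2. Qed.

Let mslab := measurable_slab T.
Let slab_lty := leb3_slab_lty T.

(** The integral over a period is invariant by translation, so that the shift
    by [h] in one factor is a shift by [- h] in the other. *)
Lemma quotient_by_parts f psi B C (h : R) v : v \in [:: dir_1 R; dir_2 R] ->
  0 < h <= 1 ->
  measurable_fun setT (f : R3 -> R) -> measurable_fun setT (psi : R3 -> R) ->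
  (forall z, `|f z| <= B) -> (forall z, `|psi z| <= C) ->
  x_periodic f -> x_periodic psi ->
  I (fun z => quotient f v h z * psi z) = - I (fun z => f z * quotient psi v (- h) z).
Proof.
move=> vdir /andP[h0 h1] mf mp fB pC fp pp.
have hn0 : h != 0 by rewrite gt_eqF.
have B0 : 0 <= B by apply: le_trans (fB 0).
have C0 : 0 <= C by apply: le_trans (pC 0).
have fpB (w w' : R * (R * R)) z : `|f (z + w) * psi (z + w')| <= B * C.
  by rewrite normrM ler_pM.
have mfp (w w' : R * (R * R)) : measurable_fun setT ((fun z => f (z + w) * psi (z + w')) : R3 -> R).
  by apply: measurable_funM; exact: measurable_comp_translate.
have int (w w' : R * (R * R)) : (leb3 R).-integrable (slab T) (EFin \o (fun z => f (z + w) * psi (z + w'))).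
  exact: integrable_slab (fpB w w').
have E1 : I (fun z => quotient f v h z * psi z) =
    h^-1 * (I (fun z => f (z + h *: v) * psi (z + 0)) - I (fun z => f (z + 0) * psi (z + 0))).
  rewrite -RintegralB// -RintegralZl//; last exact: (integrableB _ (int _ _) (int _ _)).
  by apply: eq_Rintegral => z _; rewrite /quotient !addr0 -mulrA mulrBl.
have E2 : I (fun z => f z * quotient psi v (- h) z) =
    - h^-1 * (I (fun z => f (z + 0) * psi (z + (- h) *: v)) - I (fun z => f (z + 0) * psi (z + 0))).
  rewrite -RintegralB// -RintegralZl//; last exact: (integrableB _ (int _ _) (int _ _)).
  by apply: eq_Rintegral => z _; rewrite /quotient !addr0 invrN mulrCA mulrBr.
rewrite E1 E2 mulNr opprK; congr (_ * (_ - _)).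
have h01 : 0 <= h <= 1 by rewrite h1 ltW.
rewrite -(@slab_shift_x R T (fun z => f (z + 0) * psi (z + (- h) *: v)) (B * C) h v vdir h01)//.
- by apply: eq_Rintegral => z _; rewrite !addr0 -addrA scaleNr subrr addr0.
- exact: (x_periodicM (@x_periodic_translate f 0 fp) (@x_periodic_translate psi ((- h) *: v) pp)).
Qed.

Lemma slab_bounded_cvg (f_ : nat -> R * (R * R) -> R) f B :
  (forall n, measurable_fun setT (f_ n : R3 -> R)) -> measurable_fun setT (f : R3 -> R) ->
  (forall n z, `|f_ n z| <= B) ->
  {ae leb3 R, forall z, slab T z -> f_ n z @[n --> \oo] --> f z} ->
  I (f_ n) @[n --> \oo] --> I f.
Proof.
move=> mf_ mf fB cf.
apply: (@Rintegral_bounded_cvg _ _ _ (leb3 R) (slab T) _ _ f_ f B) => //.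
- by move=> n; exact: measurable_funTS.
- exact: measurable_funTS.
Qed.

(** Let [h] tend to 0 in [quotient_by_parts], by dominated convergence. *)
Lemma lipschitz_weak_derivative K B rho v : lip3 K rho -> (forall z, `|rho z| <= B) ->
  x_periodic rho -> v \in [:: dir_1 R; dir_2 R] ->
  slab_weak_derivative T v rho (pderiv K rho v).
Proof.
move=> lip rB rp vdir.
have K0 : 0 <= K.
  exact: lip3_ge0 lip.
have mr := continuous_measurable3 (lip3_continuous lip).
have mg := measurable_pderiv lip vdir.
split.
- exact: integrable_slab rB.
- by apply: (integrable_slab T mg (pderiv_bounded rho v K0)).
move=> phi tphi.
have [C pC] := slab_test_bounded tphi.
have [D dD] := slab_test_bounded (slab_test_derive v tphi).
have [sphi pphi _] := tphi.
have mphi := continuous_measurable3 (smooth_continuous sphi).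
have mdphi := continuous_measurable3 (smooth_continuous (smooth_derive v sphi)).
pose h (n : nat) : R := n.+1%:R^-1.
have h0 n : h n != 0 by rewrite /h invr_eq0.
have hh n : 0 < h n <= 1 by rewrite /h invr_gt0 ltr0n /= invf_le1// ler1n.
have hc : h @ \oo --> 0 by exact: cvg_harmonic.
have B0 : 0 <= B by apply: le_trans (rB 0).
have c1 : I (fun z => quotient rho v (h n) z * phi z) @[n --> \oo] -->
    I (fun z => pderiv K rho v z * phi z).
  apply: (@slab_bounded_cvg _ _ (K * C)).
  - by move=> n; apply: measurable_funM => //; exact: measurable_quotient.
  - exact: measurable_funM.
  - by move=> n z; rewrite normrM ler_pM//; exact: quotient_bounded.
  - have := pderiv_ae T lip vdir h0 hc.
    apply: filterS; first exact: (ae_filter_ringOfSetsType (leb3 R)).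
    by move=> z cz /cz {}cz; apply: cvgM => //; exact: cvg_cst.
have c2 : I (fun z => rho z * quotient phi v (- h n) z) @[n --> \oo] -->
    I (fun z => rho z * 'D_v phi z).
  apply: (@slab_bounded_cvg _ _ (B * D)).
  - by move=> n; apply: measurable_funM => //; exact: measurable_quotient.
  - exact: measurable_funM.
  - move=> n z; rewrite normrM ler_pM// /quotient normrM normfV normrN mulrC.
    rewrite ler_pdivrMr ?normr_gt0//.
    by have := smooth_line_lipschitz sphi dD z (- h n); rewrite normrN.
  - apply: aeW => z _; apply: cvgM; first exact: cvg_cst.
    apply: smooth_quotient_cvg => //; first by move=> m; rewrite oppr_eq0.
    by rewrite -oppr0; apply: cvgN.
apply/esym; rewrite -[RHS]opprK; congr (- _).
apply: (cvg_unique _ c1); first exact: Rhausdorff.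
have -> : (fun n => I (fun z => quotient rho v (h n) z * phi z)) =
    (fun n => - I (fun z => rho z * quotient phi v (- h n) z)).
  by apply/funext => n; exact: quotient_by_parts rB pC _ _.
exact: cvgN.
Qed.

(** There is no periodicity in time; the support of [f] is what stays inside of
    the slab during the translation. *)
Lemma slab_shift_t f B t0 t1 k : 0 <= k -> k < t0 -> t1 < T ->
  measurable_fun setT (f : R3 -> R) -> (forall z, `|f z| <= B) ->
  (forall z, f z != 0 -> t0 <= z.1 <= t1) ->
  I (fun z => f (z + k *: dir_t R)) = I f.
Proof.
move=> k0 kt0 t1T mf fB supp.
pose S : set R3 := setT `*` unit_square R.
have SE (i : interval R) : S `&` (fun z : R3 => z.1) @^-1` [set` i] = [set` i] `*` unit_square R.
  by apply/seteqP; split => -[t x] /=; rewrite /S /=; tauto.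
have mS : measurable S by apply: measurableX => //; exact: measurable_unit_square.
have := @Rintegral_strip_shift _ _ R (leb3 R) (fun s => translate (s, (0, 0))) (fun z => z.1) S
  _ _ _ _ _ _ f B k `]0, T[ `]k, k + T[ mf fB.
rewrite !SE -/(slab T).
under eq_Rintegral do rewrite translate3 -scale_dir_t.
move=> ->.
- rewrite [LHS]Rintegral_mkcond [RHS]Rintegral_mkcond; congr Rintegral.
  apply/funext => z; rewrite !patchE.
  have [->|/supp /andP[tz zt]] := eqVneq (f z) 0; first by do 2 case: ifP.
  rewrite (_ : (z \in `]k, k + T[ `*` unit_square R) = (z \in slab T))//.
  apply/idP/idP; rewrite !inE => -[/= _ Sz]; split => //=; rewrite in_itv/=;
    apply/andP; split; lra.
- by move=> s; exact: measurable_translate.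
- by move=> s A; exact: leb3_translate.
- exact: measurable_fst.
- by move=> s z.
- exact: mS.
- by move=> s [t [x y]]; rewrite /S /= !addr0.
- rewrite [X in (X < _)%E](_ : _ = leb `]k, (k + T)%R[%classic); first exact: lebesgue_oo_lty.
  by apply: leb3_box; exact: measurable_itv.
- by move=> r; rewrite !in_itv/=; apply/idP/idP => /andP[? ?]; apply/andP; split; lra.
Qed.

Lemma Lfun_bounded f B : measurable_fun setT (f : R3 -> R) -> (forall z, `|f z| <= B) ->
  f \in Lfun (slab_measure T) +oo%E.
Proof.
move=> mf fB; rewrite inE; apply/andP; split; rewrite inE //=.
rewrite /finite_norm unlock; case: ifPn => // _.
apply: (@le_lt_trans _ _ B%:E); last exact: ltry.
apply/ess_supP; apply: aeW => z /=; by rewrite lee_fin.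
Qed.

End weak_derivatives.

(** * The kernel of the regularized system *)

Section trigonometric_sums.
Context (R : realType).
Implicit Types (z a b c d : R) (x : R * R).

Definition cos2pi (s : R) := cos (2 * pi * s).

Lemma cos_lipschitz a b : `|cos a - cos b| <= `|a - b|.
Proof.
wlog ab : a b / a < b.
  move=> wlg; have [/wlg//|ba|->] := ltgtP a b; last by rewrite !subrr.
  by rewrite distrC [leRHS]distrC; exact: wlg.
have [c _ E] := MVT ab (fun z _ => is_derive_cos z) (continuous_subspaceT (@continuous_cos R)).
rewrite distrC E normrM normrN [leRHS]distrC -[leRHS]mul1r ler_wpM2r//.
exact: sin_max.
Qed.

Lemma cos2pi_lipschitz a b : `|cos2pi a - cos2pi b| <= 2 * pi * `|a - b|.
Proof.
apply: (le_trans (cos_lipschitz _ _)).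
by rewrite -mulrBr normrM [`|2 * pi|]ger0_norm// mulr_ge0// pi_ge0.
Qed.

Lemma cosD2piz a (m : int) : cos (a + 2 * pi * m%:~R) = cos a.
Proof.
have h n b : cos (b + 2 * pi * n%:R) = cos b.
  by rewrite mulr_natr [2 * pi]mulr_natl; exact: (periodicn (@cosD2pi R)).
case: m => n; first exact: h.
by rewrite NegzE mulrNz mulrN -[LHS](h n.+1) subrK.
Qed.

Lemma sinD2piz a (m : int) : sin (a + 2 * pi * m%:~R) = sin a.
Proof. by rewrite -[in LHS]cosBpihalf -cosBpihalf addrAC cosD2piz. Qed.

Lemma cos2piD1z a (m : int) : cos2pi (a + m%:~R) = cos2pi a.
Proof. by rewrite /cos2pi mulrDr cosD2piz. Qed.

Lemma ReD (u v : R[i]) : complex.Re (u + v) = complex.Re u + complex.Re v.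
Proof. by case: u; case: v. Qed.

Lemma Re_sum (I : Type) (s : seq I) (F : I -> R[i]) :
  complex.Re (\sum_(i <- s) F i) = \sum_(i <- s) complex.Re (F i).
Proof. by elim/big_rec2 : _ => // i u v _ <-; rewrite ReD. Qed.

Lemma Re_realM (r : R) (u : R[i]) : complex.Re (Complex r 0 * u) = r * complex.Re u.
Proof. by case: u => u v /=; rewrite mul0r subr0. Qed.

Lemma complex_natV (n : nat) : (n%:R : R[i])^-1 = Complex (n%:R^-1) 0.
Proof. by rewrite -[Complex _ _]/(real_complex R n%:R^-1) fmorphV /= rmorph_nat. Qed.

Lemma fejerE M z : fejer M z =
  M%:R^-1 * \sum_(0 <= l < M) \sum_(j <- sym_range l) cos2pi (j%:~R * z).
Proof.
rewrite /fejer complex_natV Re_realM Re_sum; congr (_ * _).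
by apply: eq_bigr => l _; rewrite Re_sum.
Qed.

Lemma sigmaKE M x : sigmaK M x =
  (M%:R ^+ 2)^-1 * \sum_(0 <= n1 < M) \sum_(0 <= n2 < M)
    \sum_(m1 <- sym_range n1) \sum_(m2 <- sym_range n2)
      kernel_coef R (m1, m2) * cos2pi (m1%:~R * x.1 + m2%:~R * x.2).
Proof.
rewrite /sigmaK -natrX complex_natV Re_realM natrX Re_sum; congr (_ * _).
apply: eq_bigr => n1 _; rewrite Re_sum; apply: eq_bigr => n2 _.
rewrite Re_sum; apply: eq_bigr => m1 _; rewrite Re_sum; apply: eq_bigr => m2 _.
by rewrite Re_realM.
Qed.

Lemma mem_sym_range l (j : int) : j \in sym_range l -> `|j| <= l%:Z.
Proof.
move=> /mapP[k]; rewrite mem_iota add0n ltnS => /andP[_ kl] ->.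
by rewrite ler_norml; lia.
Qed.

Lemma size_sym_range l : size (sym_range l) = (2 * l).+1.
Proof. by rewrite /sym_range size_map size_iota. Qed.

Lemma sum_odd M : (\sum_(0 <= l < M) (2 * l).+1 = M ^ 2)%N.
Proof.
elim: M => [|M IH]; first by rewrite big_geq.
by rewrite big_nat_recr//= IH; lia.
Qed.

Lemma kernel_coef_bound m : `|kernel_coef R m| <= 1.
Proof.
rewrite /kernel_coef; case: eqP => [_|mn0]; first by rewrite normr0.
set a := m.1%:~R; set b := m.2%:~R.
have a2 : 0 <= a ^+ 2 :> R by exact: sqr_ge0.
have b2 : 0 <= b ^+ 2 :> R by exact: sqr_ge0.
rewrite (_ : Num.sqrt _ ^+ 4 = (a ^+ 2 + b ^+ 2) ^+ 2); last first.
  by rewrite (exprM _ 2 2) sqr_sqrtr// addr_ge0.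
have ab0 : 0 < a ^+ 2 + b ^+ 2.
  rewrite lt_neqAle addr_ge0// andbT eq_sym paddr_eq0// !sqrf_eq0 !intr_eq0.
  by apply/negP => /andP[/eqP m1 /eqP m2]; apply: mn0; case: m m1 m2 {a b a2 b2} => ? ? /= -> ->.
have d0 : 0 < (a ^+ 2 + b ^+ 2) ^+ 2 by rewrite exprn_gt0.
rewrite ger0_norm; last exact: divr_ge0 (mulr_ge0 a2 b2) (ltW d0).
rewrite ler_pdivrMr// mul1r; set u := a ^+ 2 in a2 *; set v := b ^+ 2 in b2 *; nra.
Qed.

(** The number of terms is [M ^ 4], because the sum of [2 l + 1] for [l < M] is
    [M ^ 2]. *)
Lemma sym_sum_bound M (F : nat -> nat -> int -> int -> R) (C : R) : 0 <= C ->
  (forall n1 n2 m1 m2, (n1 < M)%N -> (n2 < M)%N -> `|m1| <= n1%:Z -> `|m2| <= n2%:Z ->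
     `|F n1 n2 m1 m2| <= C) ->
  `|\sum_(0 <= n1 < M) \sum_(0 <= n2 < M)
    \sum_(m1 <- sym_range n1) \sum_(m2 <- sym_range n2) F n1 n2 m1 m2| <= M%:R ^+ 4 * C.
Proof.
move=> C0 FC.
have -> : M%:R ^+ 4 * C = \sum_(0 <= n1 < M) \sum_(0 <= n2 < M)
    \sum_(m1 <- sym_range n1) \sum_(m2 <- sym_range n2) C.
  rewrite (eq_bigr (fun n1 : nat => (2 * n1).+1%:R * (M%:R ^+ 2 * C))); last first.
    move=> n1 _; rewrite (eq_bigr (fun n2 : nat => (2 * n2).+1%:R * ((2 * n1).+1%:R * C))); last first.
      move=> n2 _; rewrite !big_const_seq !count_predT !size_sym_range.
      by rewrite !iter_addr_0 !mulr_natl mulrnAC.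
    by rewrite -mulr_suml -natr_sum sum_odd natrX mulrCA.
  by rewrite -mulr_suml -natr_sum sum_odd natrX mulrA -exprD.
rewrite big_nat_cond [leRHS]big_nat_cond; apply: (le_trans (ler_norm_sum _ _ _)); apply: ler_sum => n1 /andP[/andP[_ n1M] _].
rewrite big_nat_cond [leRHS]big_nat_cond; apply: (le_trans (ler_norm_sum _ _ _)); apply: ler_sum => n2 /andP[/andP[_ n2M] _].
rewrite big_seq [leRHS]big_seq; apply: (le_trans (ler_norm_sum _ _ _)); apply: ler_sum => m1 /mem_sym_range m1l.
rewrite big_seq [leRHS]big_seq; apply: (le_trans (ler_norm_sum _ _ _)); apply: ler_sum => m2 /mem_sym_range m2l.
exact: FC.
Qed.

(** The normalization [M ^ -2] leaves a factor [M ^ 2]; this is where the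
    [M ^ 2] of the CFL conditions comes from. *)
Lemma sigmaK_bound M x : `|sigmaK M x| <= M%:R ^+ 2.
Proof.
rewrite sigmaKE normrM; have [->|M0] := posnP M.
  by rewrite big_geq// normr0 mulr0 expr0n.
have M2 : (0 : R) < M%:R ^+ 2 by rewrite exprn_gt0// ltr0n.
rewrite gtr0_norm ?invr_gt0// mulrC ler_pdivrMr// -exprD -[leRHS]mulr1.
apply: sym_sum_bound => // n1 n2 m1 m2 _ _ _ _.
by rewrite normrM mulr_ile1// ?kernel_coef_bound//; exact: cos_max.
Qed.

Lemma sigmaK_lipschitz M (x y : R * R) : `|sigmaK M x - sigmaK M y| <=
  M%:R ^+ 2 * (2 * pi * M%:R) * (`|x.1 - y.1| + `|x.2 - y.2|).
Proof.
have [->|M0] := posnP M.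
  by rewrite !sigmaKE !big_geq// !mulr0 subrr normr0 mul0r.
have M2 : (0 : R) < M%:R ^+ 2 by rewrite exprn_gt0// ltr0n.
rewrite !sigmaKE -mulrBr normrM gtr0_norm ?invr_gt0// mulrC ler_pdivrMr//.
rewrite -sumrB; under eq_bigr do (rewrite -sumrB; under eq_bigr do (rewrite -sumrB;
  under eq_bigr do rewrite -sumrB)).
apply: (@le_trans _ _ (M%:R ^+ 4 * (2 * pi * M%:R * (`|x.1 - y.1| + `|x.2 - y.2|)))); last first.
  by rewrite le_eqVlt; apply/orP; left; apply/eqP; ring.
have C0 : 0 <= 2 * pi * M%:R * (`|x.1 - y.1| + `|x.2 - y.2|) :> R.
  by rewrite !mulr_ge0// ?pi_ge0// addr_ge0.
apply: sym_sum_bound => // n1 n2 m1 m2 n1M n2M m1n m2n.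
rewrite -mulrBr normrM -[leRHS]mul1r ler_pM// ?kernel_coef_bound//.
apply: (le_trans (cos2pi_lipschitz _ _)).
rewrite -!mulrA; apply: ler_wpM2l => //; apply: ler_wpM2l; first exact: pi_ge0.
rewrite opprD addrACA -!mulrBr [leRHS]mulrDr; apply: (le_trans (ler_normD _ _)).
have mM (m : int) n : (n < M)%N -> `|m| <= n%:Z -> `|m%:~R| <= M%:R :> R.
  move=> nM mn; rewrite -intr_norm -[M%:R]/((M%:Z)%:~R) ler_int; lia.
by apply: lerD; rewrite normrM ler_wpM2r//; [exact: mM m1n|exact: mM m2n].
Qed.

Lemma sigmaK_periodic M : torus_periodic (@sigmaK R M).
Proof.
move=> x; rewrite !sigmaKE; split; congr (_ * _);
  do 2 (apply: eq_bigr => ? _); apply: eq_bigr => m1 _; apply: eq_bigr => m2 _; congr (_ * _);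
  rewrite /= mulrDr mulr1; [rewrite addrAC|rewrite addrA]; exact: cos2piD1z.
Qed.

(** Multiplied by [2 sin (a / 2)], the sum telescopes. *)
Lemma sum_cos_zero (a c : R) N (m : int) : sin (a / 2) != 0 -> a * N%:R = 2 * pi * m%:~R ->
  \sum_(0 <= l < N) cos (a * l%:R + c) = 0.
Proof.
move=> s0 aN.
have tele n : 2 * sin (a / 2) * \sum_(0 <= l < n) cos (a * l%:R + c) =
    sin (a * n%:R + c - a / 2) - sin (c - a / 2).
  elim: n => [|n IH]; first by rewrite big_geq// !mulr0 add0r subrr.
  rewrite big_nat_recr//= mulrDr IH -[n.+1%:R]natr1.
  rewrite (_ : a * (n%:R + 1) + c - a / 2 = a * n%:R + c + a / 2); last by field.
  by rewrite (sinB (a * n%:R + c)) (sinD (a * n%:R + c) (a / 2)); ring.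
have : 2 * sin (a / 2) * \sum_(0 <= l < N) cos (a * l%:R + c) = 0.
  rewrite tele aN -addrA addrC sinD2piz addrC; apply/eqP; rewrite subr_eq0; apply/eqP; congr sin; ring.
by move/eqP; rewrite mulf_eq0 mulf_eq0 (negbTE s0) pnatr_eq0 /= => /eqP.
Qed.

Lemma sin_pi_frac_neq0 (m : int) N : m != 0 -> `|m| < N%:Z -> sin (pi * m%:~R / N%:R) != 0 :> R.
Proof.
have pos (k : nat) : (0 < k < N)%N -> 0 < sin (pi * k%:R / N%:R) :> R.
  move=> /andP[k0 kN]; have N0 : (0 < N)%N by exact: leq_trans kN.
  apply: sin_gt0_pi; rewrite divr_gt0 ?mulr_gt0 ?pi_gt0 ?ltr0n//=.
  by rewrite ltr_pdivrMr ?ltr0n// ltr_pM2l ?pi_gt0// ltr_nat.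
case: m => k m0 kN; first by rewrite gt_eqF// pos//; lia.
by rewrite NegzE mulrNz mulrN mulNr sinN oppr_eq0 gt_eqF// pos//; lia.
Qed.

(** The coefficients with [m_1 = 0] vanish, and every other mode has a frequency
    smaller than [N], hence has zero mean over [N] equidistant points.  Thus the
    discrete convolution does not see functions of x_2 alone. *)
Lemma sigmaK_row_zero M N (y : R) : (M <= N)%N -> (0 < N)%N ->
  \sum_(0 <= l < N) sigmaK M (l%:R * N%:R^-1, y) = 0 :> R.
Proof.
move=> MN N0; under eq_bigr do rewrite sigmaKE.
rewrite -mulr_sumr exchange_big big_nat_cond big1 ?mulr0//= => n1 /andP[n1M _].
rewrite exchange_big big1//= => n2 _; rewrite exchange_big big_seq big1//= => m1 /mem_sym_range m1n.
rewrite exchange_big big1//= => m2 _; rewrite -mulr_sumr.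
have [->|m10] := eqVneq m1 0.
  by rewrite /kernel_coef /=; case: ifP; rewrite ?mul0r// expr0n /= !mul0r.
rewrite [X in _ * X](_ : _ = 0) ?mulr0//.
have Nr : (N%:R : R) != 0 by rewrite pnatr_eq0 -lt0n.
rewrite -[RHS](@sum_cos_zero (2 * pi * m1%:~R / N%:R) (2 * pi * (m2%:~R * y)) N m1).
- by apply: eq_bigr => l _; rewrite /cos2pi; congr cos; field.
- rewrite (_ : _ / 2 = pi * m1%:~R / N%:R); last by field.
  by apply: sin_pi_frac_neq0 => //; lia.
- by field.
Qed.

End trigonometric_sums.

(** * The Fejer kernel *)

Lemma is_derive_affine (R : realType) (f : R -> R) (l a b z : R) :
  is_derive (a * z + b) 1 f l -> is_derive z 1 (fun s => f (a * s + b)) (a * l).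
Proof.
move=> df.
have da : is_derive z 1 (fun s : R => a * s + b) a.
  by apply: is_derive_eq; rewrite addr0 [_ *: 1]mulr1.
have h := @is_derive1_comp _ f (fun s : R => a * s + b) z l a df da.
by apply: (is_derive_eq h); rewrite mulrC.
Qed.

Lemma is_derive_sumM (R : realType) (c z : R) n (h : nat -> R -> R) (dh : nat -> R) :
  (forall k, is_derive z 1 (h k) (dh k)) ->
  is_derive z 1 (fun s => c * \sum_(0 <= k < n) h k s) (c * \sum_(0 <= k < n) dh k).
Proof.
move=> d.
have ds : is_derive z 1 (fun s => \sum_(0 <= k < n) h k s) (\sum_(0 <= k < n) dh k).
  elim: n => [|n IH].
    by under eq_fun do rewrite big_geq//; rewrite big_geq//; exact: is_derive_cst.
  under eq_fun do rewrite big_nat_recr//=; rewrite big_nat_recr//=.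
  exact: (is_deriveD IH (d n)).
exact: (@is_deriveZ _ _ _ _ c _ _ _ ds).
Qed.

Section fejer_kernel.
Context (R : realType).
Implicit Types (z : R).

Lemma sum_sym_rangeS (f : int -> R) l :
  \sum_(j <- sym_range l.+1) f j = \sum_(j <- sym_range l) f j + (f (- l.+1%:Z) + f l.+1%:Z).
Proof.
have E n (g : nat -> R) : \sum_(k <- iota 0 n) g k = \sum_(0 <= k < n) g k.
  by rewrite /index_iota subn0.
rewrite /sym_range !big_map (E (2 * l.+1).+1) (E (2 * l).+1).
rewrite (_ : (2 * l.+1).+1 = (2 * l).+3); last by lia.
rewrite big_nat_recl// big_nat_recr//= addrCA; congr (_ + (_ + _)).
- by apply: eq_bigr => k _; congr f; lia.
- by congr f; lia.
- by congr f; lia.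
Qed.

Lemma sum_cos2pi_sym l z : \sum_(j <- sym_range l) cos2pi (j%:~R * z) =
  1 + 2 * \sum_(0 <= k < l) cos2pi (k.+1%:R * z).
Proof.
elim: l => [|l IH].
  by rewrite (_ : sym_range 0 = [:: 0])// big_seq1 big_geq// mulr0 addr0 mul0r /cos2pi mulr0 cos0.
rewrite sum_sym_rangeS IH big_nat_recr//= mulrDr [RHS]addrA; congr (_ + _).
by rewrite mulrNz mulNr /cos2pi mulrN cosN [RHS]mulr_natl mulr2n.
Qed.

Lemma fejer_dirichlet M z : fejer M z =
  M%:R^-1 * \sum_(0 <= l < M) (1 + 2 * \sum_(0 <= k < l) cos2pi (k.+1%:R * z)).
Proof. by rewrite fejerE; congr (_ * _); apply: eq_bigr => l _; exact: sum_cos2pi_sym. Qed.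

(** The sum of the Dirichlet kernels is the square of the modulus of the sum of
    the [exp (2 i pi k z)] for [0 <= k < M]. *)
Lemma fejer_square M z : \sum_(0 <= l < M) (1 + 2 * \sum_(0 <= k < l) cos2pi (k.+1%:R * z)) =
  (\sum_(0 <= k < M) cos (2 * pi * (k%:R * z))) ^+ 2 +
  (\sum_(0 <= k < M) sin (2 * pi * (k%:R * z))) ^+ 2.
Proof.
pose t k := 2 * pi * (k%:R * z).
have key l : \sum_(0 <= k < l) cos2pi (k.+1%:R * z) =
    cos (t l) * \sum_(0 <= k < l) cos (t k) + sin (t l) * \sum_(0 <= k < l) sin (t k).
  rewrite !mulr_sumr -big_split /= big_nat_rev /= add0n.
  rewrite big_nat_cond [RHS]big_nat_cond; apply: eq_bigr => k /andP[/andP[_ kl] _].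
  rewrite -cosB /cos2pi /t; congr cos; rewrite subnSK// natrB; first by ring.
  exact: ltnW.
elim: M => [|M IH]; first by rewrite !big_geq// !expr0n addr0.
rewrite !big_nat_recr//= IH key -!/(t _).
set c := \sum_(0 <= k < M) cos _; set s := \sum_(0 <= k < M) sin _.
have := cos2Dsin2 (t M); rewrite -/(t M); set cM := cos (t M); set sM := sin (t M) => cs.
rewrite (_ : (c + cM) ^+ 2 + (s + sM) ^+ 2 =
  c ^+ 2 + s ^+ 2 + ((cM ^+ 2 + sM ^+ 2) + 2 * (cM * c + sM * s))); last by ring.
by rewrite cs.
Qed.

Lemma fejer_ge0 M z : 0 <= fejer M z.
Proof. by rewrite fejer_dirichlet fejer_square mulr_ge0// ?addr_ge0 ?sqr_ge0. Qed.

(** [z + fejer_prim M z] is a primitive of the Fejer kernel; [fejer_prim] is its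
    periodic part. *)
Definition fejer_prim M z : R :=
  M%:R^-1 * \sum_(0 <= l < M) (2 * \sum_(0 <= k < l) sin (2 * pi * (k.+1%:R * z)) / (2 * pi * k.+1%:R)).

Lemma is_derive_fejer_prim M z : (0 < M)%N -> is_derive z 1 (fejer_prim M) (fejer M z - 1).
Proof.
move=> M0.
have Mr : (M%:R : R) != 0 by rewrite pnatr_eq0 -lt0n.
have -> : fejer M z - 1 = M%:R^-1 * \sum_(0 <= l < M) (2 * \sum_(0 <= k < l) cos2pi (k.+1%:R * z)).
  rewrite fejer_dirichlet big_split /= sumr_const_nat subn0 mulrDr mulVf//.
  by rewrite addrAC subrr add0r.
have dk k : is_derive z 1 (fun z => sin (2 * pi * (k.+1%:R * z)) / (2 * pi * k.+1%:R)) (cos2pi (k.+1%:R * z)).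
  have p0 : 2 * pi * k.+1%:R != 0 :> R by rewrite !mulf_neq0// gt_eqF// pi_gt0.
  have := is_derive_affine (a := 2 * pi * k.+1%:R) (b := 0) (is_derive_sin (2 * pi * k.+1%:R * z + 0)).
  move=> /(@is_deriveZ _ _ _ _ (2 * pi * k.+1%:R)^-1) h.
  rewrite (_ : (fun z => _) = (2 * pi * k.+1%:R)^-1 \*: (fun s : R => sin (2 * pi * k.+1%:R * s + 0))).
    by apply: (is_derive_eq h); rewrite addr0 /cos2pi [_ *: _]mulKf// mulrA.
  by apply/funext => s /=; rewrite addr0 mulrC mulrA.
have dl l : is_derive z 1 (fun z => 2 * \sum_(0 <= k < l) sin (2 * pi * (k.+1%:R * z)) / (2 * pi * k.+1%:R))
    (2 * \sum_(0 <= k < l) cos2pi (k.+1%:R * z)).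
  apply: is_derive_sumM => k; exact: dk.
exact: is_derive_sumM.
Qed.

Lemma fejer_prim_periodic M z : fejer_prim M (z + 1) = fejer_prim M z.
Proof.
congr (_ * _); apply: eq_bigr => l _; congr (_ * _); apply: eq_bigr => k _; congr (_ / _).
by rewrite [_ * (z + 1)]mulrDr mulr1 [2 * pi * _]mulrDr (sinD2piz _ k.+1%:Z).
Qed.

Lemma fejer_periodic M z : fejer M (z + 1) = fejer M z.
Proof.
rewrite !fejer_dirichlet; congr (_ * _); apply: eq_bigr => l _; congr (_ + _ * _); apply: eq_bigr => k _.
by rewrite [_ * (z + 1)]mulrDr mulr1 (cos2piD1z _ k.+1%:Z).
Qed.

End fejer_kernel.

Section trigonometric_polynomials.
Context (R : realType).

(** This class contains the test functions that are used against the data, and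
    it is stable under directional derivatives, so that its elements are smooth
    once they are differentiable.  The frequencies are real numbers: periodicity
    is a separate matter. *)
Inductive trig : (R * R -> R) -> Prop :=
| trig_cos p q d : trig (fun y => cos (p * y.1 + q * y.2 + d))
| trigD f g : trig f -> trig g -> trig (fun y => f y + g y)
| trigM f g : trig f -> trig g -> trig (fun y => f y * g y)
| trigZ c f : trig f -> trig (fun y => c * f y).

Lemma trig_cst c : trig (fun=> c).
Proof.
rewrite (_ : (fun=> c) = fun y : R * R => c * cos (0 * y.1 + 0 * y.2 + 0)).
  by apply: trigZ; exact: trig_cos.
by apply/funext => y; rewrite !mul0r !addr0 cos0 mulr1.
Qed.

Lemma trig_sum n (F : nat -> R * R -> R) : (forall k, trig (F k)) ->
  trig (fun y => \sum_(0 <= k < n) F k y).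
Proof.
move=> h; elim: n => [|n IH].
  by under eq_fun do rewrite big_geq//; exact: trig_cst.
under eq_fun do rewrite big_nat_recr//=; exact: trigD.
Qed.

Lemma differentiable_linear_form (p q : R) x :
  differentiable (fun y : R * R => p * y.1 + q * y.2) x.
Proof.
have d1 : differentiable (fst : R * R -> R) x.
  by apply: linear_differentiable => y; exact: cvg_fst.
have d2 : differentiable (snd : R * R -> R) x.
  by apply: linear_differentiable => y; exact: cvg_snd.
by apply: differentiableD; apply: differentiableM.
Qed.

Lemma differentiable_trig f : trig f -> forall x, differentiable f x.
Proof.
elim=> {f} [p q d x|f g _ IHf _ IHg x|f g _ IHf _ IHg x|c f _ IH x].
- apply: (@differentiable_comp _ _ _ _ (fun y : R * R => p * y.1 + q * y.2 + d) cos); last first.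
    by apply/derivable1_diffP; exact: ex_derive.
  apply: differentiableD; last exact: differentiable_cst.
  exact: differentiable_linear_form.
- exact: differentiableD.
- exact: differentiableM.
- by apply: differentiableM => //; exact: differentiable_cst.
Qed.

Lemma derive_along (V : normedModType R) (phi : V -> R) z v (l : R) :
  is_derive (0 : R) 1 (fun s : R => phi (z + s *: v)) l -> 'D_v phi z = l.
Proof.
move=> [_ <-]; rewrite /derive.
suff -> : (fun h : R => h^-1 *: ((phi \o shift z) (h *: v) - phi z)) =
    (fun h : R => h^-1 *: (((fun s : R => phi (z + s *: v)) \o shift 0) (h *: (1 : R)) - phi (z + 0 *: v))) by [].
by apply/funext => h /=; rewrite [_ + 0]addr0 scale0r addr0 [h *: 1]mulr1 [h *: v + z]addrC.
Qed.

Lemma trig_derive f v : trig f -> trig ('D_v f).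
Proof.
elim=> {f} [p q d|f g tf IHf tg IHg|f g tf IHf tg IHg|c f tf IH].
- rewrite (_ : 'D_v _ = fun y => (p * v.1 + q * v.2) * cos (p * y.1 + q * y.2 + (d + pi / 2))).
    by apply: trigZ; exact: trig_cos.
  apply/funext => y; apply: derive_along.
  have := is_derive_affine (a := p * v.1 + q * v.2) (b := p * y.1 + q * y.2 + d)
    (is_derive_cos ((p * v.1 + q * v.2) * 0 + (p * y.1 + q * y.2 + d))).
  rewrite mulr0 add0r addrA cosDpihalf.
  congr (is_derive _ _ _ _); apply/funext => s /=; congr cos.
  rewrite /GRing.scale /=; ring.
- rewrite (_ : 'D_v _ = fun y => 'D_v f y + 'D_v g y); first exact: trigD.
  by apply/funext => y; rewrite deriveD//; apply: diff_derivable; exact: differentiable_trig.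
- rewrite (_ : 'D_v _ = fun y => f y * 'D_v g y + g y * 'D_v f y).
    by apply: trigD; exact: trigM.
  by apply/funext => y; rewrite deriveM//; apply: diff_derivable; exact: differentiable_trig.
- rewrite (_ : 'D_v _ = fun y => c * 'D_v f y); first exact: trigZ.
  by apply/funext => y; rewrite deriveZ//; apply: diff_derivable; exact: differentiable_trig.
Qed.

Lemma smooth_trig f : trig f -> smooth f.
Proof.
move=> tf vs x; apply: differentiable_trig.
by elim: vs => // v vs IH /=; exact: trig_derive.
Qed.

End trigonometric_polynomials.

(** * Riemann sums on the unit square *)

Section unit_integrals.
Context (R : realType).
Local Notation mR := (measurableTypeR R).
Local Notation leb := (@lebesgue_measure R).
Implicit Types (g : R -> R) (f : R * R -> R).

Lemma lebesgue_unit : leb `[0%R, 1%R]%classic = 1%E.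
Proof. by rewrite lebesgue_measure_itv /= lte01 -EFinB subr0. Qed.

Lemma integrable_unit g B : measurable_fun setT (g : mR -> R) -> (forall z, `|g z| <= B) ->
  leb.-integrable `[0%R, 1%R]%classic (EFin \o g).
Proof.
move=> mg gB; apply: (@bounded_integrable _ _ _ leb _ _ _ g B) => //.
- by rewrite [X in (X < _)%E]lebesgue_unit ltry.
- exact: measurable_funTS.
Qed.

Lemma integrable_unit_square f B : measurable_fun setT (f : mR * mR -> R) -> (forall z, `|f z| <= B) ->
  (leb2 R).-integrable (unit_square R) (EFin \o f).
Proof.
move=> mf fB; apply: (@bounded_integrable _ _ _ (leb2 R) _ _ _ f B) => //.
- exact: measurable_unit_square.
- by rewrite [X in (X < _)%E]leb2_unit_square ltry.
- exact: measurable_funTS.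
Qed.

Lemma Rintegral_unit_square f B :
  measurable_fun setT (f : mR * mR -> R) -> (forall z, `|f z| <= B) ->
  \int[leb2 R]_(y in unit_square R) f y =
  \int[leb]_(x in `[0, 1]) \int[leb]_(y in `[0, 1]) f (x, y).
Proof.
move=> mf fB.
have B0 : 0 <= B by apply: le_trans (fB 0).
rewrite Rintegral_mkcond /Rintegral.
have intf : (leb \x leb)%E.-integrable setT (EFin \o (f \_ (unit_square R))).
  rewrite -restrict_EFin.
  have h : (leb2 R).-integrable setT ((EFin \o f) \_ (unit_square R)).
    apply: (@integrable_mkcond _ _ R (leb2 R) _ (EFin \o f) (measurable_unit_square R)).1.
    exact: integrable_unit_square mf fB.
  exact: h.
have := integral12_prod_meas1 intf.
rewrite /fubini_F => <-.
rewrite integral_mkcond; congr fine; apply: eq_integral => x _.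
rewrite /= restrict_EFin /= !patchE; case: ifPn => [/set_mem x01|/negP x01].
  rewrite fineK; last first.
    apply: (@integrable_fin_num _ _ _ leb); first exact: measurable_itv.
    apply: (@integrable_unit (fun y => f (x, y)) B) => //.
    exact: (measurableT_comp mf (measurable_pair1 x)).
  rewrite [RHS]integral_mkcond; apply: eq_integral => y _.
  rewrite restrict_EFin /= !patchE.
  rewrite (_ : ((x, y) \in unit_square R) = (y \in `[0, 1]%classic))//.
  by apply/idP/idP => /set_mem h'; apply/mem_set; [exact: h'.2|split].
apply: integral0_eq => y _; rewrite /= patchE.
case: ifPn => // /set_mem[/= x01' _]; exfalso; apply: x01; exact/mem_set.
Qed.

Lemma Rintegral_riemann_step g C a h : 0 <= h ->
  (forall x y, `|g x - g y| <= C * `|x - y|) -> measurable_fun setT (g : mR -> R) ->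
  `|\int[leb]_(x in `]a, (a + h)%R]) g x - h * g a| <= C * h ^+ 2.
Proof.
move=> h0 gC mg.
have C0 : 0 <= C by have := gC 1 0; rewrite subr0 normr1 mulr1; apply: le_trans.
have mI : measurable (`]a, (a + h)%R]%classic : set mR) by exact: measurable_itv.
have lI : leb `]a, (a + h)%R]%classic = h%:E.
  rewrite lebesgue_measure_itv /= lte_fin ltrDl; case: ltP => [_|h0'].
    by rewrite -EFinB addrAC subrr add0r.
  by have -> : h = 0 by apply/eqP; rewrite eq_le h0 h0'.
have Ioo : (leb `]a, (a + h)%R]%classic < +oo)%E by rewrite lI ltry.
have gB x : `]a, (a + h)%R]%classic x -> `|g x - g a| <= C * h.
  rewrite /= in_itv/= => /andP[ax xah]; apply: (le_trans (gC _ _)).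
  by rewrite ler_wpM2l// ger0_norm ?subr_ge0 ?(ltW ax)// lerBlDl.
have mga : measurable_fun (`]a, (a + h)%R]%classic : set mR) (fun x => g x - g a).
  by apply: measurable_funB => //; exact: measurable_funTS.
have ig : leb.-integrable (`]a, (a + h)%R]%classic) (EFin \o g).
  apply: (@bounded_integrable _ _ _ leb _ mI Ioo g (`|g a| + C * h)); first exact: measurable_funTS.
  move=> x xI; rewrite -[g x](subrK (g a)); apply: (le_trans (ler_normD _ _)).
  by rewrite addrC lerD2l gB.
have ic : leb.-integrable (`]a, (a + h)%R]%classic) (EFin \o (fun=> g a)).
  by apply: (@bounded_integrable _ _ _ leb _ mI Ioo _ `|g a|).
have -> : h * g a = \int[leb]_(x in `]a, (a + h)%R]) g a.
  by rewrite Rintegral_cst// [X in fine X]lI mulrC.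
rewrite -RintegralB//.
apply: (le_trans (Rintegral_le_bound mI Ioo mga gB)).
by rewrite [X in fine X]lI /= -mulrA -expr2.
Qed.

Lemma Rintegral_riemann g C B N : (0 < N)%N ->
  (forall x y, `|g x - g y| <= C * `|x - y|) -> (forall x, `|g x| <= B) ->
  `|\int[leb]_(x in `[0, 1]) g x - \sum_(0 <= l < N) N%:R^-1 * g (l%:R * N%:R^-1)| <= C * N%:R^-1.
Proof.
move=> N0 gC gB.
have Nr : (N%:R : R) != 0 by rewrite pnatr_eq0 -lt0n.
have mg : measurable_fun setT (g : mR -> R).
  by apply: continuous_measurable_fun; exact: lipschitz_continuous gC.
set h := N%:R^-1; have h0 : 0 <= h by rewrite invr_ge0.
have main k : `|\int[leb]_(x in `[0, (k%:R * h)%R]) g x - \sum_(0 <= l < k) h * g (l%:R * h)| <=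
    k%:R * (C * h ^+ 2).
  elim: k => [|k IH].
    by rewrite !mul0r set_itv1 Rintegral_set1 big_geq// subrr normr0.
  have ik : leb.-integrable `[0%R, k.+1%:R * h] (EFin \o g).
    apply: (@bounded_integrable _ _ _ leb _ _ _ g B) => //.
      by apply: compact_finite_measure; exact: segment_compact.
    exact: measurable_funTS.
  have E := @Rintegral_itvB _ g (BLeft 0) (BRight (k.+1%:R * h)) (k%:R * h) ik.
  have Ek : k.+1%:R * h = k%:R * h + h by rewrite -natr1 mulrDl mul1r.
  have {}E := E (_ : (BLeft 0 <= BRight (k%:R * h))%O) (_ : (BRight (k%:R * h) <= BRight (k.+1%:R * h))%O).
  move: E; rewrite !bnd_simp mulr_ge0// Ek lerDl h0 => /(_ isT isT) /eqP; rewrite subr_eq => /eqP ->.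
  rewrite big_nat_recr//= [X in X - _]addrC opprD addrACA -natr1 mulrDl mul1r.
  apply: (le_trans (ler_normD _ _)); rewrite lerD//.
  exact: Rintegral_riemann_step.
have := main N; rewrite /h mulfV//.
by rewrite (_ : N%:R * (C * _) = C * N%:R^-1)//; field.
Qed.

Lemma lip2_continuous f C :
  (forall x y, `|f x - f y| <= C * (`|x.1 - y.1| + `|x.2 - y.2|)) -> continuous f.
Proof.
move=> fC x.
have lip : lip3 C (fun z : R * (R * R) => f z.2).
  move=> z w; apply: (le_trans (fC _ _)); rewrite -addrA ler_wpM2l ?lerDr//.
  by have := fC (1, 0) (0, 0); rewrite /= !subr0 normr0 normr1 addr0 mulr1; apply: le_trans.
have h : (fun y : R * R => ((0 : R), y)) @ x --> ((0 : R), x).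
  have h1 : (fun _ : R * R => (0 : R)) @ x --> (0 : R) by exact: cvg_cst.
  have h2 : (fun y : R * R => y) @ x --> x by exact: cvg_id.
  exact: (cvg_pair h1 h2).
exact: (cvg_comp _ _ h (@lip3_continuous R C _ lip ((0 : R), x))).
Qed.

(** The one-dimensional estimate is used twice: for the sections of [f], and for
    their integrals, which are Lipschitz with the same constant. *)
Lemma Rintegral_riemann2 f C B N : (0 < N)%N ->
  (forall x y, `|f x - f y| <= C * (`|x.1 - y.1| + `|x.2 - y.2|)) -> (forall x, `|f x| <= B) ->
  `|\int[leb2 R]_(y in unit_square R) f y -
    \sum_(0 <= l < N) \sum_(0 <= r < N) N%:R^-1 ^+ 2 * f (l%:R * N%:R^-1, r%:R * N%:R^-1)| <=
  2 * C * N%:R^-1.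
Proof.
move=> N0 fC fB.
have cf : continuous f.
  exact: lip2_continuous fC.
have mf := continuous_measurable2 cf.
have N1 : 0 <= N%:R^-1 :> R by rewrite invr_ge0.
rewrite (Rintegral_unit_square mf fB).
pose G x := \int[leb]_(y in `[0, 1]) f (x, y).
have msec x : measurable_fun setT ((fun y => f (x, y)) : mR -> R).
  exact: (measurableT_comp mf (measurable_pair1 x)).
have isec x := integrable_unit (msec x) (fun y => fB (x, y)).
have mI : measurable (`[0%R, 1%R]%classic : set mR) by exact: measurable_itv.
have Ioo : (leb `[0%R, 1%R]%classic < +oo)%E by rewrite lebesgue_unit ltry.
have GB x : `|G x| <= B.
  apply: (le_trans (Rintegral_le_bound mI Ioo (measurable_funTS (msec x)) (fun y _ => fB (x, y)))).
  by rewrite [X in fine X]lebesgue_unit mulr1.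
have GC x y : `|G x - G y| <= C * `|x - y|.
  rewrite /G -RintegralB//.
  have fxy z : `|f (x, z) - f (y, z)| <= C * `|x - y|.
    by have := fC (x, z) (y, z); rewrite /= subrr normr0 addr0.
  apply: (le_trans (Rintegral_le_bound mI Ioo _ (fun z _ => fxy z))).
    by apply: measurable_funB; exact: measurable_funTS.
  by rewrite [X in fine X]lebesgue_unit mulr1.
rewrite -/(Rintegral leb `[0, 1]%classic G).
have h1 := Rintegral_riemann N0 GC GB.
have h2 l : `|G (l%:R * N%:R^-1) - \sum_(0 <= r < N) N%:R^-1 * f (l%:R * N%:R^-1, r%:R * N%:R^-1)| <= C * N%:R^-1.
  apply: (@Rintegral_riemann (fun y => f (l%:R * N%:R^-1, y)) C B N N0) => // x y.
  by have := fC (l%:R * N%:R^-1, x) (l%:R * N%:R^-1, y); rewrite /= subrr normr0 add0r.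
set S := \sum_(0 <= l < N) \sum_(0 <= r < N) _.
rewrite -(subrK (\sum_(0 <= l < N) N%:R^-1 * G (l%:R * N%:R^-1)) (Rintegral _ _ _)) -addrA.
apply: (le_trans (ler_normD _ _)).
rewrite (_ : 2 * C * N%:R^-1 = C * N%:R^-1 + C * N%:R^-1); last by ring.
apply: lerD => //.
rewrite /S -sumrB; apply: (le_trans (ler_norm_sum _ _ _)).
apply: (@le_trans _ _ (\sum_(0 <= l < N) N%:R^-1 * (C * N%:R^-1))).
  apply: ler_sum => l _; rewrite expr2; under eq_bigr do rewrite -mulrA.
  by rewrite -mulr_sumr -mulrBr normrM ger0_norm// ler_wpM2l.
rewrite sumr_const_nat subn0 -[X in X <= _]mulr_natl mulrA mulfV ?mul1r// pnatr_eq0 -lt0n//.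
Qed.

End unit_integrals.

(** * Regularized data *)

Section regularized_data.
Context (R : realType).
Local Notation mR := (measurableTypeR R).
Local Notation leb := (@lebesgue_measure R).
Local Notation I2 f := (\int[leb2 R]_(y in unit_square R) f y).
Implicit Types (k u rho g phi : R * R -> R) (x y : R * R) (M : nat).

Lemma sym_sum_bound1 M (F : nat -> int -> R) (C : R) : 0 <= C ->
  (forall l j, (l < M)%N -> `|j| <= l%:Z -> `|F l j| <= C) ->
  `|\sum_(0 <= l < M) \sum_(j <- sym_range l) F l j| <= M%:R ^+ 2 * C.
Proof.
move=> C0 FC.
have -> : M%:R ^+ 2 * C = \sum_(0 <= l < M) \sum_(j <- sym_range l) C.
  rewrite (eq_bigr (fun l : nat => (2 * l).+1%:R * C)); last first.
    by move=> l _; rewrite big_const_seq count_predT size_sym_range iter_addr_0 mulr_natl.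
  by rewrite -mulr_suml -natr_sum sum_odd natrX.
rewrite big_nat_cond [leRHS]big_nat_cond; apply: (le_trans (ler_norm_sum _ _ _)); apply: ler_sum => l /andP[/andP[_ lM] _].
rewrite big_seq [leRHS]big_seq; apply: (le_trans (ler_norm_sum _ _ _)); apply: ler_sum => j /mem_sym_range jl.
exact: FC.
Qed.

Lemma fejer_bound M z : (0 < M)%N -> `|@fejer R M z| <= M%:R.
Proof.
move=> M0; have Mr : (0 : R) < M%:R by rewrite ltr0n.
rewrite fejerE normrM gtr0_norm ?invr_gt0// mulrC ler_pdivrMr// -expr2 -[leRHS]mulr1.
by apply: sym_sum_bound1 => // l j _ _; exact: cos_max.
Qed.

Lemma fejer_lipschitz M (a b : R) : (0 < M)%N ->
  `|fejer M a - fejer M b| <= M%:R * (2 * pi * M%:R) * `|a - b|.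
Proof.
move=> M0; have Mr : (0 : R) < M%:R by rewrite ltr0n.
rewrite !fejerE -mulrBr normrM gtr0_norm ?invr_gt0// mulrC ler_pdivrMr//.
rewrite -sumrB; under eq_bigr do rewrite -sumrB.
rewrite (_ : M%:R * _ * _ * _ = M%:R ^+ 2 * (2 * pi * M%:R * `|a - b|)); last by ring.
apply: sym_sum_bound1 => [|l j lM jl]; first by rewrite !mulr_ge0 ?pi_ge0.
apply: (le_trans (cos2pi_lipschitz _ _)).
rewrite -mulrBr normrM -!mulrA ler_wpM2l// ler_wpM2l ?pi_ge0// ler_wpM2r//.
by rewrite -intr_norm -[M%:R]/((M%:Z)%:~R) ler_int; lia.
Qed.

Lemma fejer2_lipschitz M x y : (0 < M)%N -> `|fejer2 M x - fejer2 M y| <=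
  M%:R * (M%:R * (2 * pi * M%:R)) * (`|x.1 - y.1| + `|x.2 - y.2|).
Proof.
move=> M0; rewrite /fejer2.
have -> : fejer M x.1 * fejer M x.2 - fejer M y.1 * fejer M y.2 =
  (fejer M x.1 - fejer M y.1) * fejer M x.2 + fejer M y.1 * (fejer M x.2 - fejer M y.2) by ring.
apply: (le_trans (ler_normD _ _)); rewrite !normrM mulrDr; apply: lerD.
  by rewrite -mulrA mulrC ler_pM// ?fejer_bound ?fejer_lipschitz.
by rewrite -mulrA ler_pM// ?fejer_bound ?fejer_lipschitz.
Qed.

Lemma fejer2_bound M x : (0 < M)%N -> `|@fejer2 R M x| <= M%:R ^+ 2.
Proof. by move=> M0; rewrite /fejer2 normrM expr2 ler_pM// fejer_bound. Qed.

Lemma measurable_lip2 k C :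
  (forall x y, `|k x - k y| <= C * (`|x.1 - y.1| + `|x.2 - y.2|)) ->
  measurable_fun setT (k : mR * mR -> R).
Proof. by move=> kC; apply: continuous_measurable2; exact: lip2_continuous kC. Qed.

Lemma integrable_lip2M k u C B :
  (forall x y, `|k x - k y| <= C * (`|x.1 - y.1| + `|x.2 - y.2|)) ->
  (forall x, `|k x| <= B) ->
  (leb2 R).-integrable (unit_square R) (EFin \o u) ->
  (leb2 R).-integrable (unit_square R) (EFin \o (fun y => k y * u y)).
Proof.
move=> kC kB iu.
have mk := measurable_lip2 kC.
have bk : [bounded k y | y in (unit_square R : set (mR * mR))].
  exists B; split; first exact: num_real.
  by move=> C' BC' x _ /=; apply: (le_trans (kB x)); exact: ltW.
by have := @integrableMr _ _ _ (leb2 R) _ (measurable_unit_square R) k _ (measurable_funTS mk) bk iu.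
Qed.

Lemma subrBB (a b c : R) : (a - b) - (a - c) = - (b - c).
Proof. by ring. Qed.

Lemma torus_conv_lipschitz k u C B :
  (forall x y, `|k x - k y| <= C * (`|x.1 - y.1| + `|x.2 - y.2|)) ->
  (forall x, `|k x| <= B) ->
  (leb2 R).-integrable (unit_square R) (EFin \o u) ->
  forall x y, `|torus_conv k u x - torus_conv k u y| <=
    C * I2 (fun y => `|u y|) * (`|x.1 - y.1| + `|x.2 - y.2|).
Proof.
move=> kC kB iu x x'.
have kxC (z : R * R) : forall y y', `|k (z - y) - k (z - y')| <= C * (`|y.1 - y'.1| + `|y.2 - y'.2|).
  move=> [y1 y2] [y1' y2']; apply: (le_trans (kC _ _)) => /=.
  by rewrite !subrBB !normrN.
have int z := integrable_lip2M (kxC z) (fun y => kB (z - y)) iu.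
have iau : (leb2 R).-integrable (unit_square R) (EFin \o (fun y => `|u y|)).
  exact: integrable_norm iu.
have mU : measurable (unit_square R : set (mR * mR)) := measurable_unit_square R.
rewrite /torus_conv -RintegralB//.
have idiff : (leb2 R).-integrable (unit_square R) (EFin \o (fun y => k (x - y) * u y - k (x' - y) * u y)).
  exact: (integrableB _ (int x) (int x')).
apply: (le_trans (le_normr_Rintegral mU idiff)).
rewrite mulrAC -RintegralZl//; apply: le_Rintegral => //.
- exact: integrable_norm idiff.
- exact: (@integrableZl _ _ _ (leb2 R) _ mU (C * (`|x.1 - x'.1| + `|x.2 - x'.2|)) _ iau).
move=> y _; rewrite -mulrBl normrM ler_wpM2r//; apply: (le_trans (kC _ _)) => /=.
by rewrite !opprB !addrA ![_ - y.1 + y.1]subrK ![_ - y.2 + y.2]subrK.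
Qed.

Lemma integrable_conv k u C B x :
  (forall x y, `|k x - k y| <= C * (`|x.1 - y.1| + `|x.2 - y.2|)) ->
  (forall x, `|k x| <= B) ->
  (leb2 R).-integrable (unit_square R) (EFin \o u) ->
  (leb2 R).-integrable (unit_square R) (EFin \o (fun y => k (x - y) * u y)).
Proof.
move=> kC kB iu; apply: (@integrable_lip2M (fun y => k (x - y)) u C B) => // -[y1 y2] [y1' y2'].
apply: (le_trans (kC _ _)) => /=.
by rewrite !subrBB !normrN.
Qed.

(** With the primitive [Phi z = z + fejer_prim M z] of the Fejer kernel, this is
    [(Phi (x_1 + h - y_1) - Phi (x_1 - y_1)) * fejer M (x_2 - y_2)].  It is
    periodic in [y], nonnegative for [0 <= h] because [Phi] is nondecreasing, and
    its [y_1]-derivative is, up to the sign, the increment of the regularizing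
    kernel when [x_1] increases by [h]. *)
Definition datum_test M (x : R * R) (h : R) (y : R * R) : R :=
  (h + fejer_prim M (x.1 + h - y.1) - fejer_prim M (x.1 - y.1)) * fejer M (x.2 - y.2).

Lemma trig_sin (p q d : R) : trig (fun y => sin (p * y.1 + q * y.2 + d)).
Proof.
rewrite (_ : (fun y => _) = fun y : R * R => cos (p * y.1 + q * y.2 + (d - pi / 2))); first exact: trig_cos.
by apply/funext => y; rewrite addrA cosBpihalf.
Qed.

Lemma trig_fejer_prim M c : trig (fun y : R * R => fejer_prim M (c - y.1)).
Proof.
apply: trigZ; apply: trig_sum => l; apply: trigZ; apply: trig_sum => k.
rewrite (_ : (fun y => _) = fun y : R * R => (2 * pi * k.+1%:R)^-1 *
  sin (- (2 * pi * k.+1%:R) * y.1 + 0 * y.2 + 2 * pi * k.+1%:R * c)).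
  by apply: trigZ; exact: trig_sin.
by apply/funext => y; rewrite mulrC; congr (_ * sin _); ring.
Qed.

Lemma trig_fejer M c : trig (fun y : R * R => fejer M (c - y.2)).
Proof.
rewrite (_ : (fun y => _) = fun y : R * R => M%:R^-1 * \sum_(0 <= l < M) (1 + 2 * \sum_(0 <= k < l)
   cos (0 * y.1 + (- (2 * pi * k.+1%:R)) * y.2 + 2 * pi * k.+1%:R * c))).
  apply: trigZ; apply: trig_sum => l; apply: trigD; first exact: trig_cst.
  by apply: trigZ; apply: trig_sum => k; exact: trig_cos.
apply/funext => y; rewrite fejer_dirichlet; congr (_ * _); apply: eq_bigr => l _.
by congr (_ + _ * _); apply: eq_bigr => k _; rewrite /cos2pi; congr cos; ring.
Qed.

Lemma trig_datum_test M x h : trig (datum_test M x h).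
Proof.
apply: trigM; last exact: trig_fejer.
rewrite (_ : (fun y => _) = fun y : R * R => (h + fejer_prim M (x.1 + h - y.1)) + (-1) * fejer_prim M (x.1 - y.1)).
  apply: trigD; last by apply: trigZ; exact: trig_fejer_prim.
  by apply: trigD; [exact: trig_cst|exact: trig_fejer_prim].
by apply/funext => y; rewrite mulN1r.
Qed.

Lemma fejer_prim_N1 M z : fejer_prim M (z - 1) = @fejer_prim R M z.
Proof. by rewrite -[LHS]fejer_prim_periodic subrK. Qed.

Lemma torus_test_datum M x h : torus_test (datum_test M x h).
Proof.
split; first by apply: smooth_trig; exact: trig_datum_test.
move=> [y1 y2]; rewrite /datum_test /=; split.
  by rewrite !opprD !addrA !fejer_prim_N1.
by rewrite opprD addrA -[fejer M (x.2 - y2 - 1)]fejer_periodic subrK.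
Qed.

Lemma fejer_primitive_nondecreasing M : (0 < M)%N -> forall a b : R, a <= b ->
  a + fejer_prim M a <= b + fejer_prim M b.
Proof.
move=> M0 a b; rewrite le_eqVlt => /predU1P[->//|ab].
pose Fi (z : R) := z + fejer_prim M z.
have dF (z : R) : is_derive z 1 Fi (fejer M z).
  have := is_deriveD (@is_derive_id _ _ z 1) (is_derive_fejer_prim z M0).
  by rewrite [1 + _]addrC subrK.
have cF : continuous Fi.
  by move=> z; apply: differentiable_continuous; apply/derivable1_diffP; case: (dF z).
have [c _ E] := MVT ab (fun z _ => dF z) (continuous_subspaceT cF).
by rewrite -subr_ge0 -[X in _ <= X]/(Fi b - Fi a) E mulr_ge0 ?fejer_ge0// subr_ge0 ltW.
Qed.

Lemma datum_test_ge0 M x h y : (0 < M)%N -> 0 <= h -> 0 <= datum_test M x h y.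
Proof.
move=> M0 h0; rewrite /datum_test mulr_ge0 ?fejer_ge0//.
have := fejer_primitive_nondecreasing M0 (_ : x.1 - y.1 <= x.1 + h - y.1).
by rewrite lerD2r lerDl h0 => /(_ isT); lra.
Qed.

Lemma derive_datum_test M x h y : (0 < M)%N ->
  'D_(1, 0) (datum_test M x h) y =
  - (fejer2 M ((x.1 + h, x.2) - y) - fejer2 M (x - y)).
Proof.
move=> M0; apply: derive_along.
have dP c : is_derive (0 : R) 1 (fun s => fejer_prim M ((-1) * s + (c - y.1))) (-1 * (fejer M (c - y.1) - 1)).
  have h0 := is_derive_affine (is_derive_fejer_prim (-1 * 0 + (c - y.1)) M0).
  by apply: (is_derive_eq h0); rewrite mulr0 add0r.
have d1 := is_deriveB (is_deriveD (is_derive_cst h (0:R) (1:R)) (dP (x.1 + h))) (dP x.1).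
have d2 := @is_deriveZ _ _ _ _ (fejer M (x.2 - y.2)) _ _ _ d1.
rewrite (_ : (fun s => _) = fejer M (x.2 - y.2) \*: (cst h + (fun s : R => fejer_prim M (-1 * s + (x.1 + h - y.1)))
    - (fun s : R => fejer_prim M (-1 * s + (x.1 - y.1))))).
  apply: (is_derive_eq d2); rewrite /fejer2 /= /GRing.scale /=; ring.
apply/funext => s; rewrite /datum_test /= !fctE /GRing.scale /= mulr0 addr0 mulr1 mulrC.
by congr (_ * (_ + fejer_prim M _ - fejer_prim M _)); ring.
Qed.

Lemma continuous_fejer_prim M : (0 < M)%N -> continuous (@fejer_prim R M).
Proof.
move=> M0 z; apply: differentiable_continuous; apply/derivable1_diffP.
by case: (is_derive_fejer_prim z M0).
Qed.

Lemma fejer_prim_bounded M : (0 < M)%N -> exists B : R, forall z, `|@fejer_prim R M z| <= B.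
Proof.
move=> M0; exists (\sum_(0 <= l < M) \sum_(0 <= k < l) 2) => z.
have Mr : (0 : R) < M%:R by rewrite ltr0n.
rewrite /fejer_prim normrM gtr0_norm ?invr_gt0// mulrC ler_pdivrMr//.
rewrite mulr_suml; apply: (le_trans (ler_norm_sum _ _ _)); apply: ler_sum => l _.
apply: (@le_trans _ _ (\sum_(0 <= k < l) 2)); last first.
  by rewrite ler_peMr ?ler1n// sumr_ge0.
rewrite normrM ger0_norm// [leRHS](eq_bigr (fun=> 2 * 1)); last by move=> *; rewrite mulr1.
rewrite -mulr_sumr ler_wpM2l//.
apply: (le_trans (ler_norm_sum _ _ _)); apply: ler_sum => k _.
have p1 : 1 <= 2 * pi * k.+1%:R :> R.
  have := @pi_ge2 R; have : 1 <= k.+1%:R :> R by rewrite ler1n.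
  set p := pi; set q := _%:R; nra.
have p0 : 0 < 2 * pi * k.+1%:R :> R by rewrite (lt_le_trans _ p1).
by rewrite normrM normfV [`|2 * pi * _|]gtr0_norm// ler_pdivrMr// mul1r (le_trans (sin_max _)).
Qed.

Lemma continuous_fejer M : (0 < M)%N -> continuous (@fejer R M).
Proof.
move=> M0; apply: (@lipschitz_continuous _ _ (M%:R * (2 * pi * M%:R))) => a b.
exact: fejer_lipschitz.
Qed.

Lemma integral_fejer M c : (0 < M)%N -> \int[leb]_(y in `[0, 1]) fejer M (c - y) = 1.
Proof.
move=> M0.
pose F (y : R) := y - fejer_prim M (c - y).
have dF (y : R) : is_derive y 1 F (fejer M (c - y)).
  have h0 := is_derive_affine (is_derive_fejer_prim (-1 * y + c) M0).
  have h1 := is_deriveB (@is_derive_id _ _ y 1) h0.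
  rewrite (_ : F = id - (fun s : R => fejer_prim M (-1 * s + c))).
    by apply: (is_derive_eq h1); rewrite mulN1r [- y + c]addrC; ring.
  by apply/funext => s; rewrite /F !fctE mulN1r [- s + c]addrC.
have cF : continuous F.
  by move=> z; apply: differentiable_continuous; apply/derivable1_diffP; case: (dF z).
have cf : continuous (fun y : R => fejer M (c - y)).
  apply: (@lipschitz_continuous _ _ (M%:R * (2 * pi * M%:R))) => a b.
  by apply: (le_trans (fejer_lipschitz _ _ M0)); rewrite subrBB normrN.
have := @continuous_FTC2 R (fun y : R => fejer M (c - y)) F 0 1 ltr01 (continuous_subspaceT cf).
rewrite /Rintegral => -> /=.
- by rewrite /F fejer_prim_N1 subr0; ring.
- split; first by move=> z _; case: (dF z).
  + exact: (cvg_at_right_filter (cF 0)).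
  + exact: (cvg_at_left_filter (cF 1)).
- by move=> z _; rewrite derive1E; case: (dF z).
Qed.

Lemma integral_prim M c (h : R) : (0 < M)%N -> 0 <= h <= 1 ->
  \int[leb]_(y in `[0, 1]) (h + fejer_prim M (c + h - y) - fejer_prim M (c - y)) = h.
Proof.
move=> M0 h01.
have [B PB] := fejer_prim_bounded M0.
have mP a : measurable_fun setT ((fun y : R => fejer_prim M (a - y)) : mR -> R).
  apply: continuous_measurable_fun => y.
  apply: (@continuous_comp _ _ _ (fun y : R => a - y) (fejer_prim M)).
    by apply: cvgB; [exact: cvg_cst|exact: cvg_id].
  exact: continuous_fejer_prim.
have iP a : leb.-integrable `[0%R, 1%R]%classic (EFin \o (fun y : R => fejer_prim M (a - y))).
  exact: (integrable_unit (mP a) (fun y : R => PB (a - y))).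
have ih : leb.-integrable `[0%R, 1%R]%classic (EFin \o (fun=> h)).
  exact: (@integrable_unit _ (fun=> h) `|h|).
have mI : measurable (`[0%R, 1%R]%classic : set mR) by exact: measurable_itv.
have ihP : leb.-integrable `[0%R, 1%R]%classic (EFin \o (fun y : R => h + fejer_prim M (c + h - y))).
  exact: (integrableD _ ih (iP _)).
rewrite RintegralB// RintegralD// Rintegral_cst// [X in fine X]lebesgue_unit mulr1.
rewrite (_ : \int[leb]_(y in `[0, 1]) fejer_prim M (c - y) =
  \int[leb]_(y in `[0, 1]) fejer_prim M (c + h - y)); first by rewrite addrK.
have := @Rintegral_periodic_shift _ _ R leb (fun s x : R => x + s) id setT _ _ _ _ _ _ _ _ _
  (fun y : R => fejer_prim M (c + h - y)) B h h01 (mP (c + h)) (fun y : R => PB (c + h - y)).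
rewrite !setTI => <- //.
- by apply: eq_Rintegral => y _; congr fejer_prim; ring.
- by move=> s; exact: measurable_addr.
- by move=> s A; exact: lebesgue_translation.
- by move=> s t x; rewrite addrAC addrA.
- by move=> s; rewrite setTI; exact: lebesgue_measure_set1.
- by rewrite [X in (X < _)%E]lebesgue_unit ltry.
- by move=> x /=; rewrite opprD addrA fejer_prim_N1.
Qed.

Lemma trig_continuous (f : R * R -> R) : trig f -> continuous f.
Proof. by move=> tf; apply: smooth_continuous; exact: smooth_trig. Qed.

Lemma datum_test_bounded M x h : (0 < M)%N -> exists B : R, forall y, `|datum_test M x h y| <= B.
Proof.
move=> M0; have [B PB] := fejer_prim_bounded M0.
exists ((`|h| + B + B) * M%:R) => y.
rewrite /datum_test normrM ler_pM// ?fejer_bound//.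
by apply: (le_trans (ler_normB _ _)); rewrite lerD//; apply: (le_trans (ler_normD _ _)); rewrite lerD.
Qed.

Lemma integral_datum_test M x h : (0 < M)%N -> 0 <= h <= 1 -> I2 (datum_test M x h) = h.
Proof.
move=> M0 h01.
have mD := continuous_measurable2 (trig_continuous (trig_datum_test M x h)).
have [D DB] := datum_test_bounded x h M0.
rewrite (Rintegral_unit_square mD DB) /datum_test /=.
have mI : measurable (`[0%R, 1%R]%classic : set mR) by exact: measurable_itv.
rewrite -[RHS](integral_prim x.1 M0 h01); apply: eq_Rintegral => a _.
rewrite RintegralZl//; first by rewrite integral_fejer// mulr1.
apply: (@integrable_unit _ _ M%:R); last by move=> z; exact: fejer_bound.
apply: continuous_measurable_fun => y.
apply: (@continuous_comp _ _ _ (fun y : R => x.2 - y) (fejer M)).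
  by apply: cvgB; [exact: cvg_cst|exact: cvg_id].
exact: continuous_fejer.
Qed.

Lemma Rintegral_ae_ge0 (f : R * R -> R) : (leb2 R).-integrable (unit_square R) (EFin \o f) ->
  {ae leb2 R, forall x, unit_square R x -> 0 <= f x} -> 0 <= I2 f.
Proof.
move=> fi f0.
have mU : measurable (unit_square R : set (mR * mR)) := measurable_unit_square R.
have mf := measurable_int _ fi.
rewrite /Rintegral (@ae_eq_integral _ _ _ (leb2 R) _ (EFin \o (fun x => `|f x|))) //.
- by apply: fine_ge0; apply: integral_ge0 => x _; rewrite lee_fin.
- by apply/measurable_EFinP; apply: measurableT_comp => //; exact/measurable_EFinP.
- apply: filterS f0; first exact: (ae_filter_ringOfSetsType (leb2 R)).
  by move=> x fx Ux /=; rewrite ger0_norm// fx.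
Qed.

(** The derivative of the datum tested against [datum_test] is the increment of
    the regularized datum.  The test function is nonnegative with integral [h],
    and the derivative is at least [- L]. *)
Lemma regularized_datum_monotone (L : R) M rho x h : (0 < M)%N -> 0 <= h <= 1 ->
  admissible_datum L rho ->
  - (L * h) <= regularized_datum M rho (x.1 + h, x.2) - regularized_datum M rho x.
Proof.
move=> M0 h01 [_ _ [g [[ir ig wd] gL _]]].
have mU : measurable (unit_square R : set (mR * mR)) := measurable_unit_square R.
have F2C := fun x y => fejer2_lipschitz x y M0.
have F2B := fun x => @fejer2_bound M x M0.
have ic z := integrable_conv z F2C F2B ir.
have h0 : 0 <= h by case/andP : h01.
pose phi := datum_test M x h.
have tphi := torus_test_datum M x h.
have [B phiB] := datum_test_bounded x h M0.
have mphi := continuous_measurable2 (trig_continuous (trig_datum_test M x h)).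
have bphi : [bounded phi y | y in (unit_square R : set (mR * mR))].
  exists B; split; first exact: num_real.
  by move=> C' BC' y _ /=; apply: (le_trans (phiB y)); exact: ltW.
have igphi := @integrableMr _ _ _ (leb2 R) _ mU phi _ (measurable_funTS mphi) bphi ig.
have igphi' : (leb2 R).-integrable (unit_square R) (EFin \o (fun y => g y * phi y)).
  by apply: eq_integrable igphi => // y _; rewrite /= mulrC.
have iphi : (leb2 R).-integrable (unit_square R) (EFin \o phi).
  exact: integrable_unit_square mphi phiB.
have iLphi : (leb2 R).-integrable (unit_square R) (EFin \o (fun y => L * phi y)).
  exact: (integrableZl mU _ iphi).
have E : regularized_datum M rho (x.1 + h, x.2) - regularized_datum M rho x = I2 (fun y => g y * phi y).
  have -> : I2 (fun y => g y * phi y) = - I2 (fun y => rho y * 'D_(1, 0) phi y).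
    by rewrite (wd _ tphi) opprK.
  have iD : (leb2 R).-integrable (unit_square R) (EFin \o (fun y => rho y * 'D_(1, 0) phi y)).
    have := integrableB _ (ic x) (ic (x.1 + h, x.2)).
    move=> /(_ mU); apply: eq_integrable => // y _.
    by rewrite /= derive_datum_test// -EFinB; congr EFin; ring.
  rewrite /regularized_datum /torus_conv -RintegralB//.
  rewrite -mulN1r -RintegralZl//.
  by apply: eq_Rintegral => y _; rewrite derive_datum_test//; ring.
rewrite E -(integral_datum_test x M0 h01) -RintegralZl// -subr_ge0 opprK -RintegralD//.
apply: Rintegral_ae_ge0; first exact: (integrableD _ igphi' iLphi).
apply: filterS gL; first exact: (ae_filter_ringOfSetsType (leb2 R)).
move=> y gy Uy; rewrite -mulrDl mulr_ge0 ?gy//.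
exact: datum_test_ge0.
Qed.

Lemma regularized_datum_lipschitz (L : R) M rho : (0 < M)%N -> admissible_datum L rho ->
  exists K, forall x y, `|regularized_datum M rho x - regularized_datum M rho y| <=
    K * (`|x.1 - y.1| + `|x.2 - y.2|).
Proof.
move=> M0 [_ _ [g [[ir _ _] _ _]]]; eexists => x y.
exact: (torus_conv_lipschitz (fun x y => fejer2_lipschitz x y M0) (fun x => fejer2_bound x M0) ir).
Qed.

End regularized_data.

(** * Functions on the periodic grid *)

Section grid_functions.
Context (R : realType) (N : nat).
Hypothesis N0 : (0 < N)%N.
Implicit Types (w : int -> int -> R) (f : int -> R) (i j : int).

Definition periodic1 f := forall i, f (i + N%:Z) = f i.

Lemma periodic1_mod f i : periodic1 f -> f (i %% N)%Z = f i.
Proof.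
move=> fp.
have h (k : nat) i' : f (i' + k%:Z * N%:Z) = f i'.
  elim: k => [|k IH]; first by rewrite mul0r addr0.
  by rewrite -addn1 PoszD mulrDl mul1r addrA fp IH.
rewrite [in RHS](divz_eq i N) addrC; case: (i %/ N)%Z => k; first by rewrite h.
by rewrite NegzE -[LHS](h k.+1) mulNr -[RHS](h k.+1) subrK.
Qed.

Lemma grid_periodic_mod w i j : grid_periodic N w -> w (i %% N)%Z (j %% N)%Z = w i j.
Proof.
move=> wp; rewrite (@periodic1_mod (w (i %% N)%Z)); last by move=> k; exact: (wp _ _).2.
by rewrite (@periodic1_mod (w ^~ j))// => k; exact: (wp _ _).1.
Qed.

Lemma grid_max w : grid_periodic N w ->
  exists i j, forall i' j', `|w i' j'| <= `|w i j|.
Proof.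
move=> wp; pose F (p : 'I_N * 'I_N) := `|w (p.1 : nat)%:Z (p.2 : nat)%:Z|.
have [p0 _] : exists p : 'I_N * 'I_N, True by exists (Ordinal N0, Ordinal N0).
have [p _ pmax] := @arg_maxP _ _ _ p0 xpredT F isT.
exists (p.1 : nat)%:Z, (p.2 : nat)%:Z => i' j'.
have Nz : (N%:Z : int) != 0 by rewrite eqz_nat -lt0n.
have lt (k : int) : (`|(k %% N)%Z|%N < N)%N.
  by rewrite -ltz_nat gez0_abs ?modz_ge0// ltz_pmod// ltz_nat.
have E (k : int) : (k %% N)%Z = `|(k %% N)%Z|%N%:Z by rewrite gez0_abs// modz_ge0.
rewrite -(grid_periodic_mod i' j' wp) (E i') (E j').
exact: (pmax (Ordinal (lt i'), Ordinal (lt j')) isT).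
Qed.

Lemma slope_iter f c : (forall i, - c <= f (i + 1) - f i) ->
  forall (k : nat) i, f i - k%:R * c <= f (i + k%:Z).
Proof.
move=> fc k i; elim: k => [|k IH]; first by rewrite mul0r subr0 addr0.
have := fc (i + k%:Z); rewrite -addrA -PoszD addn1.
rewrite -natr1 mulrDl mul1r; lra.
Qed.

(** Fewer than [N] steps lead from [i] to [j], and each loses at most [c]. *)
Lemma periodic1_osc f c : periodic1 f -> 0 <= c -> (forall i, - c <= f (i + 1) - f i) ->
  forall i j, f i - f j <= N%:R * c.
Proof.
move=> fp c0 fc i j.
have Nz : (N%:Z : int) != 0 by rewrite eqz_nat -lt0n.
have lt : (`|((j - i) %% N)%Z|%N < N)%N.
  by rewrite -ltz_nat gez0_abs ?modz_ge0// ltz_pmod// ltz_nat.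
have := slope_iter fc `|((j - i) %% N)%Z|%N i; rewrite gez0_abs ?modz_ge0//.
have -> : f (i + ((j - i) %% N)%Z) = f j.
  by rewrite -[LHS]periodic1_mod// modzDmr addrC subrK periodic1_mod.
move=> h.
have : `|((j - i) %% N)%Z|%N%:R * c <= N%:R * c by rewrite ler_wpM2r// ler_nat ltnW.
lra.
Qed.

(** The other [N - 1] increments of a period are at least [- c], and all sum to 0. *)
Lemma periodic1_jump f c : periodic1 f -> 0 <= c -> (forall i, - c <= f (i + 1) - f i) ->
  forall i, f (i + 1) - f i + c <= N%:R * c.
Proof.
move=> fp c0 fc i.
have := slope_iter fc N.-1 (i + 1); rewrite -addrA -[1]/(1%:Z) -PoszD add1n prednK// fp.
have -> : (N%:R : R) = N.-1%:R + 1 by rewrite natr1 prednK.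
rewrite mulrDl mul1r; lra.
Qed.

Definition grid_conv (k : nat -> nat -> R) w i j : R :=
  \sum_(0 <= l < N) \sum_(0 <= r < N) N%:R^-1 ^+ 2 * k l r * w (i - l%:Z) (j - r%:Z).

Lemma grid_sum_bound (F : nat -> nat -> R) B : 0 <= B ->
  (forall l r, `|F l r| <= B) ->
  `|\sum_(0 <= l < N) \sum_(0 <= r < N) N%:R^-1 ^+ 2 * F l r| <= B.
Proof.
move=> B0 FB.
have Nr : (N%:R : R) != 0 by rewrite pnatr_eq0 -lt0n.
apply: (@le_trans _ _ (\sum_(0 <= l < N) \sum_(0 <= r < N) N%:R^-1 ^+ 2 * B)).
  apply: (le_trans (ler_norm_sum _ _ _)); apply: ler_sum => l _.
  apply: (le_trans (ler_norm_sum _ _ _)); apply: ler_sum => r _.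
  have s0 : 0 <= N%:R^-1 ^+ 2 :> R by exact: sqr_ge0.
  by rewrite normrM ger0_norm// ler_wpM2l.
rewrite !sumr_const_nat subn0 -mulrnA -[leLHS]mulr_natl natrM le_eqVlt; apply/orP; left; apply/eqP.
by field.
Qed.

Lemma grid_conv_sup k w Bk B : 0 <= Bk -> (forall l r, `|k l r| <= Bk) ->
  (forall i j, `|w i j| <= B) -> forall i j, `|grid_conv k w i j| <= Bk * B.
Proof.
move=> Bk0 kB wB i j; rewrite /grid_conv.
have B0 : 0 <= B by apply: le_trans (wB 0 0).
under eq_bigr do under eq_bigr do rewrite -mulrA.
apply: grid_sum_bound => [|l r]; first exact: mulr_ge0.
by rewrite normrM ler_pM.
Qed.

(** The rows of the kernel sum to zero, so that [w] may be replaced by its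
    difference with its values on a fixed row. *)
Lemma grid_conv_osc k w Bk B : 0 <= Bk -> (forall l r, `|k l r| <= Bk) ->
  (forall r, \sum_(0 <= l < N) k l r = 0) ->
  (forall i i' j, `|w i j - w i' j| <= B) -> forall i j, `|grid_conv k w i j| <= Bk * B.
Proof.
move=> Bk0 kB k0 wB i j.
have B0 : 0 <= B by apply: le_trans (wB 0 0 0).
rewrite (_ : grid_conv k w i j = \sum_(0 <= l < N) \sum_(0 <= r < N)
    N%:R^-1 ^+ 2 * (k l r * (w (i - l%:Z) (j - r%:Z) - w i (j - r%:Z)))).
  by apply: grid_sum_bound => [|l r]; [exact: mulr_ge0|rewrite normrM ler_pM].
rewrite /grid_conv; apply/eqP; rewrite -subr_eq0 -sumrB; apply/eqP.
under eq_bigr do rewrite -sumrB.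
rewrite exchange_big big1//= => r _.
rewrite (eq_bigr (fun l => N%:R^-1 ^+ 2 * w i (j - r%:Z) * k l r)).
  by rewrite -mulr_sumr k0 mulr0.
by move=> l _; ring.
Qed.

Lemma grid_convB k w1 w2 i j :
  grid_conv k w1 i j - grid_conv k w2 i j = grid_conv k (fun i j => w1 i j - w2 i j) i j.
Proof.
rewrite /grid_conv -sumrB; apply: eq_bigr => l _; rewrite -sumrB; apply: eq_bigr => r _; ring.
Qed.

Lemma grid_conv_kernelB k1 k2 w i j :
  grid_conv k1 w i j - grid_conv k2 w i j = grid_conv (fun l r => k1 l r - k2 l r) w i j.
Proof.
rewrite /grid_conv -sumrB; apply: eq_bigr => l _; rewrite -sumrB; apply: eq_bigr => r _; ring.
Qed.

Lemma sum_shift (F : nat -> R) : F N = F 0%N -> \sum_(0 <= l < N) F l.+1 = \sum_(0 <= l < N) F l.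
Proof.
case: N N0 => // n _ Fn.
by rewrite big_nat_recr//= Fn addrC [RHS]big_nat_recl.
Qed.

Lemma grid_conv_shift1 k w i j : grid_periodic N w -> (forall r, k N r = k 0%N r) ->
  grid_conv k w (i + 1) j = grid_conv (fun l r => k l.+1 r) w i j.
Proof.
move=> wp kp; rewrite /grid_conv.
rewrite -(@sum_shift (fun l => \sum_(0 <= r < N) N%:R^-1 ^+ 2 * k l r * w (i + 1 - l%:Z) (j - r%:Z))).
  apply: eq_bigr => l _; apply: eq_bigr => r _.
  by congr (_ * w _ _); lia.
apply: eq_bigr => r _; rewrite kp subr0; congr (_ * _).
by rewrite -[LHS](wp _ _).1 subrK.
Qed.

Lemma grid_conv_shift2 k w i j : grid_periodic N w -> (forall l, k l N = k l 0%N) ->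
  grid_conv k w i (j + 1) = grid_conv (fun l r => k l r.+1) w i j.
Proof.
move=> wp kp; rewrite /grid_conv; apply: eq_bigr => l _.
rewrite -(@sum_shift (fun r => N%:R^-1 ^+ 2 * k l r * w (i - l%:Z) (j + 1 - r%:Z))).
  by apply: eq_bigr => r _; congr (_ * w _ _); lia.
rewrite kp subr0; congr (_ * _).
by rewrite -[LHS](wp _ _).2 subrK.
Qed.

End grid_functions.

Section kernel_on_grid.
Context (R : realType) (M N : nat).
Hypotheses (M0 : (0 < M)%N) (MN : (M <= N)%N).
Let N0 : (0 < N)%N := leq_trans M0 MN.

Definition sigma_grid (l r : nat) : R := sigmaK M (l%:R * N%:R^-1, r%:R * N%:R^-1).

Lemma speedE b an (w : int -> int -> R) i j :
  speed M N b an w i j = - sgb R b * (an + grid_conv N sigma_grid w i j).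
Proof. by []. Qed.

Lemma sigma_grid_bound l r : `|sigma_grid l r| <= M%:R ^+ 2.
Proof. exact: sigmaK_bound. Qed.

Lemma sigma_grid_row r : \sum_(0 <= l < N) sigma_grid l r = 0.
Proof. exact: sigmaK_row_zero. Qed.

Let Nr : (N%:R : R) != 0. Proof. by rewrite pnatr_eq0 -lt0n. Qed.

Lemma sigma_gridN1 r : sigma_grid N r = sigma_grid 0 r.
Proof.
rewrite /sigma_grid mulfV// mul0r.
by rewrite -[RHS](sigmaK_periodic M (0, r%:R * N%:R^-1)).1 /= add0r.
Qed.

Lemma sigma_gridN2 l : sigma_grid l N = sigma_grid l 0.
Proof.
rewrite /sigma_grid mulfV// mul0r.
by rewrite -[RHS](sigmaK_periodic M (l%:R * N%:R^-1, 0)).2 /= add0r.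
Qed.

Definition sigma_lip : R := M%:R ^+ 2 * (2 * pi * M%:R).

Lemma sigma_lip_ge0 : 0 <= sigma_lip.
Proof. by rewrite !mulr_ge0 ?pi_ge0. Qed.

(** The difference is put on the kernel.  The rows of the difference of kernels
    sum to zero as well, so that only the oscillation of [w] enters. *)
Lemma sigma_conv_lip1 w B i j : grid_periodic N w ->
  (forall i i' j, `|w i j - w i' j| <= B) ->
  `|grid_conv N sigma_grid w (i + 1) j - grid_conv N sigma_grid w i j| <= sigma_lip * N%:R^-1 * B.
Proof.
move=> wp wB; rewrite grid_conv_shift1//; last exact: sigma_gridN1.
rewrite grid_conv_kernelB; apply: grid_conv_osc => //.
- by rewrite mulr_ge0 ?invr_ge0 ?sigma_lip_ge0.
- move=> l r; apply: (le_trans (sigmaK_lipschitz _ _ _)) => /=.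
  rewrite subrr normr0 addr0 -mulrBl -[l.+1%:R]natr1 addrAC subrr add0r mul1r.
  by rewrite ger0_norm ?invr_ge0.
- move=> r; rewrite sumrB (@sum_shift R N N0 (sigma_grid ^~ r) (sigma_gridN1 r)) /=.
  by rewrite !sigma_grid_row subrr.
Qed.

Lemma sigma_conv_lip2 w B i j : grid_periodic N w ->
  (forall i i' j, `|w i j - w i' j| <= B) ->
  `|grid_conv N sigma_grid w i (j + 1) - grid_conv N sigma_grid w i j| <= sigma_lip * N%:R^-1 * B.
Proof.
move=> wp wB; rewrite grid_conv_shift2//; last exact: sigma_gridN2.
rewrite grid_conv_kernelB; apply: grid_conv_osc => //.
- by rewrite mulr_ge0 ?invr_ge0 ?sigma_lip_ge0.
- move=> l r; apply: (le_trans (sigmaK_lipschitz _ _ _)) => /=.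
  rewrite subrr normr0 add0r -mulrBl -[r.+1%:R]natr1 addrAC subrr add0r mul1r.
  by rewrite ger0_norm ?invr_ge0.
- by move=> r; rewrite sumrB !sigma_grid_row subrr.
Qed.

End kernel_on_grid.

(** * One step of the scheme *)

Section parts.
Context (R : realType).
Implicit Types x y : R.

Lemma pos_part_ge0 x : 0 <= pos_part x.
Proof. by rewrite /pos_part divr_ge0//; have := ler_norm (- x); rewrite normrN; lra. Qed.

Lemma neg_part_ge0 x : 0 <= neg_part x.
Proof. by rewrite /neg_part divr_ge0//; have := ler_norm x; lra. Qed.

Lemma pos_partD x : pos_part x + neg_part x = `|x|.
Proof. by rewrite /pos_part /neg_part; field. Qed.

Lemma pos_partB x : pos_part x - neg_part x = x.
Proof. by rewrite /pos_part /neg_part; field. Qed.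

Lemma pos_part_lip x y : `|pos_part x - pos_part y| <= `|x - y|.
Proof.
rewrite /pos_part -mulrBl normrM [`|2^-1|]ger0_norm// ler_pdivrMr//.
rewrite opprD addrACA; apply: (le_trans (ler_normD _ _)).
have := ler_dist_dist x y; lra.
Qed.

Lemma neg_part_lip x y : `|neg_part x - neg_part y| <= `|x - y|.
Proof.
rewrite /neg_part -mulrBl normrM [`|2^-1|]ger0_norm// ler_pdivrMr//.
rewrite opprD addrACA; apply: (le_trans (ler_normD _ _)).
have := ler_dist_dist x y; rewrite -opprD normrN; lra.
Qed.

(** Only one of the two parts is nonzero, but the bound by the sum of the parts
    is enough. *)
Lemma upwind_bound x (a b c : R) : 0 <= a <= c -> 0 <= b <= c ->
  `|pos_part x * a - neg_part x * b| <= `|x| * c.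
Proof.
move=> /andP[a0 ac] /andP[b0 bc]; rewrite -pos_partD.
have := pos_part_ge0 x; have := neg_part_ge0 x.
set p := pos_part x; set n := neg_part x => n0 p0.
rewrite ler_norml; apply/andP; split; nra.
Qed.

End parts.

Section one_step.
Context (R : realType) (M N : nat).
Hypotheses (M0 : (0 < M)%N) (MN : (M <= N)%N).
Variables (L dt an Na : R) (v0 v1 : bool -> int -> int -> R).
Hypotheses (L0 : 0 < L) (dt0 : 0 < dt) (anNa : `|an| <= Na).
Hypotheses (p0 : forall b, grid_periodic N (v0 b)) (p1 : forall b, grid_periodic N (v1 b)).

Let N0 : (0 < N)%N := leq_trans M0 MN.
Let Nr : (N%:R : R) != 0. Proof. by rewrite pnatr_eq0 -lt0n. Qed.
Let Np : 0 < (N%:R : R). Proof. by rewrite ltr0n. Qed.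
Let dx : R := space_step R N.
Let dx0 : 0 < dx. Proof. by rewrite invr_gt0. Qed.
Let mu := dt / dx.
Let mu0 : 0 < mu. Proof. exact: divr_gt0. Qed.
Let A := 4 * M%:R ^+ 2 * L + Na.

Hypotheses (cfl1 : mu < 1 / (4 * A)) (cfl2 : mu < 1 / (18 * M%:R ^+ 2 * L)).

Definition grid_diff (v : bool -> int -> int -> R) i j := v true i j - v false i j.

Let lam b i j := speed M N b an (grid_diff v1) i j.

Hypothesis scheme : forall b i j,
  (v1 b i j - v0 b i j) / dt =
    pos_part (lam b i j) * (grid_slope N (v0 b) i j + L) -
    neg_part (lam b i j) * (grid_slope N (v0 b) (i - 1) j + L).

(** The increments in the first direction of [v + L x_1]. *)
Definition jump (v : bool -> int -> int -> R) b (i j : int) :=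
  v b (i + 1) j - v b i j + L * space_step R N.

Lemma slopeE (v : bool -> int -> int -> R) b i j : grid_slope N (v b) i j + L = jump v b i j / dx.
Proof. by rewrite /grid_slope /jump -/dx [RHS]mulrDl mulfK// gt_eqF. Qed.

Lemma schemeE b i j : v1 b i j = v0 b i j +
  mu * (pos_part (lam b i j) * jump v0 b i j - neg_part (lam b i j) * jump v0 b (i - 1) j).
Proof.
have /eqP := scheme b i j; rewrite !slopeE.
rewrite -subr_eq0 => /eqP h; apply/eqP; rewrite -subr_eq0; apply/eqP.
rewrite -[RHS](mulr0 dt) -h /mu; field.
by rewrite !gt_eqF.
Qed.

Lemma LdxE : N%:R * (L * dx) = L.
Proof. by rewrite /dx /space_step mulrCA mulfV ?mulr1. Qed.

Lemma grid_diff_periodic v : (forall b, grid_periodic N (v b)) -> grid_periodic N (grid_diff v).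
Proof. by move=> vp i j; rewrite /grid_diff !(vp _ i j).1 !(vp _ i j).2. Qed.

Section monotone.
Variables (v : bool -> int -> int -> R).
Hypothesis (vp : forall b, grid_periodic N (v b)) (D0 : forall b i j, 0 <= jump v b i j).

Let col b j : periodic1 N (fun i => v b i j).
Proof. by move=> i; exact: (vp b i j).1. Qed.

Let slope_ge b i j : - (L * dx) <= v b (i + 1) j - v b i j.
Proof. by have := D0 b i j; rewrite /jump -/dx; lra. Qed.

Let Ldx0 : 0 <= L * dx. Proof. by rewrite mulr_ge0 ?ltW. Qed.

Lemma jump_le b i j : jump v b i j <= L.
Proof.
by have := periodic1_jump N0 (col b j) Ldx0 (fun i => slope_ge b i j) i; rewrite LdxE.
Qed.

Lemma grid_diff_osc i i' j : `|grid_diff v i j - grid_diff v i' j| <= 2 * L.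
Proof.
have h b i1 i2 : v b i1 j - v b i2 j <= L.
  by have := periodic1_osc N0 (col b j) Ldx0 (fun i => slope_ge b i j) i1 i2; rewrite LdxE.
have := h true i i'; have := h true i' i; have := h false i i'; have := h false i' i.
by rewrite /grid_diff ler_norml => *; apply/andP; split; lra.
Qed.

(** The constant [2 M ^ 2 L] is the bound [M ^ 2] of the kernel times the
    oscillation [2 L] of the difference of two functions of oscillation [L]. *)
Lemma conv_le i j : `|grid_conv N (sigma_grid R M N) (grid_diff v) i j| <= 2 * M%:R ^+ 2 * L.
Proof.
apply: le_trans (grid_conv_osc N0 _ (@sigma_grid_bound R M N) (sigma_grid_row R M0 MN) grid_diff_osc i j) _.
  exact: sqr_ge0.
by rewrite mulrCA mulrA.
Qed.

Lemma speed_lip1 b i j : `|speed M N b an (grid_diff v) (i + 1) j - speed M N b an (grid_diff v) i j|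
  <= 2 * L * sigma_lip R M * dx.
Proof.
have sg : `|- sgb R b| = 1 by rewrite normrN; case: b; rewrite /= ?normrN normr1.
rewrite !speedE -mulrBr normrM sg mul1r opprD addrACA subrr add0r.
apply: le_trans (sigma_conv_lip1 M0 MN _ _ (grid_diff_periodic vp) grid_diff_osc) _.
by rewrite le_eqVlt; apply/orP; left; apply/eqP; rewrite /dx /space_step; ring.
Qed.

Lemma speed_lip2 b i j : `|speed M N b an (grid_diff v) i (j + 1) - speed M N b an (grid_diff v) i j|
  <= 2 * L * sigma_lip R M * dx.
Proof.
have sg : `|- sgb R b| = 1 by rewrite normrN; case: b; rewrite /= ?normrN normr1.
rewrite !speedE -mulrBr normrM sg mul1r opprD addrACA subrr add0r.
apply: le_trans (sigma_conv_lip2 M0 MN _ _ (grid_diff_periodic vp) grid_diff_osc) _.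
by rewrite le_eqVlt; apply/orP; left; apply/eqP; rewrite /dx /space_step; ring.
Qed.

End monotone.

Hypothesis D0 : forall b i j, 0 <= jump v0 b i j.

Definition speed_max : R := 9 / 8 * (Na + 2 * M%:R ^+ 2 * L).

(** Let [Lam] be the largest velocity at the new time.  In one step the densities
    vary by at most [mu * Lam * L], hence the convolution by [2 * M ^ 2 * mu * Lam * L],
    which is at most [Lam / 9] by the CFL condition; the convolution at the old
    time is bounded by monotonicity.  The factor [9 / 8] in [speed_max] comes from
    absorbing [Lam / 9]. *)
Lemma speed_self_bound b i j : `|lam b i j| <= speed_max.
Proof.
have sg b' : `|- sgb R b'| = 1 by rewrite normrN; case: b'; rewrite /= ?normrN normr1.
pose P i j := an + grid_conv N (sigma_grid R M N) (grid_diff v1) i j.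
have lamE b' i' j' : `|lam b' i' j'| = `|P i' j'| by rewrite /lam speedE normrM sg mul1r.
have convp : grid_periodic N P.
  move=> i' j'; rewrite /P /grid_conv; split; congr (_ + _);
    do 2 (apply: eq_bigr => ? _); congr (_ * _); rewrite addrAC.
    by rewrite (grid_diff_periodic p1 _ _).1.
  by rewrite (grid_diff_periodic p1 _ _).2.
have [i0 [j0 Pmax]] := grid_max N0 convp.
set Lam := `|P i0 j0| in Pmax.
have Lam0 : 0 <= Lam by exact: normr_ge0.
rewrite lamE; apply: (le_trans (Pmax i j)).
have incr b' i' j' : `|v1 b' i' j' - v0 b' i' j'| <= mu * (Lam * L).
  rewrite schemeE addrAC subrr add0r normrM gtr0_norm// ler_pM2l//.
  apply: (le_trans (upwind_bound (c := L) _ _ _)).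
  - by rewrite D0 jump_le.
  - by rewrite D0 jump_le.
  - by rewrite ler_wpM2r ?(ltW L0)// lamE.
have dconv i' j' : `|grid_conv N (sigma_grid R M N) (grid_diff v1) i' j' -
     grid_conv N (sigma_grid R M N) (grid_diff v0) i' j'| <= M%:R ^+ 2 * (2 * (mu * (Lam * L))).
  rewrite grid_convB; apply: grid_conv_sup => //; first exact: sigma_grid_bound.
  move=> i'' j''; rewrite /grid_diff.
  have := incr true i'' j''; have := incr false i'' j''; rewrite !ler_norml.
  by move=> /andP[? ?] /andP[? ?]; apply/andP; split; lra.
have M2 : 0 < M%:R ^+ 2 :> R by rewrite exprn_gt0// ltr0n.
have muML : mu * (18 * M%:R ^+ 2 * L) <= 1.
  have p : 0 < 18 * M%:R ^+ 2 * L by rewrite mulr_gt0// mulr_gt0.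
  by rewrite -(ler_pdivlMr _ _ p) ltW.
(* [1 / 9] bounds [2 * M ^ 2 * mu * L] *)
have key : Lam <= Na + 2 * M%:R ^+ 2 * L + 1 / 9 * Lam.
  rewrite {1}/Lam /P; apply: (le_trans (ler_normD _ _)); rewrite -addrA lerD//.
  rewrite -[grid_conv _ _ _ i0 j0](subrK (grid_conv N (sigma_grid R M N) (grid_diff v0) i0 j0)).
  rewrite addrC; apply: (le_trans (ler_normD _ _)).
  apply: lerD; last exact: conv_le.
  apply: (le_trans (dconv _ _)).
  rewrite (_ : _ * _ = 1 / 9 * (mu * (18 * M%:R ^+ 2 * L)) * Lam); last by field.
  by rewrite ler_wpM2r// -[leRHS]mulr1 ler_wpM2l.
rewrite /speed_max; lra.
Qed.

Let Na0 : 0 <= Na. Proof. exact: le_trans anNa. Qed.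
Let A0 : 0 < A.
Proof. by rewrite /A ltr_wpDr// mulr_gt0// mulr_gt0// exprn_gt0// ltr0n. Qed.

(** By the other CFL condition, [mu * speed_max] is at most [9 / 8 * 1 / 4]. *)
Lemma mu_speed b i j : mu * `|lam b i j| <= 1 / 2.
Proof.
have h1 : speed_max <= 9 / 8 * A.
  rewrite /speed_max ler_wpM2l// /A addrC lerD2r -!mulrA ler_wpM2r ?ler_nat//.
  by rewrite !mulr_ge0// ltW.
have h2 : mu * A <= 1 / 4.
  rewrite -ler_pdivlMr// ltW// (lt_le_trans cfl1)// le_eqVlt; apply/orP; left; apply/eqP.
  by field; rewrite gt_eqF.
have h3 : mu * `|lam b i j| <= mu * (9 / 8 * A).
  by rewrite ler_wpM2l ?(ltW mu0)// (le_trans (speed_self_bound _ _ _)).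
lra.
Qed.

Let pl b i j := mu * pos_part (lam b i j).
Let nl b i j := mu * neg_part (lam b i j).
Let pl0 b i j : 0 <= pl b i j. Proof. by rewrite mulr_ge0 ?pos_part_ge0 ?ltW. Qed.
Let nl0 b i j : 0 <= nl b i j. Proof. by rewrite mulr_ge0 ?neg_part_ge0 ?ltW. Qed.
Let pnl b i j : pl b i j + nl b i j <= 1 / 2.
Proof. by rewrite -mulrDr pos_partD mu_speed. Qed.
Let pnlB b i j : pl b i j - nl b i j = mu * lam b i j.
Proof. by rewrite -mulrBr pos_partB. Qed.
Let schemeE' b i j : v1 b i j = v0 b i j + pl b i j * jump v0 b i j - nl b i j * jump v0 b (i - 1) j.
Proof. by rewrite schemeE /pl /nl; ring. Qed.

(** Harten's incremental form of the scheme: the coefficients are nonnegative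
    when [mu * `|lam|] is at most [1 / 2]. *)
Lemma jumpE b i j : jump v1 b i j =
  jump v0 b i j * (1 - nl b (i + 1) j - pl b i j) +
  pl b (i + 1) j * jump v0 b (i + 1) j + nl b i j * jump v0 b (i - 1) j.
Proof. by rewrite {1}/jump !schemeE' addrK; rewrite /jump; ring. Qed.

Lemma jump_ge0 b i j : 0 <= jump v1 b i j.
Proof.
rewrite jumpE !addr_ge0// mulr_ge0//.
have := pnl b (i + 1) j; have := pnl b i j; have := pl0 b (i + 1) j; have := nl0 b i j; lra.
Qed.

Definition speed_lip : R := 2 * L * sigma_lip R M.

Lemma speed_lip_ge0 : 0 <= speed_lip.
Proof. by rewrite mulr_ge0 ?sigma_lip_ge0// mulr_ge0// ltW. Qed.

Let mu_dx : mu * dx = dt. Proof. by rewrite /mu divfK// gt_eqF. Qed.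

(** The coefficients in [jumpE] add up to [1 + mu * (lam_(i + 1) - lam_i)], and
    the velocity is Lipschitz. *)
Lemma jump_growth S : 0 <= S -> (forall b i j, jump v0 b i j <= S * dx) ->
  forall b i j, jump v1 b i j <= S * (1 + speed_lip * dt) * dx.
Proof.
move=> S0 SD b i j; rewrite jumpE.
have c0 : 0 <= 1 - nl b (i + 1) j - pl b i j.
  have := pnl b (i + 1) j; have := pnl b i j; have := pl0 b (i + 1) j; have := nl0 b i j; lra.
apply: (@le_trans _ _ (S * dx * (1 - nl b (i + 1) j - pl b i j) + pl b (i + 1) j * (S * dx) + nl b i j * (S * dx))).
  by apply: lerD; [apply: lerD; [rewrite ler_wpM2r|rewrite ler_wpM2l]|rewrite ler_wpM2l].
rewrite (_ : _ + _ + _ = S * dx * (1 + ((pl b (i + 1) j - nl b (i + 1) j) - (pl b i j - nl b i j)))); last by ring.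
rewrite [leRHS]mulrAC ler_wpM2l ?(mulr_ge0 S0 (ltW dx0))// lerD2l !pnlB -mulrBr.
rewrite -mu_dx [leRHS]mulrCA ler_wpM2l ?(ltW mu0)//.
exact: (le_trans (ler_norm _) (speed_lip1 p1 jump_ge0 b i j)).
Qed.

(** The x_2-increments are transported with nonnegative coefficients of sum 1,
    up to the variation in x_2 of the velocity times the slopes. *)
Lemma cross_growth S H : 0 <= S -> (forall b i j, jump v0 b i j <= S * dx) ->
  (forall b i j, `|v0 b i (j + 1) - v0 b i j| <= H) ->
  forall b i j, `|v1 b i (j + 1) - v1 b i j| <= H + 2 * speed_lip * S * dt * dx.
Proof.
move=> S0 SD HH b i j.
pose H0 i j := v0 b i (j + 1) - v0 b i j.
have Hge : 0 <= H by apply: le_trans (HH b i j).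
have E : v1 b i (j + 1) - v1 b i j =
  (H0 i j * (1 - pl b i (j + 1) - nl b i (j + 1)) + pl b i (j + 1) * H0 (i + 1) j + nl b i (j + 1) * H0 (i - 1) j)
  + ((pl b i (j + 1) - pl b i j) * jump v0 b i j - (nl b i (j + 1) - nl b i j) * jump v0 b (i - 1) j).
  by rewrite !schemeE' /H0 /jump !subrK; ring.
rewrite E; apply: (le_trans (ler_normD _ _)); apply: lerD.
  have c0 : 0 <= 1 - pl b i (j + 1) - nl b i (j + 1).
    by have := pnl b i (j + 1); lra.
  apply: (le_trans (ler_normD _ _)).
  apply: (@le_trans _ _ (H * (1 - pl b i (j + 1) - nl b i (j + 1)) + pl b i (j + 1) * H + nl b i (j + 1) * H)).
    apply: lerD; last by rewrite normrM (ger0_norm (nl0 _ _ _)) ler_wpM2l ?HH.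
    apply: (le_trans (ler_normD _ _)); apply: lerD.
      by rewrite normrM (ger0_norm c0) ler_wpM2r ?HH.
    by rewrite normrM (ger0_norm (pl0 _ _ _)) ler_wpM2l ?HH.
  by rewrite le_eqVlt; apply/orP; left; apply/eqP; ring.
have lip := speed_lip2 p1 jump_ge0 b i j.
apply: (le_trans (ler_normB _ _)).
have bound (x y : R) : `|x| <= mu * (2 * L * sigma_lip R M * dx) -> 0 <= y <= S * dx ->
   `|x * y| <= speed_lip * dt * (S * dx).
  move=> xb /andP[y0 yS]; rewrite normrM (ger0_norm y0) ler_pM//.
  by rewrite -mu_dx mulrCA.
rewrite (_ : 2 * speed_lip * S * dt * dx = speed_lip * dt * (S * dx) + speed_lip * dt * (S * dx)); last by ring.
by apply: lerD; apply: bound; rewrite ?D0 ?SD// -mulrBr normrM (gtr0_norm mu0) ler_wpM2l ?(ltW mu0)//;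
  [apply: le_trans (pos_part_lip _ _) lip|apply: le_trans (neg_part_lip _ _) lip].
Qed.

Lemma time_growth S : 0 <= S -> (forall b i j, jump v0 b i j <= S * dx) ->
  forall b i j, `|v1 b i j - v0 b i j| <= speed_max * S * dt.
Proof.
move=> S0 SD b i j; rewrite schemeE addrAC subrr add0r normrM gtr0_norm//.
rewrite (_ : speed_max * S * dt = mu * (speed_max * (S * dx))); last by rewrite -mu_dx; ring.
rewrite ler_pM2l//.
apply: (le_trans (upwind_bound (c := S * dx) _ _ _)); rewrite ?D0 ?SD//.
by rewrite ler_wpM2r ?speed_self_bound// mulr_ge0// ltW.
Qed.

End one_step.

(** * Lipschitz bounds for the discrete solution *)

Section clamp.
Context (R : realType) (T : R).
Hypothesis T0 : 0 <= T.

(** The projection on [0, T].  Composed with it, a function on [0, T] extends to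
    the line with the same bounds and the same modulus of continuity. *)
Definition clamp (t : R) : R := if t < 0 then 0 else if T < t then T else t.

Lemma clamp_itv t : 0 <= clamp t <= T.
Proof. by rewrite /clamp; case: ltP => t0; [rewrite lexx T0|case: ltP => tT; rewrite ?T0 ?lexx ?t0 ?tT]. Qed.

Lemma clamp_id t : 0 <= t <= T -> clamp t = t.
Proof. by move=> /andP[t0 tT]; rewrite /clamp !ltNge t0 tT. Qed.

Lemma clamp_lip s t : `|clamp s - clamp t| <= `|s - t|.
Proof.
wlog st : s t / s <= t.
  by move=> h; case: (leP s t) => [|/ltW] /h//; rewrite distrC [leRHS]distrC.
have cst : clamp s <= clamp t.
  by rewrite /clamp; case: ltP => ?; case: ltP => ?; case: ltP => ?; rewrite ?lexx//; try case: ltP => ?; lra.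
rewrite !(distrC s) !(distrC (clamp s)) !ger0_norm ?subr_ge0//.
by rewrite /clamp; case: ltP => ?; case: ltP => ?; case: ltP => ?; rewrite ?lexx//; try case: ltP => ?; lra.
Qed.

Lemma clamp_cvg s : clamp t @[t --> s] --> clamp s.
Proof.
apply/cvgrPdist_lt => e e0; near=> t.
apply: le_lt_trans (clamp_lip _ _) _; near: t.
by move/cvgrPdist_lt : (@cvg_id R (nbhs s)); exact.
Unshelve. all: by end_near. Qed.

Lemma continuous_clamp (a : R -> R) : {within `[0, T], continuous a} -> continuous (a \o clamp).
Proof.
move=> ca s; apply/cvgrPdist_lt => e e0.
have /subspace_continuousP/(_ (clamp s)) := ca.
have cs : `[0, T]%classic (clamp s) by rewrite /= in_itv /= clamp_itv.
move=> /(_ cs)/cvgrPdist_lt/(_ _ e0); rewrite near_withinE => h.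
near=> t.
have : `[0, T]%classic (clamp t) by rewrite /= in_itv /= clamp_itv.
by near: t; exact: (clamp_cvg h).
Unshelve. all: by end_near. Qed.

End clamp.

(** By continuity a value above the essential supremum would persist on an
    interval, which has positive measure. *)
Lemma Linfty_norm_ge (R : realType) (T : R) (a : R -> R) t : 0 < T ->
  {within `[0, T], continuous a} -> 0 <= t <= T -> `|a t| <= Linfty_norm T a.
Proof.
move=> T0 ca tT; have T0' := ltW T0.
have ct := continuous_clamp T0' ca.
have cnt : continuous (fun t => `|a (clamp T t)|).
  by move=> s; apply: cvg_norm; exact: ct.
have muT : (0 < time_measure T [set: R])%E.
  by rewrite /time_measure/= /mrestr setTI lebesgue_measure_itv/= lte_fin T0 oppr0 adde0 lte_fin.
pose s := ess_sup (time_measure T) (abse \o (EFin \o a)).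
have sE : Linfty_norm T a = fine s by rewrite /Linfty_norm unlock muT.
have [c _ cmax] := EVT_max T0' (continuous_subspaceT cnt).
have sle : (s <= `|a (clamp T c)|%:E)%E.
  apply/ess_supP; exists (~` `]0, T[%classic); split.
  - by apply: measurableC; exact: measurable_itv.
  - by rewrite /time_measure/= /mrestr setICl measure0.
  - move=> x /= xN xT; apply: xN; rewrite lee_fin.
    have xT' : 0 <= x <= T by move: xT; rewrite /= in_itv /= => /andP[/ltW-> /ltW->].
    by have := cmax x; rewrite in_itv/= (clamp_id xT'); exact.
have s0 : (0 <= s)%E by apply: ess_sup_gee => //; apply: aeW => x /=; rewrite lee_fin.
have sfin : s \is a fin_num.
  by rewrite ge0_fin_numE// (le_lt_trans sle) ?ltry.
rewrite sE leNgt; apply/negP => hlt.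
have : (fine s < `|a (clamp T t)|) by rewrite clamp_id.
move=> {}hlt.
have /cvgrPdist_lt/(_ (`|a (clamp T t)| - fine s)) := cnt t.
rewrite subr_gt0 => /(_ hlt) [d /= d0 dU].
pose lo := Num.max 0 (t - d); pose hi := Num.min T (t + d).
have lohi : lo < hi.
  move: tT => /andP[t0 tT].
  by rewrite /lo /hi gt_max !lt_min; apply/andP; split; apply/andP; split; lra.
have [A [mA A0 sub]] := ess_sup_ge (time_measure T) (abse \o (EFin \o a)).
have : (lebesgue_measure `]lo, hi[%classic <= time_measure T A)%E.
  rewrite /time_measure/= /mrestr; apply: le_measure; rewrite ?inE.
  - exact: measurable_itv.
  - by apply: measurableI => //; exact: measurable_itv.
  - move=> x /=; rewrite in_itv/= /lo /hi gt_max lt_min => /andP[/andP[x0 xt] /andP[xT tx]].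
    split; last by rewrite /= in_itv/= x0 xT.
    apply: sub => /=; apply/negP; rewrite -ltNge -/s -(fineK sfin) lte_fin.
    have xT' : 0 <= x <= T by rewrite !ltW.
    have /dU : ball_ [eta Num.norm] t d x.
      by rewrite /ball_ /= ltr_norml; apply/andP; split; lra.
    rewrite (clamp_id xT') => h; have := ler_norm (`|a (clamp T t)| - `|a x|); lra.
by rewrite A0 lebesgue_measure_itv/= lte_fin lohi leNgt lte_fin subr_gt0 lohi.
Qed.

Section uniform_lipschitz.
Context (R : realType) (T L K0 : R) (a : R -> R) (rho0 : bool -> R * R -> R) (M N NT : nat).
Variable v : bool -> nat -> int -> int -> R.
Hypotheses (T0 : 0 < T) (L0 : 0 < L) (ca : {within `[0, T], continuous a}).
Hypotheses (adm : forall b, admissible_datum L (rho0 b)) (M0 : (0 < M)%N) (MN : (M <= N)%N).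
Hypotheses (NT0 : (0 < NT)%N) (cfl : CFL T L a M N NT).
Hypothesis sol : scheme_solution T L a rho0 M N NT v.
Hypothesis datum_lip : forall b x y, `|regularized_datum M (rho0 b) x - regularized_datum M (rho0 b) y|
  <= K0 * (`|x.1 - y.1| + `|x.2 - y.2|).

Let N0 : (0 < N)%N := leq_trans M0 MN.
Let dx : R := space_step R N.
Let dt := time_step T NT.
Let dx0 : 0 < dx. Proof. by rewrite invr_gt0 ltr0n. Qed.
Let dt0 : 0 < dt. Proof. by rewrite divr_gt0 ?ltr0n. Qed.
Let K00 : 0 <= K0.
Proof.
by have := datum_lip true (1, 0) (0, 0); rewrite /= !subr0 normr0 normr1 addr0 mulr1; apply: le_trans.
Qed.
Let w n b := v b n.
Let Na := Linfty_norm T a.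

Let dtT : NT%:R * dt = T.
Proof. by rewrite /dt /time_step mulrC divfK// pnatr_eq0 -lt0n. Qed.

Let n_dt n : (n <= NT)%N -> 0 <= n%:R * dt <= T.
Proof.
move=> nN; rewrite mulr_ge0 ?(ltW dt0)//= -[leRHS]dtT.
by rewrite ler_wpM2r ?(ltW dt0) ?ler_nat.
Qed.

Let an_le n : (n <= NT)%N -> `|a (n%:R * dt)| <= Na.
Proof. by move=> /n_dt; exact: Linfty_norm_ge. Qed.

Let per n : (n <= NT)%N -> forall b, grid_periodic N (w n b).
Proof. by move=> nN b; have [+ _ _] := sol; exact. Qed.

Let cfl1 : dt / dx < 1 / (4 * (4 * M%:R ^+ 2 * L + Na)).
Proof. by have [+ _] := cfl; rewrite lt_min => /andP[]. Qed.

Let cfl2 : dt / dx < 1 / (18 * M%:R ^+ 2 * L).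
Proof. by have [+ _] := cfl; rewrite lt_min => /andP[]. Qed.

Let step n (nN : (n < NT)%N) b i j :
  (w n.+1 b i j - w n b i j) / dt =
    pos_part (speed M N b (a (n.+1%:R * dt)) (grid_diff (w n.+1)) i j) * (grid_slope N (w n b) i j + L) -
    neg_part (speed M N b (a (n.+1%:R * dt)) (grid_diff (w n.+1)) i j) * (grid_slope N (w n b) (i - 1) j + L).
Proof. by have [_ _ h] := sol; exact: h. Qed.

Let J0 n : (n <= NT)%N -> forall b i j, 0 <= jump N L (w n) b i j.
Proof.
elim: n => [_ b i j|n IH nN].
  have [_ v0 _] := sol.
  have dx1 : 0 <= dx <= 1 by rewrite (ltW dx0) invf_le1 ?ltr0n// ler1n.
  have := regularized_datum_monotone (i%:~R * dx, j%:~R * dx) M0 dx1 (adm b).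
  by rewrite /jump /w !v0 -/dx intrD [(_ + 1%:~R) * _]mulrDl mul1r /=; lra.
exact: (jump_ge0 M0 MN L0 dt0 (an_le nN) (per (ltnW nN)) (per nN) cfl1 cfl2 (step nN) (IH (ltnW nN))).
Qed.

Let q := 1 + speed_lip M L * dt.
Let q1 : 1 <= q.
Proof. by rewrite lerDl mulr_ge0 ?(ltW dt0)// speed_lip_ge0. Qed.

Let Jle n : (n <= NT)%N -> forall b i j, jump N L (w n) b i j <= (K0 + L) * q ^+ n * dx.
Proof.
elim: n => [_ b i j|n IH nN].
  have [_ v0 _] := sol.
  have := datum_lip b (i%:~R * dx + dx, j%:~R * dx) (i%:~R * dx, j%:~R * dx).
  rewrite /= subrr normr0 addr0 addrAC subrr add0r (gtr0_norm dx0) ler_norml => /andP[_].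
  by rewrite /jump /w !v0 -/dx intrD [(_ + 1%:~R) * _]mulrDl mul1r expr0 mulr1; lra.
move=> b i j; rewrite exprSr mulrA.
have S0 : 0 <= (K0 + L) * q ^+ n.
  by rewrite mulr_ge0 ?addr_ge0 ?(ltW L0)// exprn_ge0// (le_trans ler01).
exact: (jump_growth M0 MN L0 dt0 (an_le nN) (per (ltnW nN)) (per nN) cfl1 cfl2 (step nN)
  (J0 (ltnW nN)) S0 (IH (ltnW nN))).
Qed.

(** The Gronwall bound for the x_1-slopes up to time [T]. *)
Definition slope_const : R := (K0 + L) * expR (speed_lip M L * T).
Let SS := slope_const.
Let SS0 : 0 <= SS.
Proof. by rewrite mulr_ge0 ?expR_ge0// addr_ge0// ltW. Qed.

Let JS n : (n <= NT)%N -> forall b i j, jump N L (w n) b i j <= SS * dx.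
Proof.
move=> nN b i j; apply: (le_trans (Jle nN b i j)).
rewrite ler_wpM2r ?(ltW dx0)// ler_wpM2l ?addr_ge0 ?(ltW L0)//.
apply: (@le_trans _ _ (expR (speed_lip M L * dt) ^+ n)).
  by rewrite lerXn2r ?nnegrE ?expR_ge0// ?expR_ge1Dx// (le_trans ler01).
rewrite -expRM_natl ler_expR mulrCA.
rewrite ler_wpM2l ?speed_lip_ge0//.
by have /andP[] := n_dt nN.
Qed.

Let cross n : (n <= NT)%N -> forall b i j,
  `|w n b i (j + 1) - w n b i j| <= (K0 + 2 * speed_lip M L * SS * (n%:R * dt)) * dx.
Proof.
elim: n => [_ b i j|n IH nN b i j].
  have [_ v0 _] := sol.
  have := datum_lip b (i%:~R * dx, j%:~R * dx + dx) (i%:~R * dx, j%:~R * dx).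
  rewrite /= subrr normr0 add0r addrAC subrr add0r (gtr0_norm dx0).
  by rewrite /w !v0 -/dx intrD [(_ + 1%:~R) * _]mulrDl mul1r mul0r mulr0 addr0.
have := cross_growth M0 MN L0 dt0 (an_le nN) (per (ltnW nN)) (per nN) cfl1 cfl2 (step nN)
  (J0 (ltnW nN)) SS0 (JS (ltnW nN)) (IH (ltnW nN)) b i j.
move=> /le_trans; apply; rewrite -/dx le_eqVlt; apply/orP; left; apply/eqP.
by rewrite -natr1; ring.
Qed.

Definition scheme_lip : R :=
  SS + (K0 + 2 * speed_lip M L * SS * T) + speed_max M L Na * SS.

Let speed_max0 : 0 <= speed_max M L Na.
Proof.
have Na0 : 0 <= Na by rewrite (le_trans _ (an_le (leq0n NT))).
by rewrite mulr_ge0// addr_ge0// mulr_ge0 ?(ltW L0)// mulr_ge0// sqr_ge0.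
Qed.

Let c0 : 0 <= K0 + 2 * speed_lip M L * SS * T.
Proof.
by rewrite addr_ge0// mulr_ge0 ?(ltW T0)// mulr_ge0// mulr_ge0// speed_lip_ge0.
Qed.

Let d0 : 0 <= speed_max M L Na * SS. Proof. exact: mulr_ge0. Qed.

Lemma scheme_lip1 n b i j : (n <= NT)%N -> `|v b n (i + 1) j - v b n i j| <= scheme_lip * dx.
Proof.
move=> nN; have := J0 nN b i j; have := JS nN b i j; rewrite /jump -/dx => h1 h2.
have LS : L <= SS.
  rewrite /SS /slope_const -[leLHS]mulr1 ler_pM ?(ltW L0)// ?lerDr//.
  by rewrite -expR0 ler_expR mulr_ge0 ?(ltW T0)// speed_lip_ge0.
apply: (@le_trans _ _ (SS * dx)); last by rewrite ler_wpM2r ?(ltW dx0)// /scheme_lip -addrA lerDl addr_ge0.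
have : L * dx <= SS * dx by rewrite ler_wpM2r ?(ltW dx0).
have : 0 <= L * dx by rewrite mulr_ge0 ?ltW.
by rewrite /w ler_norml in h1 h2 * => *; apply/andP; split; lra.
Qed.

Lemma scheme_lip2 n b i j : (n <= NT)%N -> `|v b n i (j + 1) - v b n i j| <= scheme_lip * dx.
Proof.
move=> nN; apply: (le_trans (cross nN b i j)).
rewrite ler_wpM2r ?(ltW dx0)// /scheme_lip addrAC -[leLHS]add0r lerD ?addr_ge0//.
rewrite lerD2l; have /andP[_ h] := n_dt nN.
by rewrite ler_wpM2l// mulr_ge0// mulr_ge0// speed_lip_ge0.
Qed.

Lemma scheme_lip_t n b i j : (n < NT)%N -> `|v b n.+1 i j - v b n i j| <= scheme_lip * dt.
Proof.
move=> nN.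
apply: (le_trans (time_growth M0 MN L0 dt0 (an_le nN) (per (ltnW nN)) (per nN) cfl2 (step nN)
  (J0 (ltnW nN)) SS0 (JS (ltnW nN)) b i j)).
by rewrite ler_wpM2r ?(ltW dt0)// /scheme_lip lerDr addr_ge0.
Qed.

Lemma scheme_speed_bound n b i j : (n < NT)%N ->
  `|speed M N b (a (n.+1%:R * dt)) (grid_diff (w n.+1)) i j| <= speed_max M L Na.
Proof.
move=> nN; exact: (speed_self_bound M0 MN L0 dt0 (an_le nN) (per (ltnW nN)) (per nN) cfl2 (step nN)
  (J0 (ltnW nN))).
Qed.

End uniform_lipschitz.

(** * The reconstruction *)

Section piecewise.
Context (R : realType).
Implicit Types (h x y K : R) (f : R -> R).

Lemma grid_cell h x : 0 < h -> exists i : int, i%:~R * h <= x <= (i + 1)%:~R * h.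
Proof.
move=> h0; exists (Num.floor (x / h)).
rewrite -ler_pdivlMr// floor_le_tmp/= -ler_pdivrMr//.
by rewrite ltW// floorD1_gt.
Qed.

(** A path from [x] to [y] is cut at the nodes, by induction on their number. *)
Lemma piecewise_lipschitz f h K : 0 < h ->
  (forall (i : int) x y, i%:~R * h <= x <= (i + 1)%:~R * h -> i%:~R * h <= y <= (i + 1)%:~R * h ->
     `|f x - f y| <= K * `|x - y|) ->
  forall x y, `|f x - f y| <= K * `|x - y|.
Proof.
move=> h0 fK.
have step (k : nat) : forall (i : int) x y, i%:~R * h <= x <= (i + 1)%:~R * h ->
    (i + k%:Z)%:~R * h <= y <= (i + k%:Z + 1)%:~R * h -> x <= y -> `|f x - f y| <= K * `|x - y|.
  elim: k => [|k IH] i x y xi; first by rewrite addr0 => yi _; exact: fK xi yi.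
  move=> yi xy; have /andP[ix xi1] := xi; have /andP[iy _] := yi.
  have ip : (i + 1)%:~R * h <= (i + 1 + 1)%:~R * h by rewrite ler_wpM2r ?(ltW h0)// ler_int lerDl.
  have py : (i + 1)%:~R * h <= y.
    by apply: le_trans iy; rewrite ler_wpM2r ?(ltW h0)// ler_int lerD2l.
  have E : i + k.+1%:Z = i + 1 + k%:Z by rewrite -addrA -PoszD add1n.
  have h1 := fK i x ((i + 1)%:~R * h) xi; rewrite lexx (le_trans ix xi1) in h1.
  have h2 := IH (i + 1) ((i + 1)%:~R * h) y; rewrite lexx ip -E yi py in h2.
  have := h1 isT; have := h2 isT isT isT.
  set p := _ * h in py xi1 *; rewrite (distrC x) (distrC p y) (distrC x y) (ger0_norm (_ : 0 <= p - x)) ?subr_ge0//.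
  rewrite (ger0_norm (_ : 0 <= y - p)) ?subr_ge0// (ger0_norm (_ : 0 <= y - x)) ?subr_ge0//.
  have := ler_normD (f x - f p) (f p - f y); rewrite addrA subrK => *.
  nra.
move=> x y; wlog xy : x y / x <= y.
  by move=> hw; case: (leP x y) => [|/ltW] /hw//; rewrite distrC (distrC y).
have [i xi] := grid_cell x h0.
have [j yj] := grid_cell y h0.
have [ij|ji] := leP i j.
  have E : j = i + `|j - i|%N%:Z by rewrite gez0_abs ?subr_ge0// [RHS]addrC subrK.
  by apply: (step `|j - i|%N i) => //; rewrite -E.
suff -> : x = y by rewrite !subrr normr0 mulr0.
apply/eqP; rewrite eq_le xy /=.
have /andP[ix _] := xi; have /andP[_ yj1] := yj.
apply: (le_trans yj1); apply: le_trans ix.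
by rewrite ler_wpM2r ?(ltW h0)// ler_int lezD1.
Qed.

End piecewise.

Section reconstruction.
Context (R : realType) (T K : R) (N NT : nat).
Variables (v : nat -> int -> int -> R) (u : R * (R * R) -> R).
Hypotheses (T0 : 0 < T) (N0 : (0 < N)%N) (NT0 : (0 < NT)%N) (rec : Q1_reconstruction T N NT v u).
Hypothesis per : forall n, (n <= NT)%N -> grid_periodic N (v n).
Let dx : R := space_step R N.
Let dt := time_step T NT.
Hypothesis lip1 : forall n i j, (n <= NT)%N -> `|v n (i + 1) j - v n i j| <= K * dx.
Hypothesis lip2 : forall n i j, (n <= NT)%N -> `|v n i (j + 1) - v n i j| <= K * dx.
Hypothesis lipt : forall n i j, (n < NT)%N -> `|v n.+1 i j - v n i j| <= K * dt.

Let dx0 : 0 < dx. Proof. by rewrite invr_gt0 ltr0n. Qed.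
Let dt0 : 0 < dt. Proof. by rewrite divr_gt0 ?ltr0n. Qed.
Let dtT : NT%:R * dt = T.
Proof. by rewrite /dt /time_step mulrC divfK// pnatr_eq0 -lt0n. Qed.

Lemma time_cell t : 0 <= t <= T -> exists2 n, (n < NT)%N & n%:R * dt <= t <= n.+1%:R * dt.
Proof.
move=> /andP[t0 tT].
have [tNT|tNT] := ltP t (NT.-1%:R * dt).
  have f0 : 0 <= Num.floor (t / dt) by rewrite floor_ge0 divr_ge0 ?(ltW dt0).
  have E : (`|Num.floor (t / dt)|%N%:R : R) = (Num.floor (t / dt))%:~R.
    by rewrite -[in RHS](gez0_abs f0).
  have le1 : `|Num.floor (t / dt)|%N%:R * dt <= t by rewrite E -ler_pdivlMr// floor_le_tmp.
  exists `|Num.floor (t / dt)|%N.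
    rewrite -(prednK NT0) ltnS ltnW// -(ltr_nat R) -(ltr_pM2r dt0).
    exact: le_lt_trans tNT.
  by rewrite le1 -natr1 E -ler_pdivrMr// ltW// (lt_le_trans (floorD1_gt _))// intrD.
by exists NT.-1; rewrite ?prednK// tNT dtT.
Qed.

Lemma node_value n i j : (n <= NT)%N -> u (n%:R * dt, (i%:~R * dx, j%:~R * dx)) = v n i j.
Proof.
have cell (k : int) : k%:~R * dx <= k%:~R * dx <= (k + 1)%:~R * dx.
  by rewrite lexx ler_wpM2r ?(ltW dx0)// ler_int lerDl.
rewrite leq_eqVlt => /orP[/eqP->|nN].
  have pN : (NT.-1 < NT)%N by rewrite prednK.
  have := @rec NT.-1 pN i j (NT%:R * dt) (i%:~R * dx) (j%:~R * dx).
  rewrite prednK// -/dx -/dt !cell lexx ler_wpM2r ?(ltW dt0) ?ler_nat ?leq_pred//.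
  move=> /(_ isT isT isT) ->.
  rewrite !subrr !mul0r -mulrBl -natrB ?leq_pred// (_ : (NT - NT.-1 = 1)%N); last first.
    by rewrite -subn1 subKn.
  by rewrite mul1r divff ?gt_eqF// /Q1_interpolation; ring.
have := @rec n nN i j (n%:R * dt) (i%:~R * dx) (j%:~R * dx).
rewrite -/dx -/dt !cell lexx ler_wpM2r ?(ltW dt0) ?ler_nat ?leqnSn//.
by move=> /(_ isT isT isT) ->; rewrite !subrr !mul0r /Q1_interpolation; ring.
Qed.

Let fracn n t : n%:R * dt <= t <= n.+1%:R * dt -> 0 <= (t - n%:R * dt) / dt <= 1.
Proof.
move=> /andP[ix]; rewrite -natr1 => xi; rewrite divr_ge0 ?subr_ge0 ?(ltW dt0)//=.
by rewrite ler_pdivrMr// mul1r; lra.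
Qed.

Let fraci (i : int) x : i%:~R * dx <= x <= (i + 1)%:~R * dx -> 0 <= (x - i%:~R * dx) / dx <= 1.
Proof.
move=> /andP[ix]; rewrite intrD => xi; rewrite divr_ge0 ?subr_ge0 ?(ltW dx0)//=.
by rewrite ler_pdivrMr// mul1r; lra.
Qed.

Let conv2 (s x y B : R) : 0 <= s <= 1 -> `|x| <= B -> `|y| <= B -> `|s * x + (1 - s) * y| <= B.
Proof.
move=> /andP[s0 s1]; rewrite !ler_norml => /andP[? ?] /andP[? ?]; apply/andP; split; nra.
Qed.

Lemma reconstruction_lip1 t x y x2 : 0 <= t <= T ->
  `|u (t, (x, x2)) - u (t, (y, x2))| <= K * `|x - y|.
Proof.
move=> tT; apply: (piecewise_lipschitz (f := fun x => u (t, (x, x2))) dx0) => {x y} i x y xi yi.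
have [n nN tn] := time_cell tT; have [j x2j] := grid_cell x2 dx0.
rewrite (rec nN tn xi x2j) (rec nN tn yi x2j) -/dx -/dt.
have tau01 := fracn tn.
have beta01 := fraci x2j.
set tau := _ / dt in tau01 *; set beta := (x2 - _) / dx in beta01 *.
set A := (x - _) / dx; set B := (y - _) / dx.
pose D k := beta * (v k (i + 1) (j + 1) - v k i (j + 1)) + (1 - beta) * (v k (i + 1) j - v k i j).
have DK k : (k <= NT)%N -> `|D k| <= K * dx by move=> kN; rewrite conv2// lip1.
have -> : K * `|x - y| = `|A - B| * (K * dx).
  rewrite /A /B -mulrBl opprB addrA subrK normrM [`|dx^-1|]gtr0_norm ?invr_gt0 ?ltr0n//.
  by field; rewrite gt_eqF.
rewrite [X in `|X|](_ : _ = (A - B) * (tau * D n.+1 + (1 - tau) * D n)); last first.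
  by rewrite /Q1_interpolation /D; ring.
by rewrite normrM ler_wpM2l// conv2// DK// ltnW.
Qed.

Lemma reconstruction_lip2 t x y x1 : 0 <= t <= T ->
  `|u (t, (x1, x)) - u (t, (x1, y))| <= K * `|x - y|.
Proof.
move=> tT; apply: (piecewise_lipschitz (f := fun x => u (t, (x1, x))) dx0) => {x y} j x y xj yj.
have [n nN tn] := time_cell tT; have [i x1i] := grid_cell x1 dx0.
rewrite (rec nN tn x1i xj) (rec nN tn x1i yj) -/dx -/dt.
have tau01 := fracn tn.
have alpha01 := fraci x1i.
set tau := _ / dt in tau01 *; set alpha := (x1 - _) / dx in alpha01 *.
set A := (x - _) / dx; set B := (y - _) / dx.
pose D k := alpha * (v k (i + 1) (j + 1) - v k (i + 1) j) + (1 - alpha) * (v k i (j + 1) - v k i j).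
have DK k : (k <= NT)%N -> `|D k| <= K * dx by move=> kN; rewrite conv2// lip2.
have -> : K * `|x - y| = `|A - B| * (K * dx).
  rewrite /A /B -mulrBl opprB addrA subrK normrM [`|dx^-1|]gtr0_norm ?invr_gt0 ?ltr0n//.
  by field; rewrite gt_eqF.
rewrite [X in `|X|](_ : _ = (A - B) * (tau * D n.+1 + (1 - tau) * D n)); last first.
  by rewrite /Q1_interpolation /D; ring.
by rewrite normrM ler_wpM2l// conv2// DK// ltnW.
Qed.

Lemma reconstruction_lip_t s t x1 x2 :
  `|u (clamp T s, (x1, x2)) - u (clamp T t, (x1, x2))| <= K * `|s - t|.
Proof.
have K0 : 0 <= K.
  by have := lipt 0 0 NT0; rewrite -ler_pdivrMr//; apply: le_trans; rewrite divr_ge0 ?(ltW dt0).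
have T0' := ltW T0.
apply: (piecewise_lipschitz (f := fun s => u (clamp T s, (x1, x2))) dt0) => {}i {}s {}t si ti.
suff cell_lip n : (n < NT)%N -> forall s t, n%:R * dt <= s <= n.+1%:R * dt -> n%:R * dt <= t <= n.+1%:R * dt ->
    `|u (s, (x1, x2)) - u (t, (x1, x2))| <= K * `|s - t|.
  have E k : (k%:Z + 1)%:~R = k.+1%:R :> R by rewrite intrD -natr1.
  case: i si ti => k si ti.
    have [kN|Nk] := ltnP k NT.
      have kT r : k%:R * dt <= r <= (k%:Z + 1)%:~R * dt -> 0 <= r <= T.
        move=> /andP[kr rk]; rewrite (le_trans _ kr) ?mulr_ge0 ?(ltW dt0)//=.
        apply: (le_trans rk); rewrite -dtT ler_wpM2r ?(ltW dt0)//.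
        by rewrite E ler_nat.
      rewrite !clamp_id ?(kT _ si) ?(kT _ ti)//.
      by apply: (cell_lip k) => //; move: si ti; rewrite E.
    have kT r : k%:R * dt <= r <= (k%:Z + 1)%:~R * dt -> clamp T r = T.
      move=> /andP[kr _]; have Tr : T <= r by rewrite -dtT (le_trans _ kr)// ler_wpM2r ?(ltW dt0)// ler_nat.
      by rewrite /clamp ltNge (le_trans T0' Tr)/=; case: ltP => // rT; apply/eqP; rewrite eq_le rT Tr.
    by rewrite !kT// subrr normr0 mulr_ge0.
  have k0 r : (Negz k)%:~R * dt <= r <= (Negz k + 1)%:~R * dt -> clamp T r = 0.
    move=> /andP[_ rk]; have r0 : r <= 0.
      apply: (le_trans rk); rewrite pmulr_lle0// -[0]/(0%:~R) ler_int; lia.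
    by rewrite /clamp; case: ltP => // r0'; rewrite ltNge (le_trans r0)//=; apply/eqP; rewrite eq_le r0 r0'.
  by rewrite !k0// subrr normr0 mulr_ge0.
move=> nN {i si ti}{}s {}t sn tn.
have [i x1i] := grid_cell x1 dx0; have [j x2j] := grid_cell x2 dx0.
rewrite (rec nN sn x1i x2j) (rec nN tn x1i x2j) -/dx -/dt.
have alpha01 := fraci x1i.
have beta01 := fraci x2j.
set alpha := (x1 - _) / dx in alpha01 *; set beta := (x2 - _) / dx in beta01 *.
set A := _ / dt; set B := (t - _) / dt.
have -> : K * `|s - t| = `|A - B| * (K * dt).
  rewrite /A /B -mulrBl opprB addrA subrK normrM [`|dt^-1|]gtr0_norm ?invr_gt0//.
  by field; rewrite gt_eqF.
pose D i j := v n.+1 i j - v n i j.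
rewrite [X in `|X|](_ : _ = (A - B) * (beta * (alpha * D (i + 1) (j + 1) + (1 - alpha) * D i (j + 1))
   + (1 - beta) * (alpha * D (i + 1) j + (1 - alpha) * D i j))); last first.
  by rewrite /Q1_interpolation /D; ring.
by rewrite normrM ler_wpM2l// conv2// conv2// lipt.
Qed.

(** The reconstruction is prescribed on [0, T] only; its constant extension in
    time is Lipschitz on the whole space. *)
Definition time_clamped (z : R * (R * R)) := u (clamp T z.1, z.2).

Lemma reconstruction_lip3 : lip3 K time_clamped.
Proof.
move=> [t [x1 x2]] [s [y1 y2]]; rewrite /time_clamped /=.
have cs := clamp_itv (ltW T0) s.
have h1 := reconstruction_lip_t t s x1 x2.
have h2 := reconstruction_lip1 x1 y1 x2 cs.
have h3 := reconstruction_lip2 x2 y2 y1 cs.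
rewrite !mulrDr; move: h1 h2 h3; move: (u _) (u _) (u _) (u _) => d c b a h1 h2 h3.
rewrite (_ : a - d = (a - b) + (b - c) + (c - d)); last by ring.
apply: (le_trans (ler_normD _ _)); apply: lerD => //.
by apply: (le_trans (ler_normD _ _)); rewrite lerD.
Qed.

Let dxN : N%:R * dx = 1. Proof. by rewrite mulfV// pnatr_eq0 -lt0n. Qed.

Lemma reconstruction_periodic t : 0 <= t <= T -> torus_periodic (fun x => u (t, x)).
Proof.
move=> tT [x1 x2] /=.
have [n nN tn] := time_cell tT.
have [i x1i] := grid_cell x1 dx0; have [j x2j] := grid_cell x2 dx0.
have shift (k : int) : (k + N%:Z)%:~R * dx = k%:~R * dx + 1 by rewrite intrD mulrDl dxN.
have shiftc (k : int) x : k%:~R * dx <= x <= (k + 1)%:~R * dx ->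
    (k + N%:Z)%:~R * dx <= x + 1 <= (k + N%:Z + 1)%:~R * dx.
  by move=> /andP[? ?]; rewrite addrAC !shift !lerD2r; apply/andP.
have sub1 (x y : R) : x + 1 - (y + 1) = x - y by ring.
rewrite (rec nN tn x1i x2j); split.
  rewrite (rec nN tn (shiftc _ _ x1i) x2j) -/dx -/dt !shift !sub1.
  by rewrite /Q1_interpolation [i + N%:Z + 1]addrAC !(per nN _ _).1 !(per (ltnW nN) _ _).1.
rewrite (rec nN tn x1i (shiftc _ _ x2j)) -/dx -/dt !shift !sub1.
by rewrite /Q1_interpolation [j + N%:Z + 1]addrAC !(per nN _ _).2 !(per (ltnW nN) _ _).2.
Qed.

Lemma reconstruction_x_periodic t : torus_periodic (fun x => time_clamped (t, x)).
Proof. by move=> x; rewrite /time_clamped/=; exact: reconstruction_periodic (clamp_itv (ltW T0) t) x. Qed.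

End reconstruction.

Lemma lip3_in_C (R : realType) (T K : R) (u : R * (R * R) -> R) : 0 <= T ->
  lip3 K (time_clamped T u) -> (forall t, torus_periodic (fun x => time_clamped T u (t, x))) ->
  in_C T u.
Proof.
move=> T0 lip per.
have E t x : 0 <= t <= T -> time_clamped T u (t, x) = u (t, x).
  by move=> tT; rewrite /time_clamped /= clamp_id.
split; last by move=> t tT x; have := per t x; rewrite !E.
apply: (@subspace_eq_continuous _ _ _ (time_clamped T u)); last first.
  by apply: continuous_subspaceT; exact: lip3_continuous lip.
by move=> [t x]; rewrite inE => -[/= tT _]; rewrite E//; move: tT; rewrite in_itv.
Qed.

(** * Compactness *)

Section cluster_points.
Import ArrowAsProduct.

(** The sequence lives in a product of segments, which is compact by Tychonoff's
    theorem.  Neighbourhoods in the product topology control finitely many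
    points at a time. *)
Lemma cluster_sequence (R : realType) (I : eqType) (f : nat -> I -> R) (C : I -> R) :
  (forall n i, `|f n i| <= C i) ->
  exists p : I -> R, forall (J : finType) (F : J -> I) (e : R) n0, 0 < e ->
    exists2 m, (n0 <= m)%N & forall j, `|f m (F j) - p (F j)| < e.
Proof.
move=> fC.
have cA := @tychonoff I (fun _ => R : topologicalType) (fun i => `[- C i, C i]%classic)
  (fun i => @segment_compact R (- C i) (C i)).
have [|p [_ pcl]] := cA (f n @[n --> \oo]) _.
  by exists 0%N => // n _ i /=; rewrite in_itv/= -ler_norml; exact: fC.
exists p => J F e n0 e0.
have nb : nbhs p [set g : I -> R | forall j, `|g (F j) - p (F j)| < e].
  apply: (@filter_forall _ _ (fun j (g : I -> R) => `|g (F j) - p (F j)| < e) (nbhs p)) => j.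
  have /cvgrPdist_lt/(_ _ e0) := @proj_continuous I (fun _ => R) (F j) p.
  by apply: filterS => g; rewrite distrC.
have tail : (f n @[n --> \oo]) [set f n | n in [set n | (n0 <= n)%N]].
  by exists n0 => // n /= n0n; exists n.
by have [_ [[m /= n0m <-] mj]] := pcl _ _ tail nb; exists m.
Qed.

End cluster_points.

Section reduction.
Context (R : realType) (T K : R).
Hypothesis T0 : 0 < T.
Implicit Type u : R * (R * R) -> R.

Definition time_constant u := forall t x, u (t, x) = u (clamp T t, x).

Let fr (x : R) := x - (Num.floor x)%:~R.

Let fr_itv x : 0 <= fr x <= 1.
Proof.
have := floor_le_tmp x; have := floorD1_gt x; rewrite intrD /fr.
by move=> *; apply/andP; split; lra.
Qed.

(** The representative of [z] in the fundamental domain [0, T] * [0, 1]^2. *)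
Definition reduce (z : R * (R * R)) := (clamp T z.1, (fr z.2.1, fr z.2.2)).

Lemma reduce_itv z : [/\ 0 <= (reduce z).1 <= T, 0 <= (reduce z).2.1 <= 1 &
  0 <= (reduce z).2.2 <= 1].
Proof. by split; [exact: clamp_itv (ltW T0) z.1|exact: fr_itv|exact: fr_itv]. Qed.

Lemma reduceE u z : x_periodic u -> time_constant u -> u (reduce z) = u z.
Proof.
move=> up uc; case: z => t [x1 x2]; rewrite [RHS]uc /reduce /=.
have := @torus_periodic_int R (fun x => u (clamp T t, x)) (- Num.floor x1) (- Num.floor x2) (x1, x2) (up _).
by rewrite /= !mulrNz.
Qed.

Lemma lip3_periodic_bound u : lip3 K u -> x_periodic u -> time_constant u ->
  forall z, `|u z| <= `|u (0, (0, 0))| + K * (T + 2).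
Proof.
move=> ul up uc z; rewrite -(reduceE z up uc).
have [] := reduce_itv z; move: (reduce z) => {}z /andP[t0 tT] /andP[x0 x1] /andP[y0 y1].
have K0 : 0 <= K.
  exact: lip3_ge0 ul.
have := ul z (0, (0, 0)); rewrite /= !subr0 (ger0_norm t0) (ger0_norm x0) (ger0_norm y0) => h.
have : K * (z.1 + z.2.1 + z.2.2) <= K * (T + 2) by rewrite ler_wpM2l//; lra.
have := ler_normD (u z - u (0, (0, 0))) (u (0, (0, 0))); rewrite subrK; lra.
Qed.

Lemma nearest_fraction (n : nat) (x l : R) : (0 < n)%N -> 0 < l -> 0 <= x <= l ->
  exists j : 'I_n.+1, `|x - (j : nat)%:R / n%:R * l| <= l / n%:R.
Proof.
move=> n0 lp /andP[x0 xl].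
have np : 0 < n%:R :> R by rewrite ltr0n.
have f0 : 0 <= Num.floor (x / l * n%:R) by rewrite floor_ge0 mulr_ge0 ?divr_ge0 ?(ltW lp) ?(ltW np).
have E : (`|Num.floor (x / l * n%:R)|%N%:R : R) = (Num.floor (x / l * n%:R))%:~R.
  by rewrite -[in RHS](gez0_abs f0).
have le1 : `|Num.floor (x / l * n%:R)|%N%:R <= x / l * n%:R by rewrite E floor_le_tmp.
have ge1 : x / l * n%:R < `|Num.floor (x / l * n%:R)|%N%:R + 1.
  by rewrite E -[1]/(1%:~R) -intrD floorD1_gt.
have jn : (`|Num.floor (x / l * n%:R)|%N < n.+1)%N.
  rewrite ltnS -(ler_nat R); apply: (le_trans le1).
  by rewrite ler_piMl ?(ltW np)// ler_pdivrMr// mul1r.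
exists (Ordinal jn) => /=; set j := (_%:R) in le1 ge1 *.
rewrite (_ : x - _ = (x / l * n%:R - j) * (l / n%:R)); last by field; rewrite !gt_eqF.
rewrite ger0_norm ?mulr_ge0 ?subr_ge0 ?divr_ge0 ?(ltW np) ?(ltW lp)//.
by rewrite ler_piMl ?divr_ge0 ?(ltW np) ?(ltW lp)//; lra.
Qed.

End reduction.

Section compactness.
Context (R : realType) (T K B : R) (U : nat -> bool -> R * (R * R) -> R).
Hypotheses (T0 : 0 < T) (lip : forall m b, lip3 K (U m b)).
Hypotheses (per : forall m b, x_periodic (U m b)) (tc : forall m b, time_constant T (U m b)).
Hypothesis bounded0 : forall m b, `|U m b (0, (0, 0))| <= B.

Let K0 : 0 <= K.
Proof.
exact: lip3_ge0 (lip 0 true).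
Qed.

(** Any identity or inequality between finitely many values passes to a cluster
    point: it is periodic and Lipschitz with the same constant.  Choosing terms of
    the sequence that are close to it at the nodes of a mesh [1 / (k + 1)], the
    Lipschitz constants give uniform closeness. *)
Lemma uniform_subsequence : exists (s : nat -> nat) (rho : bool -> R * (R * R) -> R),
  [/\ {homo s : k l / (k < l)%N}, forall b, lip3 K (rho b), forall b, x_periodic (rho b),
    forall b, time_constant T (rho b) &
    forall e, 0 < e -> \forall k \near \oo, forall b z, `|U (s k) b z - rho b z| <= e].
Proof.
have [p pP] := @cluster_sequence R (bool * (R * (R * R)))%type (fun m i => U m i.1 i.2)
  (fun _ => B + K * (T + 2)) (fun m i =>
    le_trans (lip3_periodic_bound T0 (lip m i.1) (per m i.1) (tc m i.1) i.2) (lerD (bounded0 m i.1) (lexx _))).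
pose rho b z := p (b, z).
have approx b z w e : 0 < e -> exists m, `|U m b z - rho b z| < e /\ `|U m b w - rho b w| < e.
  move=> e0; have [m _ mP] := pP bool (fun c => (b, if c then z else w)) e 0%N e0.
  by exists m; split; [exact: mP true|exact: mP false].
have eqp b z w : (forall m, U m b z = U m b w) -> rho b z = rho b w.
  move=> zw; apply/eqP; rewrite -subr_eq0 -normr_le0; apply/ler_addgt0Pl => e e0.
  have [m []] := approx b z w (e / 2) (divr_gt0 e0 (ltr0Sn R 1)).
  rewrite zw (distrC (U m b w)) addr0 => h1 h2.
  have := ler_normD (rho b z - U m b w) (U m b w - rho b w).
  by rewrite addrA subrK; lra.
have rl b : lip3 K (rho b).
  move=> z w; apply/ler_addgt0Pl => e e0.
  have [m [h1 h2]] := approx b z w (e / 2) (divr_gt0 e0 (ltr0Sn R 1)).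
  apply: (le_trans _ (lerD (lexx e) (lip m b z w))).
  have -> : rho b z - rho b w = (rho b z - U m b z) + (U m b z - U m b w) + (U m b w - rho b w) by ring.
  apply: (le_trans (ler_normD _ _)).
  have := ler_normD (rho b z - U m b z) (U m b z - U m b w); rewrite (distrC (rho b z)); lra.
have rp b : x_periodic (rho b).
  by move=> t x; split; apply: eqp => m; have [] := per m b t x.
have rc b : time_constant T (rho b) by move=> t x; apply: eqp => m; exact: tc.
(* the nodes of the mesh [1 / (n + 1)] in the fundamental domain, for both signs *)
pose node n (i : bool * 'I_n.+2 * ('I_n.+2 * 'I_n.+2)) : bool * (R * (R * R)) :=
  (i.1.1, ((i.1.2 : nat)%:R / n.+1%:R * T, ((i.2.1 : nat)%:R / n.+1%:R * 1, (i.2.2 : nat)%:R / n.+1%:R * 1))).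
have next : forall q : nat * nat, exists m, (q.2 < m)%N /\
    forall i, `|U m (node q.1 i).1 (node q.1 i).2 - p (node q.1 i)| < q.1.+1%:R^-1.
  move=> [n n0] /=; have n1 : 0 < n.+1%:R^-1 :> R by rewrite invr_gt0.
  by have [m] := pP _ (@node n) _ n0.+1 n1; exists m.
have [g gP] := choice next.
pose s := fix s k := if k is k'.+1 then g (k, s k') else g (0%N, 0%N).
have sP k : exists n0, s k = g (k, n0) by case: k => [|k]; [exists 0%N|exists (s k)].
exists s, rho; split => //.
  by apply: homo_ltn => [|k]; [exact: ltn_trans|have [] := gP (k.+1, s k)].
have close k b z : `|U (s k) b z - rho b z| <= (2 * K * (T + 2) + 1) / k.+1%:R.
  rewrite -(reduceE z (per (s k) b) (tc (s k) b)) -(reduceE z (rp b) (rc b)).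
  have [] := reduce_itv T0 z; move: (reduce T z) => {}z tT x1 x2.
  have [i iP] := nearest_fraction (ltn0Sn k) T0 tT.
  have [j jP] := nearest_fraction (ltn0Sn k) ltr01 x1.
  have [l lP] := nearest_fraction (ltn0Sn k) ltr01 x2.
  pose w := (node k (b, i, (j, l))).2.
  have h1 : `|U (s k) b w - rho b w| < k.+1%:R^-1.
    by have [n0 ->] := sP k; have [_ /(_ (b, i, (j, l)))] := gP (k, n0).
  have dist u : lip3 K u -> `|u z - u w| <= K * (T + 2) / k.+1%:R.
    move=> ul; apply: (le_trans (ul z w)); rewrite -mulrA ler_wpM2l//.
    apply: (le_trans (lerD (lerD iP jP) lP)); rewrite le_eqVlt; apply/orP; left; apply/eqP; ring.
  have h2 := dist _ (lip (s k) b); have h3 := dist _ (rl b).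
  have -> : U (s k) b z - rho b z = (U (s k) b z - U (s k) b w) + (U (s k) b w - rho b w) + (rho b w - rho b z) by ring.
  apply: (le_trans (ler_normD _ _)).
  have -> : (2 * K * (T + 2) + 1) / k.+1%:R =
      K * (T + 2) / k.+1%:R + k.+1%:R^-1 + K * (T + 2) / k.+1%:R by ring.
  rewrite (distrC (rho b w)); apply: lerD => //.
  by apply: (le_trans (ler_normD _ _)); apply: lerD => //; exact: ltW.
move=> e e0.
have C0 : 0 < 2 * K * (T + 2) + 1 by rewrite ltr_wpDl// mulr_ge0// ?mulr_ge0// addr_ge0// ltW.
near=> k => b z; apply: (le_trans (close k b z)).
rewrite ler_pdivrMr// [leRHS]mulrC -ler_pdivrMr// -[k.+1%:R]natr1.
apply: (@le_trans _ _ k%:R); last by rewrite lerDl.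
by near: k; exact: nbhs_infty_ger.
Unshelve. all: by end_near. Qed.

End compactness.

(** * Limits of upwind identities *)

Section parts_cvg.
Context (R : realType).

Lemma cvg_pos_part (u : nat -> R) l : u @ \oo --> l -> pos_part (u m) @[m --> \oo] --> pos_part l.
Proof. by move=> ul; apply: cvgM; [apply: cvgD => //; exact: cvg_norm|exact: cvg_cst]. Qed.

Lemma cvg_neg_part (u : nat -> R) l : u @ \oo --> l -> neg_part (u m) @[m --> \oo] --> neg_part l.
Proof. by move=> ul; apply: cvgM; [apply: cvgB => //; exact: cvg_norm|exact: cvg_cst]. Qed.

Lemma pos_part_bound (x B : R) : `|x| <= B -> `|pos_part x| <= B.
Proof.
move=> xB; rewrite ger0_norm ?pos_part_ge0// (le_trans _ xB)// -pos_partD lerDl.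
exact: neg_part_ge0.
Qed.

Lemma neg_part_bound (x B : R) : `|x| <= B -> `|neg_part x| <= B.
Proof.
move=> xB; rewrite ger0_norm ?neg_part_ge0// (le_trans _ xB)// -pos_partD lerDr.
exact: pos_part_ge0.
Qed.

End parts_cvg.

(** [V m] and [Lam m] are the density and the velocity of step [m]; [upwind] is
    the scheme at the points of the slab.  The velocities converge pointwise,
    also after a shift by one cell; about the slopes only a bound is assumed. *)
Section limit_passage.
Context (R : realType) (T L K Kl B Bl : R).
Local Notation mR := (measurableTypeR R).
Local Notation R3 := (mR * (mR * mR))%type.
Local Notation I f := (\int[leb3 R]_(z in slab T) f z).
Variables (rho lam : R * (R * R) -> R) (V Lam : nat -> R * (R * R) -> R) (h k : nat -> R).
Local Notation e1 := (dir_1 R).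
Local Notation et := (dir_t R).
Hypotheses (rl : lip3 K rho) (rB : forall z, `|rho z| <= B) (rp : x_periodic rho).
Hypotheses (mlam : measurable_fun setT (lam : R3 -> R)) (lB : forall z, `|lam z| <= Bl).
Hypotheses (lp : x_periodic lam) (ll : forall z s, `|lam (z + s *: e1) - lam z| <= Kl * `|s|).
Hypotheses (h01 : forall m, 0 < h m <= 1) (hc : h @ \oo --> 0).
Hypotheses (k0 : forall m, 0 < k m) (kc : k @ \oo --> 0).
Hypotheses (mV : forall m, measurable_fun setT (V m : R3 -> R)) (VB : forall m z, `|V m z| <= B).
Hypotheses (Vp : forall m, x_periodic (V m)).
Hypothesis VK : forall m z, `|V m (z + h m *: e1) - V m z| <= K * h m.
Hypotheses (mLam : forall m, measurable_fun setT (Lam m : R3 -> R)) (LB : forall m z, `|Lam m z| <= Bl).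
Hypotheses (Lp : forall m, x_periodic (Lam m)).
Hypothesis Vc : forall z, slab T z -> V m z @[m --> \oo] --> rho z.
Hypothesis Lc : forall z, slab T z -> Lam m z @[m --> \oo] --> lam z.
Hypothesis Lc1 : forall z, slab T z -> Lam m (z + h m *: e1) @[m --> \oo] --> lam z.

Let G m z := quotient (V m) e1 (h m) z + L.

Hypothesis upwind : forall m z, slab T z -> quotient (V m) et (k m) z =
  pos_part (Lam m z) * G m z - neg_part (Lam m z) * G m (z + (- h m) *: e1).

Let normrM_le (x y X Y : R) : `|x| <= X -> `|y| <= Y -> `|x * y| <= X * Y.
Proof. by move=> xX yY; rewrite normrM ler_pM. Qed.

Let K0 : 0 <= K.
Proof.
exact: lip3_ge0 rl.
Qed.

Let e1dir : e1 \in [:: dir_1 R; dir_2 R]. Proof. by rewrite !inE eqxx. Qed.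

Let B0 : 0 <= B. Proof. exact: le_trans (rB 0). Qed.
Let h0 m : h m != 0. Proof. by have /andP[/gt_eqF->] := h01 m. Qed.

Let mrho : measurable_fun setT (rho : R3 -> R).
Proof. exact: continuous_measurable3 (lip3_continuous rl). Qed.

Let mG m : measurable_fun setT (G m : R3 -> R).
Proof. by apply: measurable_funD => //; exact: measurable_quotient. Qed.

Let GB m z : `|G m z| <= K + `|L|.
Proof.
apply: (le_trans (ler_normD _ _)); rewrite lerD2r /quotient normrM normfV mulrC.
by rewrite ler_pdivrMr ?normr_gt0// (gtr0_norm (_ : 0 < h m)) ?VK//; have /andP[] := h01 m.
Qed.

Let Gp m : x_periodic (G m).
Proof.
move=> t x; rewrite /G /quotient.
by rewrite !(@x_periodic_translate R _ (h m *: e1) (Vp m) t x).1 !(@x_periodic_translate R _ (h m *: e1) (Vp m) t x).2 !(Vp m t x).1 !(Vp m t x).2.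
Qed.

Let cvg_sub0 (f g : nat -> R) (l : R) : f m - g m @[m --> \oo] --> 0 -> g @ \oo --> l -> f @ \oo --> l.
Proof.
move=> c1 c2; rewrite (_ : f = (fun m => (f m - g m) + g m)); last by apply/funext => m; rewrite subrK.
by rewrite -[l]add0r; exact: cvgD.
Qed.

Let int0 : I (fun=> 0) = 0.
Proof. by rewrite /Rintegral integral0. Qed.

Let cvg0_bounded (f g : nat -> R) C : (forall m, `|g m| <= C) -> f @ \oo --> 0 -> f m * g m @[m --> \oo] --> 0.
Proof.
move=> gC f0; have C0 : 0 <= C by apply: le_trans (gC 0%N).
apply/norm_cvg0P.
apply: (@squeeze_cvgr _ _ _ _ (fun=> 0) (fun m => `|f m| * C)).
- by apply: nearW => m; rewrite normr_ge0 normrM ler_wpM2l.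
- exact: cvg_cst.
- by rewrite -(mul0r C); apply: cvgM; [apply/norm_cvg0P|exact: cvg_cst].
Qed.

Section test.
Variables (phi : R * (R * R) -> R) (t0 t1 C D D1 : R).
Hypotheses (sphi : smooth phi) (phip : x_periodic phi) (t00 : 0 < t0) (t1T : t1 < T).
Hypotheses (supp : forall t x, phi (t, x) != 0 -> t0 <= t <= t1).
Hypotheses (pC : forall z, `|phi z| <= C) (pD : forall z, `|'D_et phi z| <= D).
Hypothesis (pD1 : forall z, `|'D_e1 phi z| <= D1).

Let C0 : 0 <= C. Proof. exact: le_trans (pC 0). Qed.
Let mphi : measurable_fun setT (phi : R3 -> R).
Proof. exact: continuous_measurable3 (smooth_continuous sphi). Qed.
Let mdphi : measurable_fun setT ('D_et phi : R3 -> R).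
Proof. exact: continuous_measurable3 (smooth_continuous (smooth_derive et sphi)). Qed.

(** For small steps the support of the test function does not leave the slab. *)
Lemma time_by_parts : \forall m \near \oo, I (fun z => phi z * quotient (V m) et (k m) z) =
  - I (fun z => V m z * quotient phi et (- k m) z).
Proof.
have d0 : 0 < Num.min t0 (T - t1) by rewrite lt_min t00 subr_gt0.
near=> m.
have : k m < Num.min t0 (T - t1).
  near: m; have /cvgrPdist_lt/(_ _ d0) := kc; apply: filterS => m.
  by rewrite sub0r normrN gtr0_norm.
rewrite lt_min => /andP[kt0 kt1].
have kn0 : k m != 0 by rewrite gt_eqF.
have bnd (w w' : R * (R * R)) z : `|V m (z + w) * phi (z + w')| <= B * C by rewrite normrM ler_pM.
have mvp (w w' : R * (R * R)) : measurable_fun setT ((fun z => V m (z + w) * phi (z + w')) : R3 -> R).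
  by apply: measurable_funM; exact: measurable_comp_translate.
have int (w w' : R * (R * R)) : (leb3 R).-integrable (slab T) (EFin \o (fun z => V m (z + w) * phi (z + w'))).
  exact: integrable_slab (bnd w w').
have ms := measurable_slab T.
have E1 : I (fun z => phi z * quotient (V m) et (k m) z) =
    (k m)^-1 * (I (fun z => V m (z + k m *: et) * phi (z + 0)) - I (fun z => V m (z + 0) * phi (z + 0))).
  rewrite -RintegralB// -RintegralZl//; last exact: (integrableB _ (int _ _) (int _ _)).
  by apply: eq_Rintegral => z _; rewrite /quotient !addr0; ring.
have E2 : I (fun z => V m z * quotient phi et (- k m) z) =
    - (k m)^-1 * (I (fun z => V m (z + 0) * phi (z + (- k m) *: et)) - I (fun z => V m (z + 0) * phi (z + 0))).
  rewrite -RintegralB// -RintegralZl//; last exact: (integrableB _ (int _ _) (int _ _)).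
  by apply: eq_Rintegral => z _; rewrite /quotient !addr0 invrN; ring.
rewrite E1 E2 mulNr opprK; congr (_ * (_ - _)).
rewrite -(@slab_shift_t R T (fun z => V m (z + 0) * phi (z + (- k m) *: et)) (B * C) (t0 + k m) (t1 + k m) (k m))//.
- by apply: eq_Rintegral => z _; rewrite !addr0 -addrA scaleNr subrr addr0.
- exact: ltW.
- by rewrite ltrDr.
- by lra.
- move=> [t [x y]]; rewrite /= mulf_eq0 negb_or => /andP[_].
  rewrite scale_dir_t addr3E => /supp; rewrite /= => /andP[? ?]; apply/andP; split; lra.
Unshelve. all: by end_near. Qed.

Lemma time_limit : I (fun z => phi z * quotient (V m) et (k m) z) @[m --> \oo] -->
  - I (fun z => rho z * 'D_et phi z).
Proof.
apply: (cvg_trans (near_eq_cvg _)); first by have := time_by_parts; apply: filterS => m ->.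
apply: cvgN; apply: (@slab_bounded_cvg _ _ _ _ (B * D)).
- by move=> m; apply: measurable_funM => //; exact: measurable_quotient.
- exact: measurable_funM.
- move=> m z; rewrite normrM ler_pM// /quotient normrM normfV normrN mulrC.
  rewrite ler_pdivrMr ?normr_gt0 ?gt_eqF//.
  by have := smooth_line_lipschitz sphi pD z (- k m); rewrite normrN.
- apply: aeW => z sz; apply: cvgM; first exact: Vc.
  apply: smooth_quotient_cvg => //; first by move=> m; rewrite oppr_eq0 gt_eqF.
  by rewrite -oppr0; apply: cvgN.
Qed.

(** The coefficient of the slope after the shift of the negative part by one cell. *)
Let bracket m z := phi z * pos_part (Lam m z) - phi (z + h m *: e1) * neg_part (Lam m (z + h m *: e1)).

Let mpos m : measurable_fun setT ((fun z => pos_part (Lam m z)) : R3 -> R).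
Proof. by apply: measurable_funM => //; apply: measurable_funD => //; exact: measurableT_comp. Qed.

Let mneg m : measurable_fun setT ((fun z => neg_part (Lam m z)) : R3 -> R).
Proof. by apply: measurable_funM => //; apply: measurable_funB => //; exact: measurableT_comp. Qed.

Lemma space_summation m : I (fun z => phi z * quotient (V m) et (k m) z) = I (fun z => bracket m z * G m z).
Proof.
pose P z := phi z * pos_part (Lam m z) * G m z.
pose Q z := phi z * neg_part (Lam m z) * G m (z + (- h m) *: e1).
have ms := measurable_slab T.
have mP : measurable_fun setT (P : R3 -> R) by apply: measurable_funM => //; exact: measurable_funM.
have mQ : measurable_fun setT (Q : R3 -> R).
  by apply: measurable_funM; [exact: measurable_funM|exact: measurable_comp_translate].
have PB z : `|P z| <= C * Bl * (K + `|L|).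
  by apply: normrM_le => //; apply: normrM_le => //; exact: pos_part_bound.
have QB z : `|Q z| <= C * Bl * (K + `|L|).
  by apply: normrM_le => //; apply: normrM_le => //; exact: neg_part_bound.
have Qp : x_periodic Q.
  apply: x_periodicM; last exact: (@x_periodic_translate R _ _ (Gp m)).
  by apply: x_periodicM => // t x; rewrite !(Lp m t x).1 !(Lp m t x).2.
have h01' : 0 <= h m <= 1 by have /andP[/ltW-> ->] := h01 m.
transitivity (I P - I Q).
  rewrite -RintegralB//; [|exact: integrable_slab PB|exact: integrable_slab QB].
  by apply: eq_Rintegral => z zs; rewrite upwind ?inE// /P /Q; [ring|move: zs; rewrite inE].
rewrite -(@slab_shift_x R T Q _ (h m) e1 e1dir h01' mQ QB Qp) -RintegralB//.
- apply: eq_Rintegral => z _.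
  by rewrite /P /Q /bracket -[z + _ + _]addrA scaleNr subrr addr0; ring.
- exact: integrable_slab PB.
- by apply: (integrable_slab T (measurable_comp_translate _ mQ)) => z; exact: QB.
Qed.

(** The bracket tends to [phi * lam], and the slopes are bounded. *)
Lemma bracket_limit : I (fun z => bracket m z * G m z) - I (fun z => phi z * lam z * G m z)
  @[m --> \oo] --> 0.
Proof.
have ms := measurable_slab T.
have phic z : phi (z + h m *: e1) @[m --> \oo] --> phi z.
  have d0 : phi (z + h m *: e1) - phi z @[m --> \oo] --> 0.
    apply/norm_cvg0P; apply: (@squeeze_cvgr _ _ _ _ (fun=> 0) (fun m => D1 * `|h m|)).
    - by apply: nearW => m; rewrite normr_ge0; exact: smooth_line_lipschitz.
    - exact: cvg_cst.
    - by rewrite -(mulr0 D1); apply: cvgM; [exact: cvg_cst|apply/norm_cvg0P].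
  have cc : (fun _ : nat => phi z) @ \oo --> phi z by exact: cvg_cst.
  exact: cvg_sub0 d0 cc.
have bc z : slab T z -> bracket m z - phi z * lam z @[m --> \oo] --> 0.
  move=> sz; rewrite -(subrr (phi z * lam z)); apply: cvgB; last exact: cvg_cst.
  rewrite (_ : phi z * lam z = phi z * pos_part (lam z) - phi z * neg_part (lam z)); last first.
    by rewrite -mulrBr pos_partB.
  apply: cvgB.
    by apply: cvgM; [exact: cvg_cst|exact: cvg_pos_part (Lc sz)].
  by apply: cvgM; [exact: phic|exact: cvg_neg_part (Lc1 sz)].
have mb m : measurable_fun setT (bracket m : R3 -> R).
  apply: measurable_funB; first exact: measurable_funM.
  apply: measurable_funM; first exact: measurable_comp_translate.
  exact: (@measurable_comp_translate _ (fun z => neg_part (Lam m z))).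
have bB m z : `|bracket m z| <= 2 * (C * Bl).
  apply: (le_trans (ler_normB _ _)); rewrite mulrDl mul1r.
  by apply: lerD; apply: normrM_le => //; [exact: pos_part_bound|exact: neg_part_bound].
have plB z : `|phi z * lam z| <= C * Bl by rewrite normrM ler_pM.
have mpl : measurable_fun setT ((fun z => phi z * lam z) : R3 -> R) by exact: measurable_funM.
rewrite (_ : (fun m => _) = (fun m => I (fun z => (bracket m z - phi z * lam z) * G m z))); last first.
  apply/funext => m; rewrite -RintegralB//.
  - by apply: eq_Rintegral => z _; rewrite [RHS]mulrBl.
  - apply: (@integrable_slab _ _ _ (2 * (C * Bl) * (K + `|L|))); first exact: measurable_funM.
    by move=> z; exact: normrM_le.
  - apply: (@integrable_slab _ _ _ (C * Bl * (K + `|L|))); first exact: measurable_funM.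
    by move=> z; exact: normrM_le.
rewrite -int0.
apply: (@slab_bounded_cvg _ _ _ _ ((2 * (C * Bl) + C * Bl) * (K + `|L|))).
- by move=> m; apply: measurable_funM => //; exact: measurable_funB.
- exact: measurable_cst.
- by move=> m z; rewrite normrM ler_pM// (le_trans (ler_normB _ _))// lerD.
- by apply: aeW => z sz; apply: cvg0_bounded (bc z sz) => m; exact: GB.
Qed.

(** The slopes of [V m] and of [rho] are compared after integration by parts: the
    quotients fall on [phi * lam], where they are bounded since it is Lipschitz in
    x_1, and [V m] tends to [rho].  The slopes of [rho] converge almost everywhere. *)
Lemma slope_limit : I (fun z => phi z * lam z * G m z) @[m --> \oo] -->
  I (fun z => phi z * lam z * (pderiv K rho e1 z + L)).
Proof.
pose psi z := phi z * lam z.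
have ms := measurable_slab T.
have mpsi : measurable_fun setT (psi : R3 -> R) by exact: measurable_funM.
have psiB z : `|psi z| <= C * Bl by rewrite normrM ler_pM.
have psip : x_periodic psi by exact: x_periodicM.
have mg := measurable_pderiv rl e1dir.
have gB := pderiv_bounded rho e1 K0.
have psil z s : `|psi (z + s *: e1) - psi z| <= (D1 * Bl + C * Kl) * `|s|.
  rewrite (_ : psi _ - _ = (phi (z + s *: e1) - phi z) * lam (z + s *: e1) +
    phi z * (lam (z + s *: e1) - lam z)); last by rewrite /psi; ring.
  apply: (le_trans (ler_normD _ _)); rewrite [leRHS]mulrDl; apply: lerD.
    by rewrite [leRHS]mulrAC; apply: normrM_le => //; exact: smooth_line_lipschitz.
  by rewrite -[leRHS]mulrA; exact: normrM_le.
have qpsiB m z : `|quotient psi e1 (- h m) z| <= D1 * Bl + C * Kl.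
  rewrite /quotient normrM normfV normrN mulrC ler_pdivrMr ?normr_gt0//.
  by have := psil z (- h m); rewrite normrN.
have c1 : I (fun z => quotient rho e1 (h m) z * psi z) @[m --> \oo] -->
    I (fun z => pderiv K rho e1 z * psi z).
  apply: (@slab_bounded_cvg _ _ _ _ (K * (C * Bl))).
  - by move=> m; apply: measurable_funM => //; exact: measurable_quotient.
  - exact: measurable_funM.
  - by move=> m z; rewrite normrM ler_pM//; exact: quotient_bounded.
  - have := pderiv_ae T rl e1dir h0 hc.
    apply: filterS; first exact: (ae_filter_ringOfSetsType (leb3 R)).
    by move=> z cz /cz {}cz; apply: cvgM => //; exact: cvg_cst.
have c2 : I (fun z => quotient (V m) e1 (h m) z * psi z) - I (fun z => quotient rho e1 (h m) z * psi z)
    @[m --> \oo] --> 0.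
  rewrite (_ : (fun m => _) = (fun m => I (fun z => (rho z - V m z) * quotient psi e1 (- h m) z))); last first.
    apply/funext => m; rewrite (quotient_by_parts T e1dir (h01 m) (mV m) mpsi (VB m) psiB (Vp m) psip).
    rewrite (quotient_by_parts T e1dir (h01 m) mrho mpsi rB psiB rp psip) opprK addrC -RintegralB//.
    - by apply: eq_Rintegral => z _; rewrite [RHS]mulrBl.
    - apply: (@integrable_slab _ _ _ (B * (D1 * Bl + C * Kl))).
        by apply: measurable_funM => //; exact: measurable_quotient.
      by move=> z; exact: normrM_le.
    - apply: (@integrable_slab _ _ _ (B * (D1 * Bl + C * Kl))).
        by apply: measurable_funM => //; exact: measurable_quotient.
      by move=> z; exact: normrM_le.
  rewrite -int0.
  apply: (@slab_bounded_cvg _ _ _ _ ((B + B) * (D1 * Bl + C * Kl))).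
  - move=> m; apply: measurable_funM; [exact: measurable_funB|exact: measurable_quotient].
  - exact: measurable_cst.
  - by move=> m z; rewrite normrM ler_pM// (le_trans (ler_normB _ _))// lerD.
  - apply: aeW => z sz; apply: (cvg0_bounded (fun m => qpsiB m z)).
    by rewrite -(subrr (rho z)); apply: cvgB; [exact: cvg_cst|exact: Vc].
have c3 : I (fun z => quotient (V m) e1 (h m) z * psi z) @[m --> \oo] --> I (fun z => pderiv K rho e1 z * psi z).
  exact: cvg_sub0 c2 c1.
have ip : (leb3 R).-integrable (slab T) (EFin \o (fun z => L * psi z)).
  apply: (@integrable_slab _ _ _ (`|L| * (C * Bl))); first exact: measurable_funM.
  by move=> z; rewrite normrM ler_wpM2l.
have -> : I (fun z => phi z * lam z * (pderiv K rho e1 z + L)) =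
    I (fun z => pderiv K rho e1 z * psi z) + I (fun z => L * psi z).
  rewrite -RintegralD//; first by apply: eq_Rintegral => z _; rewrite /psi; ring.
  apply: (@integrable_slab _ _ _ (K * (C * Bl))); first exact: measurable_funM.
  by move=> z; exact: normrM_le.
rewrite (_ : (fun m => _) = (fun m => I (fun z => quotient (V m) e1 (h m) z * psi z) + I (fun z => L * psi z))).
  by apply: cvgD => //; exact: cvg_cst.
apply/funext => m; rewrite -RintegralD//; first by apply: eq_Rintegral => z _; rewrite /psi /G; ring.
have qB z : `|quotient (V m) e1 (h m) z| <= K.
  rewrite /quotient normrM normfV mulrC ler_pdivrMr ?normr_gt0//.
  by rewrite (gtr0_norm (_ : 0 < h m)) ?VK//; have /andP[] := h01 m.
apply: (@integrable_slab _ _ _ (K * (C * Bl))).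
  by apply: measurable_funM => //; exact: measurable_quotient.
by move=> z; exact: normrM_le.
Qed.

Lemma test_identity : I (fun z => rho z * 'D_et phi z) =
  - I (fun z => lam z * (pderiv K rho e1 z + L) * phi z).
Proof.
apply/esym; rewrite -[RHS]opprK; congr (- _).
have c := time_limit.
rewrite (_ : (fun m => _) = (fun m => I (fun z => bracket m z * G m z))) in c; last first.
  by apply/funext => m; exact: space_summation.
apply: (cvg_unique _ _ c); first exact: Rhausdorff.
have := cvg_sub0 bracket_limit slope_limit.
rewrite (_ : I (fun z => phi z * lam z * (pderiv K rho e1 z + L)) =
  I (fun z => lam z * (pderiv K rho e1 z + L) * phi z)); last first.
  by apply: eq_Rintegral => z _; ring.
exact.
Qed.

End test.

Lemma upwind_limit : slab_weak_derivative T et rho (fun z => lam z * (pderiv K rho e1 z + L)).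
Proof.
have mg := measurable_pderiv rl e1dir.
have gB := pderiv_bounded rho e1 K0.
split.
- exact: integrable_slab rB.
- apply: (@integrable_slab _ _ _ (Bl * (K + `|L|))).
    by apply: measurable_funM => //; exact: measurable_funD.
  by move=> z; rewrite normrM ler_pM// (le_trans (ler_normD _ _))// lerD.
move=> phi tphi.
have [C pC] := slab_test_bounded tphi.
have [D pD] := slab_test_bounded (slab_test_derive et tphi).
have [D1 pD1] := slab_test_bounded (slab_test_derive e1 tphi).
have [sphi pphi [t0 [t1 [t00 t1T supp]]]] := tphi.
exact: (test_identity sphi pphi t00 t1T supp pC pD pD1).
Qed.

End limit_passage.

(** * Discrete and continuous convolutions *)

Section reflection.
Context (R : realType) (N : nat).
Hypothesis N0 : (0 < N)%N.

Lemma periodic1_sum_shift (F : int -> R) (m : int) : periodic1 N F ->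
  \sum_(0 <= l < N) F (l%:Z + m) = \sum_(0 <= l < N) F l%:Z.
Proof.
move=> Fp.
have up (G : int -> R) (k : nat) : periodic1 N G -> \sum_(0 <= l < N) G (l%:Z + k%:Z) = \sum_(0 <= l < N) G l%:Z.
  move=> Gp; elim: k => [|k IH]; first by under eq_bigr do rewrite addr0.
  rewrite -IH -(@sum_shift R N N0 (fun l => G (l%:Z + k%:Z))).
    by apply: eq_bigr => l _; congr G; lia.
  by rewrite addrC Gp add0r.
case: m => k; first exact: up.
have Gp : periodic1 N (fun l => F (l + Negz k)) by move=> l; rewrite addrAC Fp.
rewrite -(up _ k.+1 Gp); apply: eq_bigr => l _; congr F; lia.
Qed.

Lemma periodic1_sum_reflect (F : int -> R) (i : int) : periodic1 N F ->
  \sum_(0 <= l < N) F (i - l%:Z) = \sum_(0 <= l < N) F l%:Z.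
Proof.
move=> Fp; rewrite -(periodic1_sum_shift (i - N.-1%:Z) Fp) [RHS]big_nat_rev /= add0n.
rewrite !big_mkord; apply: eq_bigr => l _; congr F.
have := ltn_ord l; lia.
Qed.

End reflection.

Section convolution.
Context (R : realType) (M : nat).
Local Notation mR := (measurableTypeR R).
Local Notation sl := (sigma_lip R M).
Local Notation cv := (torus_conv (@sigmaK R M)).

Section continuous.
Variables (u : R * R -> R) (Cu Bu : R).
Hypotheses (uC : forall x y, `|u x - u y| <= Cu * (`|x.1 - y.1| + `|x.2 - y.2|)).
Hypothesis uB : forall x, `|u x| <= Bu.

Let iu : (leb2 R).-integrable (unit_square R) (EFin \o u).
Proof.
apply: integrable_unit_square uB; exact: measurable_lip2 uC.
Qed.

Let mU : measurable (unit_square R : set (mR * mR)) := measurable_unit_square R.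

Let fineU : fine (leb2 R (unit_square R)) = 1.
Proof. by rewrite leb2_unit_square. Qed.

Let unit_lty : (leb2 R (unit_square R) < +oo)%E.
Proof. by rewrite leb2_unit_square ltry. Qed.

Lemma integrand_lipschitz x y y' : `|sigmaK M (x - y) * u y - sigmaK M (x - y') * u y'| <=
  (sl * Bu + M%:R ^+ 2 * Cu) * (`|y.1 - y'.1| + `|y.2 - y'.2|).
Proof.
rewrite (_ : _ - _ = (sigmaK M (x - y) - sigmaK M (x - y')) * u y + sigmaK M (x - y') * (u y - u y')); last by ring.
apply: (le_trans (ler_normD _ _)); rewrite [leRHS]mulrDl; apply: lerD; rewrite normrM.
  rewrite [leRHS]mulrAC ler_pM//; apply: (le_trans (sigmaK_lipschitz _ _ _)) => /=.
  by rewrite !subrBB !normrN.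
by rewrite -[leRHS]mulrA ler_pM// sigmaK_bound.
Qed.

Lemma integrand_bound x y : `|sigmaK M (x - y) * u y| <= M%:R ^+ 2 * Bu.
Proof. by rewrite normrM ler_pM// sigmaK_bound. Qed.

Lemma sigma_conv_bound x : `|cv u x| <= M%:R ^+ 2 * Bu.
Proof.
have mi : measurable_fun (unit_square R) ((fun y => sigmaK M (x - y) * u y) : mR * mR -> R).
  by apply: measurable_funTS; exact: measurable_lip2 (integrand_lipschitz x).
have := @Rintegral_le_bound _ _ _ (leb2 R) (unit_square R) mU unit_lty _ _ mi (fun y _ => integrand_bound x y).
by rewrite fineU mulr1.
Qed.

Lemma sigma_conv_lipschitz x y : `|cv u x - cv u y| <= sl * Bu * (`|x.1 - y.1| + `|x.2 - y.2|).
Proof.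
apply: (le_trans (torus_conv_lipschitz (@sigmaK_lipschitz R M) (@sigmaK_bound R M) iu x y)).
rewrite ler_wpM2r ?addr_ge0// ler_wpM2l ?sigma_lip_ge0//.
have ma : measurable_fun (unit_square R) ((fun y => `|u y|) : mR * mR -> R).
  by apply: measurable_funTS; apply: measurableT_comp => //; exact: measurable_lip2 uC.
have := @Rintegral_le_bound _ _ _ (leb2 R) (unit_square R) mU unit_lty _ Bu ma.
rewrite fineU mulr1 => h; apply: (le_trans (ler_norm _)); apply: h => z _.
by rewrite normr_id.
Qed.

Lemma sigma_conv_riemann N x : (0 < N)%N ->
  `|cv u x - \sum_(0 <= l < N) \sum_(0 <= r < N) N%:R^-1 ^+ 2 *
     (sigmaK M (x - (l%:R * N%:R^-1, r%:R * N%:R^-1)) * u (l%:R * N%:R^-1, r%:R * N%:R^-1))| <=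
  2 * (sl * Bu + M%:R ^+ 2 * Cu) * N%:R^-1.
Proof. by move=> N0; exact: (Rintegral_riemann2 N0 (integrand_lipschitz x) (integrand_bound x)). Qed.

End continuous.

Lemma sigma_convB u u' Cu Bu e :
  (forall x y, `|u x - u y| <= Cu * (`|x.1 - y.1| + `|x.2 - y.2|)) ->
  (forall x y, `|u' x - u' y| <= Cu * (`|x.1 - y.1| + `|x.2 - y.2|)) ->
  (forall x, `|u x| <= Bu) -> (forall x, `|u' x| <= Bu) ->
  (forall x, `|u x - u' x| <= e) -> forall x, `|cv u x - cv u' x| <= M%:R ^+ 2 * e.
Proof.
move=> uC uC' uB uB' ue x.
have mU : measurable (unit_square R : set (mR * mR)) := measurable_unit_square R.
have iu := integrable_conv x (@sigmaK_lipschitz R M) (@sigmaK_bound R M) (integrable_unit_square (measurable_lip2 uC) uB).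
have iu' := integrable_conv x (@sigmaK_lipschitz R M) (@sigmaK_bound R M) (integrable_unit_square (measurable_lip2 uC') uB').
rewrite /torus_conv -RintegralB//.
rewrite (_ : Rintegral _ _ _ = cv (fun y => u y - u' y) x); last first.
  by apply: eq_Rintegral => y _; rewrite mulrBr.
apply: (@sigma_conv_bound _ (Cu + Cu)) => // y z.
rewrite opprD addrACA mulrDl; apply: (le_trans (ler_normD _ _)); apply: lerD => //.
by rewrite -opprD normrN.
Qed.

Section discrete.
Variable N : nat.
Hypotheses (M0 : (0 < M)%N) (MN : (M <= N)%N).
Let N0 : (0 < N)%N := leq_trans M0 MN.
Let Nr : (N%:R : R) != 0. Proof. by rewrite pnatr_eq0 -lt0n. Qed.

(** The substitution that exchanges the arguments of a convolution.  In this form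
    it is a Riemann sum of the integral in [torus_conv]. *)
Lemma grid_conv_reflect (D : int -> int -> R) i j : grid_periodic N D ->
  grid_conv N (sigma_grid R M N) D i j =
  \sum_(0 <= l < N) \sum_(0 <= r < N) N%:R^-1 ^+ 2 *
    (sigmaK M ((i%:~R * N%:R^-1, j%:~R * N%:R^-1) - (l%:R * N%:R^-1, r%:R * N%:R^-1)) * D l%:Z r%:Z).
Proof.
move=> Dp.
pose F (l r : int) := N%:R^-1 ^+ 2 *
  (sigmaK M (i%:~R * N%:R^-1 - l%:~R * N%:R^-1, j%:~R * N%:R^-1 - r%:~R * N%:R^-1) * D l r).
have sh (k l : int) : k%:~R * N%:R^-1 - (l + N%:Z)%:~R * N%:R^-1 + 1 = k%:~R * N%:R^-1 - l%:~R * N%:R^-1 :> R.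
  by rewrite intrD mulrDl mulfV//; ring.
have Fp1 r : periodic1 N (F ^~ r).
  by move=> l; rewrite /F (Dp _ _).1 -[in LHS](sigmaK_periodic M _).1 /= sh.
have Fp2 l : periodic1 N (F l).
  by move=> r; rewrite /F (Dp _ _).2 -[in LHS](sigmaK_periodic M _).2 /= sh.
transitivity (\sum_(0 <= l < N) \sum_(0 <= r < N) F l%:Z r%:Z); last by [].
rewrite -(@periodic1_sum_reflect R N N0 (fun l => \sum_(0 <= r < N) F l r%:Z) i); last first.
  by move=> l; apply: eq_bigr => r _; exact: Fp1.
apply: eq_bigr => l _; rewrite -(@periodic1_sum_reflect R N N0 _ j (Fp2 _)).
have E (k : int) (n : nat) : k%:~R * N%:R^-1 - (k - n%:Z)%:~R * N%:R^-1 = n%:R * N%:R^-1 :> R.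
  by rewrite intrB mulrBl opprB addrC subrK.
by apply: eq_bigr => r _; rewrite /F !E mulrA.
Qed.

(** Three errors: the nodal values against [u], the Riemann sum, and the distance
    of [x] to the node. *)
Lemma grid_conv_error (D : int -> int -> R) (u : R * R -> R) Cu Bu e i j x :
  grid_periodic N D ->
  (forall x y, `|u x - u y| <= Cu * (`|x.1 - y.1| + `|x.2 - y.2|)) -> (forall x, `|u x| <= Bu) ->
  (forall l r : nat, `|D l%:Z r%:Z - u (l%:R * N%:R^-1, r%:R * N%:R^-1)| <= e) ->
  `|x.1 - i%:~R * N%:R^-1| <= N%:R^-1 -> `|x.2 - j%:~R * N%:R^-1| <= N%:R^-1 ->
  `|grid_conv N (sigma_grid R M N) D i j - cv u x| <=
    M%:R ^+ 2 * e + (4 * (sl * Bu) + 2 * (M%:R ^+ 2 * Cu)) * N%:R^-1.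
Proof.
move=> Dp uC uB De x1 x2; rewrite grid_conv_reflect//.
set X := (i%:~R * _, _).
pose S := \sum_(0 <= l < N) \sum_(0 <= r < N) N%:R^-1 ^+ 2 *
  (sigmaK M (X - (l%:R * N%:R^-1, r%:R * N%:R^-1)) * u (l%:R * N%:R^-1, r%:R * N%:R^-1)).
have e0 : 0 <= e by apply: le_trans (De 0%N 0%N).
have h1 : `|\sum_(0 <= l < N) \sum_(0 <= r < N) N%:R^-1 ^+ 2 *
  (sigmaK M (X - (l%:R * N%:R^-1, r%:R * N%:R^-1)) * D l%:Z r%:Z) - S| <= M%:R ^+ 2 * e.
  rewrite /S -sumrB; under eq_bigr do rewrite -sumrB.
  under eq_bigr do under eq_bigr do rewrite -mulrBr -mulrBr.
  apply: (grid_sum_bound N0); first by rewrite mulr_ge0// sqr_ge0.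
  by move=> l r; rewrite normrM ler_pM// sigmaK_bound.
have h2 := sigma_conv_riemann uC uB X N0; rewrite -/S in h2.
have h3 : `|cv u X - cv u x| <= sl * Bu * (2 * N%:R^-1).
  apply: (le_trans (sigma_conv_lipschitz uC uB X x)).
  apply: ler_wpM2l; first by apply: mulr_ge0; [exact: sigma_lip_ge0|exact: le_trans (uB x)].
  by rewrite mulr_natl mulr2n (distrC X.1) (distrC X.2); exact: lerD.
set A := (X in `|X - _|) in h1 *.
rewrite (_ : A - cv u x = (A - S) + (S - cv u X) + (cv u X - cv u x)); last by ring.
apply: (le_trans (ler_normD _ _)).
rewrite (_ : M%:R ^+ 2 * e + _ = M%:R ^+ 2 * e + 2 * (sl * Bu + M%:R ^+ 2 * Cu) * N%:R^-1 + sl * Bu * (2 * N%:R^-1)); last by ring.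
apply: lerD => //; apply: (le_trans (ler_normD _ _)); apply: lerD => //.
by rewrite distrC.
Qed.

End discrete.

End convolution.

(** * Piecewise constant solutions *)

Section cell_arithmetic.
Context (R : realType).
Implicit Types (k x : R).

Lemma cell_ofDz k x (m : int) : 0 < k -> cell_of k (x + m%:~R * k) = cell_of k x + m.
Proof. by move=> k0; rewrite /cell_of mulrDl mulfK ?gt_eqF// floorDrz ?intr_int// intrKfloor. Qed.

Lemma cell_ofD k x : 0 < k -> cell_of k (x + k) = cell_of k x + 1.
Proof. by move=> k0; rewrite -(cell_ofDz x 1 k0) mul1r. Qed.

Lemma cell_ofB k x : 0 < k -> cell_of k (x + - k) = cell_of k x - 1.
Proof. by move=> k0; rewrite -(cell_ofDz x (-1) k0) mulN1r. Qed.

Lemma cell_of_itv k x : 0 < k -> (cell_of k x)%:~R * k <= x < (cell_of k x + 1)%:~R * k.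
Proof.
by move=> k0; rewrite -ler_pdivlMr// -ltr_pdivrMr// floor_le_tmp floorD1_gt.
Qed.

Lemma cell_of_dist k x : 0 < k -> `|x - (cell_of k x)%:~R * k| <= k.
Proof.
move=> /(cell_of_itv x)/andP[l r]; rewrite intrD mulrDl mul1r in r.
by rewrite ger0_norm ?subr_ge0//; lra.
Qed.

End cell_arithmetic.

Section density_difference.
Context (R : realType) (K B : R) (rho : bool -> R * (R * R) -> R).
Hypotheses (rl : forall b, lip3 K (rho b)) (rB : forall b z, `|rho b z| <= B).

Definition density_difference (t : R) (y : R * R) := rho true (t, y) - rho false (t, y).

Lemma density_difference_lipschitz t x y :
  `|density_difference t x - density_difference t y| <=
    (K + K) * (`|x.1 - y.1| + `|x.2 - y.2|).
Proof.
rewrite /density_difference opprD addrACA mulrDl -opprD; apply: (le_trans (ler_normB _ _)).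
by apply: lerD; apply: (le_trans (rl _ _ _)); rewrite /= subrr normr0 add0r.
Qed.

Lemma density_difference_lipschitz_t t s x :
  `|density_difference t x - density_difference s x| <= (K + K) * `|t - s|.
Proof.
rewrite /density_difference opprD addrACA mulrDl -opprD; apply: (le_trans (ler_normB _ _)).
by apply: lerD; apply: (le_trans (rl _ _ _)); rewrite /= !subrr normr0 !addr0.
Qed.

Lemma density_difference_bound t x : `|density_difference t x| <= B + B.
Proof. by apply: (le_trans (ler_normB _ _)); rewrite lerD. Qed.

End density_difference.

Section cells.
Context (R : realType) (T L K B Bs : R) (a : R -> R) (M N NT : nat).
Variables (v : bool -> nat -> int -> int -> R).
Hypotheses (T0 : 0 < T) (M0 : (0 < M)%N) (MN : (M <= N)%N) (NT0 : (0 < NT)%N).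
Local Notation mR := (measurableTypeR R).
Local Notation R3 := (mR * (mR * mR))%type.
Let dx : R := space_step R N.
Let dt : R := time_step T NT.
Let N0 : (0 < N)%N := leq_trans M0 MN.
Let Nr : (N%:R : R) != 0. Proof. by rewrite pnatr_eq0 -lt0n. Qed.
Let dx0 : 0 < dx. Proof. by rewrite invr_gt0 ltr0n. Qed.
Let dt0 : 0 < dt. Proof. by rewrite divr_gt0 ?ltr0n. Qed.
Let dtT : NT%:R * dt = T.
Proof. by rewrite /dt /time_step mulrC divfK// pnatr_eq0 -lt0n. Qed.

Let level n b := v b n.

Hypotheses (per : forall b n, (n <= NT)%N -> grid_periodic N (v b n))
  (vB : forall b n i j, (n <= NT)%N -> `|v b n i j| <= B)
  (vK : forall b n i j, (n <= NT)%N -> `|v b n (i + 1) j - v b n i j| <= K * dx)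
  (sB : forall b n i j, (n < NT)%N ->
     `|speed M N b (a (n.+1%:R * dt)) (grid_diff (level n.+1)) i j| <= Bs)
  (step : forall b n, (n < NT)%N -> forall i j,
     let lam := speed M N b (a (n.+1%:R * dt)) (grid_diff (level n.+1)) i j in
     (v b n.+1 i j - v b n i j) / dt =
       pos_part lam * (grid_slope N (v b n) i j + L) -
       neg_part lam * (grid_slope N (v b n) (i - 1) j + L)).

Definition cell_value b (z : R * (R * R)) : R :=
  v b (minn NT `|cell_of dt z.1|%N) (cell_of dx z.2.1) (cell_of dx z.2.2).

(** The velocity of the step that leads from the level of [cell_value] to the next
    one; the index is truncated so that both levels exist for all times. *)
Definition cell_speed b (z : R * (R * R)) : R :=
  let n := minn NT.-1 `|cell_of dt z.1|%N in
  speed M N b (a (n.+1%:R * dt)) (grid_diff (level n.+1)) (cell_of dx z.2.1) (cell_of dx z.2.2).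

Lemma measurable_cell_value b : measurable_fun setT (cell_value b : R3 -> R).
Proof. exact: (measurable_cells3 dt dx dx (fun n i j => v b (minn NT `|n|%N) i j)). Qed.

Lemma measurable_cell_speed b : measurable_fun setT (cell_speed b : R3 -> R).
Proof.
exact: (measurable_cells3 dt dx dx (fun n i j => let n := minn NT.-1 `|n|%N in
  speed M N b (a (n.+1%:R * dt)) (grid_diff (level n.+1)) i j)).
Qed.

Let prevlt n : (minn NT.-1 n < NT)%N.
Proof. by rewrite -[ltnRHS]prednK// ltnS geq_minl. Qed.

Let fl1 x : cell_of dx (x + 1) = cell_of dx x + N%:Z.
Proof. by rewrite -(cell_ofDz x N%:Z dx0) -[_%:~R]/(N%:R) mulfV. Qed.

Lemma cell_value_periodic b : x_periodic (cell_value b).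
Proof.
move=> t x; rewrite /cell_value /= !fl1.
by have [-> ->] := per b (geq_minl NT `|cell_of dt t|%N) (cell_of dx x.1) (cell_of dx x.2).
Qed.

Lemma cell_speed_periodic b : x_periodic (cell_speed b).
Proof.
move=> t x; rewrite /cell_speed /= !fl1 !speedE /grid_conv.
have p := grid_diff_periodic (fun b => per b (prevlt `|cell_of dt t|%N)).
split; congr (_ * (_ + _)); do 2 (apply: eq_bigr => ? _); congr (_ * _); rewrite addrAC.
  exact: (p _ _).1.
exact: (p _ _).2.
Qed.

Lemma cell_value_bound b z : `|cell_value b z| <= B.
Proof. by apply: vB; rewrite geq_minl. Qed.

Lemma cell_speed_bound b z : `|cell_speed b z| <= Bs.
Proof. exact: sB (prevlt _). Qed.

Lemma cell_value_shift b z : `|cell_value b (z + dx *: dir_1 R) - cell_value b z| <= K * dx.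
Proof.
case: z => t [x y]; rewrite scale_dir_1 addr3E /cell_value /= !addr0 cell_ofD//.
by apply: vK; rewrite geq_minl.
Qed.

Let time_index t : 0 < t < T -> (`|cell_of dt t|%N < NT)%N /\ cell_of dt t = `|cell_of dt t|%N%:Z.
Proof.
move=> /andP[t0 tT].
have f0 : 0 <= cell_of dt t by rewrite /cell_of floor_ge0 divr_ge0 ?(ltW dt0)// ltW.
rewrite gez0_abs//; split => //.
have /andP[le _] := cell_of_itv t dt0; move: le; rewrite -[in X in X -> _](gez0_abs f0) => le.
by rewrite -(ltr_nat R) -(ltr_pM2r dt0) dtT; apply: le_lt_trans tT.
Qed.

(** The shifts by one cell and by one time step are translations of the floor. *)
Lemma cell_scheme b z : slab T z -> quotient (cell_value b) (dir_t R) dt z =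
  pos_part (cell_speed b z) * (quotient (cell_value b) (dir_1 R) dx z + L) -
  neg_part (cell_speed b z) * (quotient (cell_value b) (dir_1 R) dx (z + (- dx) *: dir_1 R) + L).
Proof.
case: z => t [x y] [/= tT _]; rewrite in_itv/= in tT.
have [nNT nE] := time_index tT.
rewrite /quotient !scale_dir_1 scale_dir_t !addr3E /cell_value /cell_speed /=.
rewrite !addr0 !cell_ofD// !cell_ofB//.
have -> : absz (cell_of dt t + 1)%R = (absz (cell_of dt t)).+1 by rewrite nE -PoszD addn1.
set n := `|_|%N in nNT *.
rewrite (minn_idPr nNT) (minn_idPr (ltnW nNT)) (_ : minn NT.-1 n = n); last first.
  by apply/minn_idPr; rewrite -ltnS prednK.
have := step b nNT (cell_of dx x) (cell_of dx y); rewrite /grid_slope -/dx /= => E.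
by rewrite ![_^-1 * _]mulrC E subrK.
Qed.

Section consistency.
Variables (rho : bool -> R * (R * R) -> R) (e : R).
Hypotheses (rl : forall b, lip3 K (rho b)) (rB : forall b z, `|rho b z| <= B).
Hypothesis close : forall b n i j, (n <= NT)%N ->
  `|v b n i j - rho b (n%:R * dt, (i%:~R * dx, j%:~R * dx))| <= e.

Lemma cell_value_close b z : slab T z -> `|cell_value b z - rho b z| <= e + K * (dt + dx + dx).
Proof.
case: z => t [x y] [/= tT _]; rewrite in_itv/= in tT.
have [nNT nE] := time_index tT.
rewrite /cell_value /=; set n := `|_|%N in nNT nE *.
rewrite (minn_idPr (ltnW nNT)).
set p := (n%:R * dt, ((cell_of dx x)%:~R * dx, (cell_of dx y)%:~R * dx)).
rewrite -(subrK (rho b p) (v _ _ _ _)) -addrA; apply: (le_trans (ler_normD _ _)).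
apply: lerD; first exact: close (ltnW nNT).
rewrite distrC; apply: (le_trans (rl b _ _)) => /=.
apply: ler_wpM2l.
  exact: lip3_ge0 (rl b).
by rewrite !lerD// ?cell_of_dist//; have := cell_of_dist t dt0; rewrite nE.
Qed.

(** The time is clamped so that the velocity is measurable and bounded on the
    whole space. *)
Definition limit_speed b (z : R * (R * R)) : R :=
  - sgb R b * (torus_conv (sigmaK M) (fun y => rho true (z.1, y) - rho false (z.1, y)) z.2 +
               a (clamp T z.1)).

Let w := density_difference rho.
Let K0 : 0 <= K.
Proof.
exact: lip3_ge0 (rl true).
Qed.

Let wl := density_difference_lipschitz rl.

Let wB := density_difference_bound rB.

Definition consistency_const : R :=
  4 * (sigma_lip R M * (B + B)) + 2 * (M%:R ^+ 2 * (K + K)).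

(** The time [s] is the end of the step that contains [t], where [a] is evaluated. *)
Lemma cell_speed_close b t x : 0 < t < T -> exists s, `|s - t| <= dt /\ 0 <= s <= T /\
  `|cell_speed b (t, x) - limit_speed b (t, x)| <=
    `|a (clamp T s) - a (clamp T t)| + M%:R ^+ 2 * (2 * (e + K * dt)) + consistency_const * dx.
Proof.
move=> tT; have [nNT nE] := time_index tT.
rewrite /cell_speed /limit_speed /=; set n := `|_|%N in nNT nE *.
rewrite (_ : minn NT.-1 n = n); last by apply/minn_idPr; rewrite -ltnS prednK.
have st : `|n.+1%:R * dt - t| <= dt.
  have /andP[] := cell_of_itv t dt0; rewrite nE intrD -[n%:~R]/(n%:R) natr1 => h1 h2.
  by rewrite -[n.+1%:R]natr1 mulrDl mul1r in h2 *; rewrite ger0_norm; lra.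
exists (n.+1%:R * dt); split => //.
have sT : 0 <= n.+1%:R * dt <= T.
  by rewrite mulr_ge0 ?(ltW dt0)//= -[leRHS]dtT ler_wpM2r ?(ltW dt0)// ler_nat.
split => //; rewrite (clamp_id sT) speedE -mulrBr normrM.
rewrite (_ : `|- sgb R b| = 1); last by rewrite normrN; case: b; rewrite /= ?normrN normr1.
rewrite mul1r [torus_conv _ _ _ + _]addrC opprD addrACA -[leRHS]addrA; apply: (le_trans (ler_normD _ _)).
apply: lerD => //.
apply: (grid_conv_error M0 MN (u := w t)) => //.
- exact: grid_diff_periodic (fun b => per b nNT).
- move=> l r.
  have h c : `|v c n.+1 l%:Z r%:Z - rho c (t, (l%:R * N%:R^-1, r%:R * N%:R^-1))| <= e + K * dt.
    rewrite -(subrK (rho c (n.+1%:R * dt, (l%:R * N%:R^-1, r%:R * N%:R^-1))) (v _ _ _ _)) -addrA.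
    apply: (le_trans (ler_normD _ _)); apply: lerD; first exact: close nNT.
    apply: (le_trans (rl c _ _)); rewrite /= !subrr normr0 !addr0.
    by rewrite ler_wpM2l.
  rewrite /grid_diff /level /w /density_difference opprD addrACA -opprD.
  rewrite (_ : 2 * (e + K * dt) = (e + K * dt) + (e + K * dt)); last by ring.
  by apply: (le_trans (ler_normB _ _)); exact: lerD.
- exact: cell_of_dist.
- exact: cell_of_dist.
Qed.

End consistency.

End cells.

(** * The limit equation *)

(** A criterion for estimates that combine an arbitrarily small uniform error with
    one that vanishes with the mesh. *)
Lemma cvg_up_to (R : realType) (x c : nat -> R) (l C : R) : 0 <= C -> c @ \oo --> 0 ->
  (forall e, 0 < e -> \forall k \near \oo, `|x k - l| <= C * e + c k) -> x @ \oo --> l.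
Proof.
move=> C0 c0 h; apply/cvgrPdist_le => e e0.
have C1 : 0 < C + 1 by rewrite ltr_wpDl.
have e1 : 0 < e / 2 / (C + 1) by rewrite !divr_gt0.
have e2 : 0 < e / 2 by rewrite divr_gt0.
near=> k; rewrite distrC.
have h1 : `|x k - l| <= C * (e / 2 / (C + 1)) + c k by near: k; exact: h.
have h2 : `|0 - c k| <= e / 2 by near: k; move/cvgrPdist_le : c0; exact.
have h3 : C * (e / 2 / (C + 1)) <= e / 2.
  rewrite (_ : C * _ = e / 2 * (C / (C + 1))); last by ring.
  by rewrite ler_piMr ?(ltW e2)// ler_pdivrMr// mul1r lerDl.
rewrite sub0r normrN in h2; have := ler_norm (c k); lra.
Unshelve. all: by end_near. Qed.

Lemma torus_conv_periodic (R : realType) (k u : R * R -> R) :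
  torus_periodic k -> torus_periodic (torus_conv k u).
Proof.
move=> kp x; split; apply: eq_Rintegral => y _.
  rewrite (_ : (x.1 + 1, x.2) - y = ((x - y).1 + 1, (x - y).2)) ?(kp _).1//.
  by rewrite /= addrAC.
rewrite (_ : (x.1, x.2 + 1) - y = ((x - y).1, (x - y).2 + 1)) ?(kp _).2//.
by rewrite /= addrAC.
Qed.

Section limit_speed_properties.
Context (R : realType) (T K B Na : R) (a : R -> R) (M : nat) (rho : bool -> R * (R * R) -> R).
Local Notation mR := (measurableTypeR R).
Local Notation R3 := (mR * (mR * mR))%type.
Hypotheses (T0 : 0 < T) (ca : {within `[0, T], continuous a}).
Hypotheses (aNa : forall t, 0 <= t <= T -> `|a t| <= Na).
Hypotheses (rl : forall b, lip3 K (rho b)) (rB : forall b z, `|rho b z| <= B).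
Hypothesis rp : forall b, x_periodic (rho b).

Let w := density_difference rho.
Let cw (z : R * (R * R)) := torus_conv (sigmaK M) (w z.1) z.2.

Let K0 : 0 <= K.
Proof.
exact: lip3_ge0 (rl true).
Qed.
Let B0 : 0 <= B. Proof. exact: le_trans (rB true 0). Qed.

Let wl := density_difference_lipschitz rl.

Let wt := density_difference_lipschitz_t rl.

Let wB := density_difference_bound rB.

Let sl := sigma_lip R M * (B + B).
Let sl0 : 0 <= sl. Proof. by rewrite mulr_ge0 ?sigma_lip_ge0// addr_ge0. Qed.

Let cw_lip3 : lip3 (sl + M%:R ^+ 2 * (K + K)) cw.
Proof.
move=> [t x] [s y]; rewrite /cw /=.
rewrite -(subrK (torus_conv (sigmaK M) (w t) y) (torus_conv (sigmaK M) (w t) x)) -addrA.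
apply: (le_trans (ler_normD _ _)).
have h1 := @sigma_conv_lipschitz R M _ _ _ (wl t) (wB t) x y.
have h2 := @sigma_convB R M _ _ _ _ _ (wl t) (wl s) (wB t) (wB s) (wt t s) y.
have c0 : 0 <= M%:R ^+ 2 * (K + K) by rewrite mulr_ge0 ?sqr_ge0 ?addr_ge0.
rewrite mulrA in h2; apply: (le_trans (lerD h1 h2)).
rewrite -/sl; set c := M%:R ^+ 2 * _ in c0 *.
rewrite -subr_ge0.
rewrite (_ : _ - _ = sl * `|t - s| + c * (`|x.1 - y.1| + `|x.2 - y.2|)); last by ring.
by apply: addr_ge0; apply: mulr_ge0 => //; exact: addr_ge0.
Qed.

Definition limit_speed_max : R := M%:R ^+ 2 * (B + B) + Na.

Lemma measurable_limit_speed b : measurable_fun setT (limit_speed T a M rho b : R3 -> R).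
Proof.
apply: measurable_funM => //; apply: measurable_funD.
  exact: continuous_measurable3 (lip3_continuous cw_lip3).
have mc : measurable_fun setT ((a \o clamp T) : mR -> R).
  by apply: continuous_measurable_fun; exact: (@continuous_clamp R T (ltW T0) a ca).
exact: (measurableT_comp mc measurable_fst).
Qed.

Let sg b : `|- sgb R b| = 1.
Proof. by rewrite normrN; case: b; rewrite /= ?normrN normr1. Qed.

Lemma limit_speed_bound b z : `|limit_speed T a M rho b z| <= limit_speed_max.
Proof.
rewrite /limit_speed normrM sg mul1r; apply: (le_trans (ler_normD _ _)); apply: lerD.
  exact: (@sigma_conv_bound R M _ _ _ (wl z.1) (wB z.1) z.2).
by apply: aNa; exact: clamp_itv (ltW T0) z.1.
Qed.

Lemma limit_speed_periodic b : x_periodic (limit_speed T a M rho b).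
Proof.
move=> t x; rewrite /limit_speed /=.
have [-> ->] // := @torus_conv_periodic R (sigmaK M) (fun y => rho true (t, y) - rho false (t, y)) (@sigmaK_periodic R M) x.
Qed.

Lemma limit_speed_lip b z s : `|limit_speed T a M rho b (z + s *: dir_1 R) - limit_speed T a M rho b z| <=
  sl * `|s|.
Proof.
case: z => t [x y]; rewrite scale_dir_1 addr3E /limit_speed /= !addr0 -mulrBr normrM sg mul1r.
rewrite opprD addrACA subrr addr0.
have := @sigma_conv_lipschitz R M _ _ _ (wl t) (wB t) (x + s, y) (x, y).
by rewrite /= subrr normr0 addr0 addrAC subrr add0r.
Qed.

End limit_speed_properties.

Section convergence.
Context (R : realType) (T L K B Na Bs : R) (a : R -> R) (M : nat) (N NT : nat -> nat).
Variables (v : nat -> bool -> nat -> int -> int -> R) (rho : bool -> R * (R * R) -> R).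
Local Notation dx k := (space_step R (N k)).
Local Notation dt k := (time_step T (NT k)).
Hypotheses (T0 : 0 < T) (ca : {within `[0, T], continuous a}).
Hypotheses (aNa : forall t, 0 <= t <= T -> `|a t| <= Na).
Hypotheses (M0 : (0 < M)%N) (MN : forall k, (M <= N k)%N) (NT0 : forall k, (0 < NT k)%N).
Hypotheses (dxc : dx k @[k --> \oo] --> 0) (dtc : dt k @[k --> \oo] --> 0).
Hypotheses (rl : forall b, lip3 K (rho b)) (rB : forall b z, `|rho b z| <= B).
Hypothesis rp : forall b, x_periodic (rho b).
Hypotheses (per : forall k b n, (n <= NT k)%N -> grid_periodic (N k) (v k b n))
  (vB : forall k b n i j, (n <= NT k)%N -> `|v k b n i j| <= B)
  (vK : forall k b n i j, (n <= NT k)%N -> `|v k b n (i + 1) j - v k b n i j| <= K * dx k)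
  (sB : forall k b n i j, (n < NT k)%N ->
     `|speed M (N k) b (a (n.+1%:R * dt k)) (grid_diff (fun c => v k c n.+1)) i j| <= Bs)
  (step : forall k b n, (n < NT k)%N -> forall i j,
     let lam := speed M (N k) b (a (n.+1%:R * dt k)) (grid_diff (fun c => v k c n.+1)) i j in
     (v k b n.+1 i j - v k b n i j) / dt k =
       pos_part lam * (grid_slope (N k) (v k b n) i j + L) -
       neg_part lam * (grid_slope (N k) (v k b n) (i - 1) j + L)).
Hypothesis close : forall e, 0 < e -> \forall k \near \oo, forall b n i j, (n <= NT k)%N ->
  `|v k b n i j - rho b (n%:R * dt k, (i%:~R * dx k, j%:~R * dx k))| <= e.

Let V k b := cell_value T (N k) (NT k) (v k) b.
Let Lam k b := cell_speed T a M (N k) (NT k) (v k) b.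
Let lam b := limit_speed T a M rho b.

Let N0 k : (0 < N k)%N := leq_trans M0 (MN k).
Let dx0 k : 0 < dx k. Proof. by rewrite invr_gt0 ltr0n. Qed.
Let dt0 k : 0 < dt k. Proof. by rewrite divr_gt0 ?ltr0n. Qed.

Lemma cell_value_cvg b z : slab T z -> V k b z @[k --> \oo] --> rho b z.
Proof.
move=> sz; apply: (@cvg_up_to R _ (fun k => K * (dt k + dx k + dx k)) _ 1) => //.
  rewrite -(mulr0 K); apply: cvgM; first exact: cvg_cst.
  by rewrite -(addr0 0); apply: cvgD => //; rewrite -(addr0 0); exact: cvgD.
move=> e /close; apply: filterS => k ck; rewrite mul1r.
exact: (cell_value_close T0 M0 (MN k) (NT0 k) rl ck b sz).
Qed.

Let err k := M%:R ^+ 2 * (2 * (K * dt k)) + consistency_const K B M * dx k.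

Let errc : err k @[k --> \oo] --> 0.
Proof.
rewrite -(addr0 0); apply: cvgD.
  rewrite -(mulr0 (M%:R ^+ 2)); apply: cvgM; first exact: cvg_cst.
  rewrite -(mulr0 2); apply: cvgM; first exact: cvg_cst.
  by rewrite -(mulr0 K); apply: cvgM => //; exact: cvg_cst.
by rewrite -(mulr0 (consistency_const K B M)); apply: cvgM => //; exact: cvg_cst.
Qed.

Lemma cell_speed_near b t e : 0 < t < T -> 0 < e -> \forall k \near \oo, forall x,
  `|Lam k b (t, x) - lam b (t, x)| <= (1 + 2 * M%:R ^+ 2) * e + err k.
Proof.
move=> tT e0.
have /cvgrPdist_le/(_ _ e0) [d /= d0 dP] := @continuous_clamp R T (ltW T0) a ca t.
near=> k => x.
have ck : forall b n i j, (n <= NT k)%N ->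
  `|v k b n i j - rho b (n%:R * dt k, (i%:~R * dx k, j%:~R * dx k))| <= e by near: k; exact: close.
have [s [st [sT h]]] := cell_speed_close a T0 M0 (MN k) (NT0 k) (per (k := k)) rl rB ck b x tT.
have dd : `|0 - dt k| < d by near: k; move/cvgrPdist_lt : dtc; exact.
have as' : `|a (clamp T s) - a (clamp T t)| <= e.
  rewrite distrC; apply: dP; rewrite /ball_/= distrC (le_lt_trans st)//.
  by rewrite sub0r normrN gtr0_norm in dd.
apply: (le_trans h); rewrite /err; lra.
Unshelve. all: by end_near. Qed.

Let C0 : 0 <= 1 + 2 * M%:R ^+ 2 :> R.
Proof. by rewrite addr_ge0// mulr_ge0// sqr_ge0. Qed.

Lemma cell_speed_cvg b z : slab T z -> Lam k b z @[k --> \oo] --> lam b z.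
Proof.
case: z => t x [/= tT _]; rewrite in_itv/= in tT.
apply: (cvg_up_to C0 errc) => e e0.
by have := cell_speed_near b tT e0; apply: filterS => k; exact.
Qed.

Lemma cell_speed_shift_cvg b z : slab T z -> Lam k b (z + dx k *: dir_1 R) @[k --> \oo] --> lam b z.
Proof.
case: z => t [x y] [/= tT _]; rewrite in_itv/= in tT.
have ec : err k + sigma_lip R M * (B + B) * dx k @[k --> \oo] --> 0.
  rewrite -(addr0 0); apply: cvgD => //.
  by rewrite -(mulr0 (sigma_lip R M * (B + B))); apply: cvgM => //; exact: cvg_cst.
apply: (cvg_up_to C0 ec) => e e0.
have := cell_speed_near b tT e0; apply: filterS => k h.
have h1 := @limit_speed_lip R T K B a M rho rl rB b (t, (x, y)) (dx k).
have h2 : `|Lam k b ((t, (x, y)) + dx k *: dir_1 R) - lam b ((t, (x, y)) + dx k *: dir_1 R)| <=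
    (1 + 2 * M%:R ^+ 2) * e + err k.
  by rewrite scale_dir_1 addr3E addr0; exact: h.
rewrite (gtr0_norm (dx0 k)) in h1.
rewrite -(subrK (lam b ((t, (x, y)) + dx k *: dir_1 R)) (Lam k b _)) -addrA [leRHS]addrA.
by apply: (le_trans (ler_normD _ _)); apply: lerD.
Qed.

Lemma limit_equation b : slab_weak_derivative T (dir_t R) (rho b)
  (fun z => lam b z * (pderiv K (rho b) (dir_1 R) z + L)).
Proof.
pose Bl := limit_speed_max B Na M + Bs.
have Bl1 : limit_speed_max B Na M <= Bl.
  rewrite lerDl; apply: le_trans (sB b 0 0 (NT0 0%N)); exact: normr_ge0.
have Bl2 : Bs <= Bl.
  rewrite lerDr; apply: le_trans (limit_speed_bound M T0 aNa rl rB b 0); exact: normr_ge0.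
apply: (@upwind_limit R T L K (sigma_lip R M * (B + B)) B Bl (rho b) (lam b)
  (fun k => V k b) (fun k => Lam k b) (fun k => dx k) (fun k => dt k)) => //.
- exact: measurable_limit_speed T0 ca rl rB b.
- by move=> z; apply: le_trans Bl1; exact: limit_speed_bound.
- exact: limit_speed_periodic.
- exact: limit_speed_lip rl rB b.
- by move=> k; rewrite dx0/= invf_le1 ?ltr0n// ler1n.
- by move=> k; exact: measurable_cell_value.
- by move=> k z; exact: (cell_value_bound T (N k) (vB (k := k))).
- by move=> k; exact: (cell_value_periodic T M0 (MN k) (per (k := k))).
- by move=> k z; exact: (cell_value_shift T M0 (MN k) (vK (k := k))).
- by move=> k; exact: measurable_cell_speed.
- by move=> k z; apply: le_trans Bl2; exact: (cell_speed_bound (NT0 k) (sB (k := k))).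
- by move=> k; exact: (cell_speed_periodic T a M0 (MN k) (NT0 k) (per (k := k))).
- exact: cell_value_cvg.
- exact: cell_speed_cvg.
- exact: cell_speed_shift_cvg.
- by move=> k z sz; exact: (cell_scheme T0 M0 (MN k) (NT0 k) (step (k := k)) b sz).
Qed.

End convergence.

(** * Convergence of the scheme *)

Lemma uniform_cvg_on (R : realType) (X : choiceType) (A : set X) (u : nat -> X -> R) (l : X -> R) :
  (forall e, 0 < e -> \forall k \near \oo, forall z, A z -> `|u k z - l z| <= e) ->
  {uniform A, u @ \oo --> l}.
Proof.
move=> h P /uniform_nbhs [E [entE subP]].
have [e /= e0 eE] : exists2 e : R, 0 < e & [set xy | ball xy.1 e xy.2] `<=` E.
  by move: entE; rewrite -entourage_ballE.
have e2 : 0 < e / 2 by rewrite divr_gt0.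
have := h _ e2; apply: filterS => k hk; apply: subP => z /hk zk; apply: eE.
by rewrite /= -ball_normE /= distrC (le_lt_trans zk)// ltr_pdivrMr// mulr_natr mulr2n ltrDl.
Qed.

Lemma eq_slab_weak_derivative (R : realType) (T : R) v (u g g' : R * (R * R) -> R) :
  (forall z, slab T z -> g z = g' z) -> slab_weak_derivative T v u g ->
  slab_weak_derivative T v u g'.
Proof.
move=> gg' [iu ig tested]; split => //.
  apply: (@eq_integrable _ _ _ (leb3 R) (slab T) (measurable_slab T) (EFin \o g) (EFin \o g')) ig.
  by move=> z; rewrite inE => /gg' /= ->.
move=> phi /tested ->; congr (- _); apply: eq_Rintegral => z; rewrite inE => /gg' ->.
by [].
Qed.

Lemma time_clamped_constant (R : realType) (T : R) (u : R * (R * R) -> R) : 0 <= T ->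
  time_constant T (time_clamped T u).
Proof. by move=> T0 t x; rewrite /time_clamped /= [clamp T (clamp T t)]clamp_id// clamp_itv. Qed.

Theorem theorem2 (R : realType) (T L : R) (a : R -> R)
    (rho0 : bool -> R * R -> R) (M : nat) (N NT : nat -> nat)
    (v : nat -> bool -> nat -> int -> int -> R)
    (rhom : nat -> bool -> R * (R * R) -> R) :
  0 < T -> 0 < L ->
  {within `[0, T], continuous a} ->
  (forall b, admissible_datum L (rho0 b)) ->
  (1 <= M)%N ->
  (forall m, (0 < N m)%N) -> (forall m, (0 < NT m)%N) ->
  (forall m, (M <= N m)%N) ->
  Num.max (time_step T (NT m)) (space_step R (N m)) @[m --> \oo] --> (0 : R) ->
  (forall m, CFL T L a M (N m) (NT m)) ->
  (forall m, scheme_solution T L a rho0 M (N m) (NT m) (v m)) ->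
  (forall m b, Q1_reconstruction T (N m) (NT m) (v m b) (rhom m b)) ->
  exists rho : bool -> R * (R * R) -> R,
    [/\ forall b, W1infty T (rho b),
        exists s : nat -> nat, {homo s : k l / (k < l)%N} /\
          forall b, converges_in_C T (fun k => rhom (s k) b) (rho b),
        forall b, distributional_solution T L a M rho b &
        forall b x, rho b (0, x) = regularized_datum M (rho0 b) x].
Proof.
move=> T0 L0 ca adm M0 N0 NT0 MN steps cfl sol rec.
have T0' := ltW T0.
have [Kt KtP] := regularized_datum_lipschitz M0 (adm true).
have [Kf KfP] := regularized_datum_lipschitz M0 (adm false).
pose K0 := Num.max Kt Kf.
have datum_lip b x y : `|regularized_datum M (rho0 b) x - regularized_datum M (rho0 b) y| <=
    K0 * (`|x.1 - y.1| + `|x.2 - y.2|).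
  by case: b; [apply: (le_trans (KtP x y))|apply: (le_trans (KfP x y))];
    rewrite ler_wpM2r ?addr_ge0// le_max lexx ?orbT.
pose K := scheme_lip T L K0 a M.
pose dx m : R := space_step R (N m).
pose dt m : R := time_step T (NT m).
have dx0 m : 0 < dx m by rewrite invr_gt0 ltr0n.
have dt0 m : 0 < dt m by rewrite divr_gt0 ?ltr0n.
have per m b n : (n <= NT m)%N -> grid_periodic (N m) (v m b n).
  by move=> nN; have [+ _ _] := sol m; exact.
have lip1 m b n i j : (n <= NT m)%N -> `|v m b n (i + 1) j - v m b n i j| <= K * dx m.
  exact: (scheme_lip1 T0 L0 ca adm M0 (MN m) (NT0 m) (cfl m) (sol m) datum_lip).
have lip2 m b n i j : (n <= NT m)%N -> `|v m b n i (j + 1) - v m b n i j| <= K * dx m.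
  exact: (scheme_lip2 T0 L0 ca adm M0 (MN m) (NT0 m) (cfl m) (sol m) datum_lip).
have lipt m b n i j : (n < NT m)%N -> `|v m b n.+1 i j - v m b n i j| <= K * dt m.
  exact: (scheme_lip_t T0 L0 ca adm M0 (MN m) (NT0 m) (cfl m) (sol m) datum_lip).
pose U m b := time_clamped T (rhom m b).
have Ul m b : lip3 K (U m b).
  exact: (reconstruction_lip3 T0 (N0 m) (NT0 m) (rec m b) (lip1 m b) (lip2 m b) (lipt m b)).
have Up m b : x_periodic (U m b).
  exact: (reconstruction_x_periodic T0 (N0 m) (NT0 m) (rec m b) (per m b)).
have Uc m b : time_constant T (U m b) by exact: time_clamped_constant.
have node m b n i j : (n <= NT m)%N -> U m b (n%:R * dt m, (i%:~R * dx m, j%:~R * dx m)) = v m b n i j.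
  move=> nN; rewrite /U /time_clamped /= clamp_id; first exact: (node_value T0 (N0 m) (NT0 m) (rec m b)).
  rewrite mulr_ge0 ?(ltW (dt0 m))//=.
  rewrite -[leRHS](_ : (NT m)%:R * dt m = T); first by rewrite ler_wpM2r ?(ltW (dt0 m)) ?ler_nat.
  by rewrite /dt /time_step mulrC divfK// pnatr_eq0 -lt0n.
have U0 m b i j : U m b (0, (i%:~R * dx m, j%:~R * dx m)) =
    regularized_datum M (rho0 b) (i%:~R * dx m, j%:~R * dx m).
  have := node m b 0%N i j (leq0n _); rewrite mul0r => ->.
  by have [_ + _] := sol m; exact.
pose B0 := `|regularized_datum M (rho0 true) (0, 0)| + `|regularized_datum M (rho0 false) (0, 0)|.
have Ub0 m b : `|U m b (0, (0, 0))| <= B0.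
  have := U0 m b 0 0; rewrite !mul0r => ->.
  by rewrite /B0; case: b; rewrite ?lerDl ?lerDr.
have [s [rho [shomo rl rp rc rconv]]] := uniform_subsequence T0 Ul Up Uc Ub0.
have K00 : 0 <= K.
  exact: lip3_ge0 (rl true).
pose B := B0 + (`|rho true (0, (0, 0))| + `|rho false (0, (0, 0))|) + K * (T + 2).
have rB b z : `|rho b z| <= B.
  apply: (le_trans (lip3_periodic_bound T0 (rl b) (rp b) (rc b) z)); rewrite lerD2r.
  have B00 : 0 <= B0 by exact: addr_ge0.
  by apply: (@le_trans _ _ (`|rho true (0, (0, 0))| + `|rho false (0, (0, 0))|));
    [case: b; rewrite ?lerDl ?lerDr|rewrite lerDr].
have UB m b z : `|U m b z| <= B.
  apply: (le_trans (lip3_periodic_bound T0 (Ul m b) (Up m b) (Uc m b) z)); rewrite lerD2r.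
  by apply: (le_trans (Ub0 m b)); rewrite lerDl addr_ge0.
have s_ge k : (k <= s k)%N by elim: k => // k IH; exact: leq_ltn_trans IH (shomo _ _ (ltnSn k)).
have s_infty : s @ \oo --> \oo.
  by move=> A [n _ nA]; exists n => // k nk; apply: nA; exact: leq_trans nk (s_ge k).
have dtc : dt (s k) @[k --> \oo] --> 0.
  apply: (@squeeze_cvgr _ _ _ _ (fun=> 0) (fun k => Num.max (dt (s k)) (dx (s k)))).
  - by apply: nearW => k; rewrite (ltW (dt0 _)) le_max lexx.
  - exact: cvg_cst.
  - exact: (cvg_comp _ _ s_infty steps).
have dxc : dx (s k) @[k --> \oo] --> 0.
  apply: (@squeeze_cvgr _ _ _ _ (fun=> 0) (fun k => Num.max (dt (s k)) (dx (s k)))).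
  - by apply: nearW => k; rewrite (ltW (dx0 _)) le_max lexx orbT.
  - exact: cvg_cst.
  - exact: (cvg_comp _ _ s_infty steps).
have aNa t : 0 <= t <= T -> `|a t| <= Linfty_norm T a by exact: Linfty_norm_ge.
pose Na := Linfty_norm T a.
pose Bs := speed_max M L Na.
have eqn := @limit_equation R T L K B Na Bs a M (fun k => N (s k)) (fun k => NT (s k))
  (fun k => v (s k)) rho T0 ca aNa M0 (fun k => MN (s k)) (fun k => NT0 (s k)) dxc dtc rl rB rp
  (fun k => per (s k)) _ (fun k => lip1 (s k)) _ _ _.
have {}eqn b : slab_weak_derivative T (dir_t R) (rho b)
    (fun z => limit_speed T a M rho b z * (pderiv K (rho b) (dir_1 R) z + L)).
  apply: eqn => {b}.
  - by move=> k b n i j nN; rewrite -(node _ b _ i j nN).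
  - move=> k b n i j nN.
    exact: (scheme_speed_bound T0 L0 ca adm M0 (MN _) (NT0 _) (cfl _) (sol _) b i j nN).
  - move=> k b n nN i j; have [_ _ step] := sol (s k); exact: step.
  - move=> e /rconv; apply: filterS => k ck b n i j nN.
    by rewrite -(node _ b _ i j nN).
have e1dir : dir_1 R \in [:: dir_1 R; dir_2 R] by rewrite inE eqxx.
have gB b v' := @pderiv_bounded R K (rho b) v' K00.
have mg b v' (h : v' \in [:: dir_1 R; dir_2 R]) := measurable_pderiv (rl b) h.
exists rho; split.
- move=> b; split; first exact: (Lfun_bounded T (continuous_measurable3 (lip3_continuous (rl b))) (rB b)).
  move=> w; rewrite inE => /orP[/eqP->|wdir].
    exists (fun z => limit_speed T a M rho b z * (pderiv K (rho b) (dir_1 R) z + L)); split; last exact: eqn.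
    apply: (Lfun_bounded T (B := limit_speed_max B Na M * (K + `|L|))).
      apply: measurable_funM; first exact: (measurable_limit_speed M T0 ca rl rB b).
      by apply: measurable_funD => //; exact: mg.
    move=> z; rewrite normrM ler_pM//; first exact: limit_speed_bound.
    by apply: (le_trans (ler_normD _ _)); rewrite lerD2r.
  exists (pderiv K (rho b) w); split; first exact: (Lfun_bounded T (mg b w wdir) (gB b w)).
  exact: lipschitz_weak_derivative (rl b) (rB b) (rp b) wdir.
- exists s; split => // b; split.
  + by move=> k; exact: (lip3_in_C T0' (Ul (s k) b) (Up (s k) b)).
  + have E : time_clamped T (rho b) = rho b by apply/funext => -[t x]; rewrite /time_clamped /= -rc.
    by apply: (@lip3_in_C R T K) => //; rewrite E; [exact: rl|exact: rp].
  + apply: uniform_cvg_on => e /rconv; apply: filterS => k ck -[t x] [/= tT _].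
    by rewrite in_itv /= in tT; have := ck b (t, x); rewrite /U /time_clamped /= clamp_id.
- move=> b; exists (pderiv K (rho b) (dir_1 R)); split.
  + exact: (Lfun_bounded T (mg b _ e1dir) (gB b _)).
  + exact: lipschitz_weak_derivative (rl b) (rB b) (rp b) e1dir.
  + apply: eq_slab_weak_derivative (eqn b) => -[t x] [/= tT _].
    rewrite /limit_speed /= clamp_id//.
    by move: tT; rewrite in_itv/= => /andP[/ltW-> /ltW->].
- move=> b x; apply/eqP; rewrite -subr_eq0 -normr_le0; apply/ler_addgt0Pl => e e0; rewrite addr0.
  have K0ge : 0 <= K0.
    by have := datum_lip true (1, 0) (0, 0); rewrite /= !subr0 normr0 normr1 addr0 mulr1; apply: le_trans.
  have C0 : 0 < 2 * (K + K0 + 1) by rewrite mulr_gt0// ltr_wpDl// addr_ge0.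
  (* both sides are Lipschitz, and at a node near [x] they differ by a uniform error *)
  have e2 : 0 < e / 2 by rewrite divr_gt0.
  near \oo => k.
  have ck : forall b z, `|U (s k) b z - rho b z| <= e / 2 by near: k; exact: rconv.
  have dk : `|0 - dx (s k)| <= e / 2 / (2 * (K + K0 + 1)).
    by near: k; move/cvgrPdist_le : dxc; apply; rewrite divr_gt0.
  rewrite sub0r normrN gtr0_norm// ler_pdivlMr// in dk.
  pose p := ((cell_of (dx (s k)) x.1)%:~R * dx (s k), (cell_of (dx (s k)) x.2)%:~R * dx (s k)).
  have h1 : `|rho b (0, x) - rho b (0, p)| <= K * (dx (s k) + dx (s k)).
    apply: (le_trans (rl b _ _)); rewrite /= subrr normr0 add0r ler_wpM2l// lerD//; exact: cell_of_dist.
  have h2 : `|regularized_datum M (rho0 b) p - regularized_datum M (rho0 b) x| <= K0 * (dx (s k) + dx (s k)).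
    apply: (le_trans (datum_lip b _ _)); rewrite ler_wpM2l// distrC (distrC p.2) lerD//; exact: cell_of_dist.
  have h3 := ck b (0, p); rewrite /p U0 -/p distrC in h3.
  rewrite (_ : rho b (0, x) - _ = (rho b (0, x) - rho b (0, p)) + (rho b (0, p) - regularized_datum M (rho0 b) p)
     + (regularized_datum M (rho0 b) p - regularized_datum M (rho0 b) x)); last by ring.
  apply: (le_trans (ler_normD _ _)); apply: (le_trans (lerD (ler_normD _ _) (lexx _))).
  apply: (le_trans (lerD (lerD h1 h3) h2)); have := dx0 (s k); nra.
Unshelve. all: by end_near. Qed.
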